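(* For every hyperplane $H\subset\mathbf{R}^{12}$ (linear subspace of dimension 11), the restriction of the function $w$ to $H\cong\mathbf{R}^{11}$ is a viscosity solution in the unit ball $B\subset\mathbf{R}^{11}$ of a uniformly elliptic (not necessarily Hessian) equation $F(D^2u)=0$, where $F$ is a $C^\infty$ function on $S^2(\mathbf{R}^{11})$.
   Context: Identify $\mathbf{R}^{12}$ with $\mathbf{H}^3$, where $\mathbf{H}$ is the algebra of Hamilton quaternions, identified with $\mathbf{R}^4$ via $(t_0,t_1,t_2,t_3)\mapsto t_0+t_1i+t_2j+t_3k$. For $x=(q_1,q_2,q_3)\in\mathbf{H}^3$ set $w(x)=\mathrm{Re}(q_1q_2q_3)/|x|$ for $x\ne0$, and $w(0)=0$. The hyperplane $H$ with the induced Euclidean structure is identified isometrically with $\mathbf{R}^{11}$, and $B=\{x\in\mathbf{R}^{11}:|x|<1\}$. $S^2(\mathbf{R}^n)$ is the space of real symmetric $n\times n$ matrices. $F:S^2(\mathbf{R}^n)\to\mathbf{R}$ is uniformly elliptic if there is a constant $C\ge1$ such that $C^{-1}\|N\|\le F(M+N)-F(M)\le C\|N\|$ for all $M\in S^2(\mathbf{R}^n)$ and all non-negative definite $N\in S^2(\mathbf{R}^n)$. ''Not necessarily Hessian'' means that $F$ is not required to satisfy $F({}^tO\,S\,O)=F(S)$ for $O\in O(n)$. A continuous function $u$ on an open set $\Omega$ is a viscosity solution of $F(D^2u)=0$ in $\Omega$ if for every $x_0\in\Omega$ and every $C^2$ function $\varphi$ near $x_0$: $F(D^2\varphi(x_0))\ge0$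 whenever $u-\varphi$ has a local maximum at $x_0$, and $F(D^2\varphi(x_0))\le0$ whenever $u-\varphi$ has a local minimum at $x_0$. *)

(* Defs.v *)
From HB Require Import structures.
From mathcomp Require Import all_boot all_order all_algebra.
From mathcomp Require Import all_classical all_reals all_analysis.
Set Implicit Arguments.
Unset Strict Implicit.
Unset Printing Implicit Defensive.
Import Order.TTheory GRing.Theory Num.Theory numFieldNormedType.Exports.
Local Open Scope classical_set_scope.
Local Open Scope ring_scope.

(* The library norm on 'rV[R]_n is the sup norm, hence a separate Euclidean
   norm; both induce the same topology. *)
Definition enorm (R : realType) (n : nat) (x : 'rV[R]_n) : R :=
  Num.sqrt (\sum_i x 0 i ^+ 2).

Definition unit_eball (R : realType) (n : nat) : set 'rV[R]_n :=
  [set x | enorm x < 1].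

Record quaternion (R : realType) := Quaternion {
  q0 : R; q1 : R; q2 : R; q3 : R }.

Definition qmul (R : realType) (a b : quaternion R) : quaternion R :=
  Quaternion
    (q0 a * q0 b - q1 a * q1 b - q2 a * q2 b - q3 a * q3 b)
    (q0 a * q1 b + q1 a * q0 b + q2 a * q3 b - q3 a * q2 b)
    (q0 a * q2 b - q1 a * q3 b + q2 a * q0 b + q3 a * q1 b)
    (q0 a * q3 b + q1 a * q2 b - q2 a * q1 b + q3 a * q0 b).

Definition qRe (R : realType) (a : quaternion R) : R := q0 a.

(* The m-th component (m = 0, 1, 2) of a vector of R^12 = H^3, read off from
   the coordinates 4m, ..., 4m+3. *)
Definition qcoord (R : realType) (x : 'rV[R]_12) (m : nat) : quaternion R :=
  Quaternion (x 0 (inord (4 * m))) (x 0 (inord (4 * m + 1)))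
             (x 0 (inord (4 * m + 2))) (x 0 (inord (4 * m + 3))).

Definition w (R : realType) (x : 'rV[R]_12) : R :=
  if x == 0 then 0
  else qRe (qmul (qmul (qcoord x 0) (qcoord x 1)) (qcoord x 2)) / enorm x.

(* [Ck k E A f]: f is of class C^k on A, where A is a relatively open subset of
   the linear subspace E of V: all iterated directional derivatives of f of
   order at most k, in directions of E, exist at every point of A and are
   continuous on A.  Only the values of f on E matter. For finite-dimensional E
   this is the usual notion. *)
Fixpoint Ck (R : realType) (V : normedModType R) (k : nat)
    (E A : set V) (f : V -> R) : Prop :=
  {within A, continuous f} /\
  (if k is k'.+1 then
     forall v, E v -> (forall x, A x -> derivable f x v) /\ Ck k' E A ('D_v f)
   else True).

Definition C2_near (R : realType) (n : nat) (x0 : 'rV[R]_n)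
    (phi : 'rV[R]_n -> R) : Prop :=
  exists U : set 'rV[R]_n, [/\ open U, U x0 & Ck 2 setT U phi].

Definition hessian (R : realType) (n : nat) (phi : 'rV[R]_n -> R)
    (x : 'rV[R]_n) : 'M[R]_n :=
  \matrix_(i, j) 'D_(delta_mx 0 i) ('D_(delta_mx 0 j) phi) x.

(* S^2(R^n). A function F on S^2(R^n) is represented by a function on 'M[R]_n
   whose values outside [symmx n] are irrelevant. *)
Definition symmx (R : realType) (n : nat) : set 'M[R]_n :=
  [set M | M^T = M].

Definition nonneg_def (R : realType) (n : nat) (N : 'M[R]_n) : Prop :=
  symmx N /\ forall x : 'rV[R]_n, 0 <= (x *m N *m x^T) 0 0.

Definition smooth_on_sym (R : realType) (n : nat) (F : 'M[R]_n -> R) : Prop :=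
  forall k, Ck k (@symmx R n) (@symmx R n) F.

(* `|N| is the largest absolute value of an entry of N; the choice of the norm
   only affects the constant C. *)
Definition uniformly_elliptic (R : realType) (n : nat)
    (F : 'M[R]_n -> R) : Prop :=
  exists C : R, 1 <= C /\
    forall M N : 'M[R]_n, symmx M -> nonneg_def N ->
      C^-1 * `|N| <= F (M + N) - F M <= C * `|N|.

Definition viscosity_solution (R : realType) (n : nat) (F : 'M[R]_n -> R)
    (Omega : set 'rV[R]_n) (u : 'rV[R]_n -> R) : Prop :=
  {within Omega, continuous u} /\
  forall (x0 : 'rV[R]_n) (phi : 'rV[R]_n -> R), Omega x0 -> C2_near x0 phi ->
    ((\forall x \near x0, u x - phi x <= u x0 - phi x0) ->
       0 <= F (hessian phi x0)) /\
    ((\forall x \near x0, u x0 - phi x0 <= u x - phi x) ->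
       F (hessian phi x0) <= 0).

Definition isometry_onto (R : realType) (m n : nat)
    (iota : 'Hom('rV[R]_m, 'rV[R]_n)) (H : {vspace 'rV[R]_n}) : Prop :=
  limg iota = H /\ forall x, enorm (iota x) = enorm x.

(* Main.v *)
(* Off the origin W = w o iota is smooth and its Hessian f is homogeneous of degree 0, hence determined
   by its values on the unit sphere. It is hyperbolic: for distinct unit vectors a, b the matrix
   f a - f b has a positive direction v, and so has the derivative of f along the sphere. Indeed for v
   orthogonal to a and b the quadratic form of f a - f b is T(a - b, v, v) - (P a - P b) |v| ^ 2, where
   P = Re (q1 q2 q3) and T is its polarization; a four-parameter family of v with
   T(d, v, v) >= |d| |v| ^ 2 / sqrt 3 meets the three linear constraints v _|_ a, v _|_ b, v in H, while
   P a - P b < |d| / sqrt 3.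

   For such an f there is a smooth elliptic F vanishing on its range: a smooth soft minimum G of
   elliptic functions attached to a fine net of the sphere almost vanishes on the range, and is
   corrected there through a smooth retraction. As f is odd, F may be taken odd.

   F (D^2 W) = 0 off the origin gives the viscosity inequalities there. At the origin, oddness of W
   makes the Hessian of a test function touching from above or below semidefinite, and F 0 = 0. *)

Require Import Defs.
From HB Require Import structures.
From mathcomp Require Import all_boot all_order all_algebra.
From mathcomp Require Import all_classical all_reals all_analysis.
From mathcomp Require Import ring lra.
Set Implicit Arguments.
Unset Strict Implicit.
Unset Printing Implicit Defensive.
Import Order.TTheory GRing.Theory Num.Theory numFieldNormedType.Exports.
Local Open Scope classical_set_scope.
Local Open Scope ring_scope.

(** * Functions of class C^k on an open set *)

(** The difficulty is smoothness. A Lipschitz elliptic function vanishing on the range of [f] is an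
    infimum of elliptic functions, one for each point of the sphere; smoothing destroys the zero on
    the range, and restoring it costs a correction whose derivative must stay below the ellipticity
    constant. Size alone does not control this derivative. Each tent is therefore nonnegative on the
    range, touches it quadratically and has second differences bounded above; a net of mesh [rho]
    then gives an error of order [rho ^ 2], semiconcave along the range, hence of slope [rho].

    The number 1 / sqrt 3 has two sources: it is the maximum of |grad P| on the unit sphere, as 3
    (ab + bc + ca) <= (a + b + c) ^ 2 for the squared lengths of three quaternions, and the longest
    of the three components of [d] has length at least |d| / sqrt 3. For distinct points the
    comparison is strict. For tangent vectors it can be an equality, where the family gives only the
    value 0; this case is rigid enough to be described explicitly, and another four-parameter family
    serves there. *)

Section Smoothness.
Variables (R : realType) (V : normedModType R).
Implicit Types (A B : set V) (f g : V -> R).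

(* Unlike in [Ck], all directions are allowed and continuity at a point of [A] is not relative
   to [A]. *)
Fixpoint CkO (k : nat) A f : Prop :=
  (forall x, A x -> {for x, continuous f}) /\
  (if k is k'.+1 then
     forall v, (forall x, A x -> derivable f x v) /\ CkO k' A ('D_v f)
   else True).

Lemma CkO_cont k A f x : CkO k A f -> A x -> {for x, continuous f}.
Proof. by case: k => [|k] [+ _] Ax; apply. Qed.

Lemma CkO_derivable k A f x v : CkO k.+1 A f -> A x -> derivable f x v.
Proof. by case=> _ /(_ v)[+ _] Ax; apply. Qed.

Lemma CkO_derive k A f v : CkO k.+1 A f -> CkO k A ('D_v f).
Proof. by case=> _ /(_ v)[]. Qed.

Lemma CkO_pred k A f : CkO k.+1 A f -> CkO k A f.
Proof.
elim: k f => [|k IH] f [fc fd]; first by split.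
by split=> // v; have [dv cv] := fd v; split=> //; apply: IH.
Qed.

Lemma CkO_leq k l A f : (l <= k)%N -> CkO k A f -> CkO l A f.
Proof.
elim: k => [|k IH]; first by rewrite leqn0 => /eqP ->.
by rewrite leq_eqVlt => /predU1P[-> //|/IH H] /CkO_pred.
Qed.

Lemma CkO_sub k A B f : B `<=` A -> CkO k A f -> CkO k B f.
Proof.
move=> BA; elim: k f => [|k IH] f [fc fd]; split=> //; try by move=> x /BA /fc.
by move=> v; have [dv cv] := fd v; split=> [x /BA /dv //|]; apply: IH.
Qed.

(** Used for gluing: the correction term has different descriptions on two overlapping open sets. *)
Lemma CkO_local k A f :
  (forall x, A x -> exists B, [/\ open B, B x & CkO k B f]) -> CkO k A f.
Proof.
elim: k f => [|k IH] f H.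
  by split=> // x /H [B [_ Bx [+ _]]]; apply.
split=> [x /H [B [_ Bx [+ _]]]|v]; first by apply.
split=> [x /H [B [_ Bx fB]]|]; first exact: CkO_derivable fB Bx.
apply: IH => x /H [B [oB Bx fB]]; exists B; split=> //.
exact: CkO_derive fB.
Qed.

Lemma CkO_ext k A f g : open A -> (forall x, A x -> f x = g x) ->
  CkO k A f -> CkO k A g.
Proof.
move=> oA; elim: k f g => [|k IH] f g fg [fc fd];
  have nfg x : A x -> \near x, f x = g x.
- by move=> Ax; have := open_nbhs_nbhs (conj oA Ax); apply: filterS => y /fg.
- split=> // x Ax; have := fc x Ax; rewrite /prop_for /continuous_at fg//.
  by apply: cvg_trans; exact: near_eq_cvg (nfg _ Ax).
- by move=> Ax; have := open_nbhs_nbhs (conj oA Ax); apply: filterS => y /fg.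
split=> [x Ax|v].
  have := fc x Ax; rewrite /prop_for /continuous_at fg//.
  by apply: cvg_trans; exact: near_eq_cvg (nfg _ Ax).
have [dv cv] := fd v; split=> [x Ax|].
  exact: near_eq_derivable (nfg _ Ax) (dv _ Ax).
by apply: IH cv => x Ax; apply: near_eq_derive; apply: nfg.
Qed.

Lemma CkO_succ k A f : open A -> (forall x, A x -> {for x, continuous f}) ->
  (forall v, exists g, (forall x, A x -> is_derive x v f (g x)) /\ CkO k A g) ->
  CkO k.+1 A f.
Proof.
move=> oA fc H; split=> // v; have [g [fg gC]] := H v; split.
  by move=> x /fg [].
by apply: CkO_ext gC => // x /fg [].
Qed.

Lemma CkO_cst k A (c : R) : CkO k A (fun=> c).
Proof.
elim: k c => [|k IH] c; split=> //; try by move=> x _; exact: cst_continuous.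
move=> v; split=> [x _|]; first exact: derivable_cst.
have -> : 'D_v (fun=> c) = (fun=> 0) :> (V -> R).
  by apply/funext => x; exact: derive_cst.
exact: IH.
Qed.

Lemma CkO_linear k A f : (forall a x y, f (a *: x + y) = a * f x + f y) ->
  continuous f -> CkO k A f.
Proof.
move=> fl fc.
have fD x v : is_derive x v f (f v).
  have H : (fun h : R => h^-1 *: ((f \o shift x) (h *: v) - f x)) @ 0^' --> f v.
    apply: cvg_near_cst; near=> h.
    rewrite /= fl addrK /GRing.scale /= mulKf//.
    by near: h; exact: nbhs_dnbhs_neq.
  split; first by apply/cvg_ex; exists (f v).
  exact/cvg_lim.
case: k => [|k]; (split; first by move=> x _; exact: fc) => // v.
split=> [x _|]; first by case: (fD x v).
have -> : 'D_v f = (fun=> f v) by apply/funext => x; case: (fD x v).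
exact: CkO_cst.
Unshelve. all: by end_near. Qed.


Lemma CkO_add k A f g : open A ->
  CkO k A f -> CkO k A g -> CkO k A (fun x => f x + g x).
Proof.
move=> oA; elim: k f g => [|k IH] f g cf cg.
  by split=> // x Ax; apply: cvgD; [apply: CkO_cont cf Ax|apply: CkO_cont cg Ax].
apply: CkO_succ => // [x Ax|v].
  by apply: cvgD; [apply: CkO_cont cf Ax|apply: CkO_cont cg Ax].
exists (fun x => 'D_v f x + 'D_v g x); split=> [x Ax|].
  by apply: is_deriveD; apply: derivableP;
    [exact: CkO_derivable cf Ax|exact: CkO_derivable cg Ax].
by apply: IH; apply: CkO_derive.
Qed.

Lemma CkO_mul k A f g : open A ->
  CkO k A f -> CkO k A g -> CkO k A (fun x => f x * g x).
Proof.
move=> oA; elim: k f g => [|k IH] f g cf cg.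
  by split=> // x Ax; apply: cvgM; [apply: CkO_cont cf Ax|apply: CkO_cont cg Ax].
apply: CkO_succ => // [x Ax|v].
  by apply: cvgM; [apply: CkO_cont cf Ax|apply: CkO_cont cg Ax].
exists (fun x => f x * 'D_v g x + g x * 'D_v f x); split=> [x Ax|].
  have /derivableP df : derivable f x v := CkO_derivable cf Ax.
  have /derivableP dg : derivable g x v := CkO_derivable cg Ax.
  exact: is_deriveM.
apply: CkO_add => //; apply: IH; try exact: CkO_pred; exact: CkO_derive.
Qed.

Lemma CkO_scale k A f c : open A -> CkO k A f -> CkO k A (fun x => c * f x).
Proof. by move=> oA; apply: CkO_mul => //; exact: CkO_cst. Qed.

Lemma CkO_opp k A f : open A -> CkO k A f -> CkO k A (fun x => - f x).
Proof.
move=> oA /(@CkO_scale _ _ _ (-1) oA); apply: CkO_ext => // x _.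
by rewrite mulN1r.
Qed.

Lemma CkO_sub2 k A f g : open A ->
  CkO k A f -> CkO k A g -> CkO k A (fun x => f x - g x).
Proof. by move=> oA cf cg; apply: CkO_add => //; exact: CkO_opp. Qed.

Lemma CkO_exprn k A f n : open A -> CkO k A f -> CkO k A (fun x => f x ^+ n).
Proof.
move=> oA cf; elim: n => [|n IH].
  by apply: CkO_ext (@CkO_cst k A 1) => // x _; rewrite expr0.
by apply: CkO_ext (CkO_mul oA cf IH) => // x _; rewrite exprS.
Qed.

Lemma CkO_sum k A (I : Type) (r : seq I) (P : pred I) (h : I -> V -> R) :
  open A -> (forall i, P i -> CkO k A (h i)) ->
  CkO k A (fun x => \sum_(i <- r | P i) h i x).
Proof.
move=> oA H; elim: r => [|i r IH].
  by apply: CkO_ext (@CkO_cst k A 0) => // x _; rewrite big_nil.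
case: (boolP (P i)) => Pi.
  by apply: CkO_ext (CkO_add oA (H i Pi) IH) => // x _; rewrite big_cons Pi.
by apply: CkO_ext IH => // x _; rewrite big_cons (negbTE Pi).
Qed.

Lemma CkO_prod k A (I : Type) (r : seq I) (P : pred I) (h : I -> V -> R) :
  open A -> (forall i, P i -> CkO k A (h i)) ->
  CkO k A (fun x => \prod_(i <- r | P i) h i x).
Proof.
move=> oA H; elim: r => [|i r IH].
  by apply: CkO_ext (@CkO_cst k A 1) => // x _; rewrite big_nil.
case: (boolP (P i)) => Pi.
  by apply: CkO_ext (CkO_mul oA (H i Pi) IH) => // x _; rewrite big_cons Pi.
by apply: CkO_ext IH => // x _; rewrite big_cons (negbTE Pi).
Qed.

Lemma is_derive_line f (x v : V) (t : R) : derivable f (x + t *: v) v ->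
  is_derive t 1 (fun s : R => f (x + s *: v)) ('D_v f (x + t *: v)).
Proof.
move=> df.
have E : (fun h : R => h^-1 *: (((fun s : R => f (x + s *: v)) \o shift t) (h *: (1 : R))
     - f (x + t *: v))) =
   (fun h : R => h^-1 *: ((f \o shift (x + t *: v)) (h *: v) - f (x + t *: v))).
  apply/funext => h /=.
  by rewrite -[h *: 1]/(h * 1) mulr1 scalerDl addrCA.
by split; rewrite /derivable /derive E.
Qed.

Lemma MVT_line f (x v : V) :
  (forall t : R, 0 <= t <= 1 -> derivable f (x + t *: v) v) ->
  exists2 c : R, 0 <= c <= 1 & f (x + v) - f x = 'D_v f (x + c *: v).
Proof.
move=> df.
have dg (t : R) : 0 <= t <= 1 ->
    is_derive t 1 (fun s : R => f (x + s *: v)) ('D_v f (x + t *: v)).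
  by move=> /df /is_derive_line.
have [//|t|c|c] := @MVT_segment R (fun s : R => f (x + s *: v))
    (fun t => 'D_v f (x + t *: v)) 0 1.
- by rewrite in_itv /= => /andP[t0 t1]; apply: dg; rewrite !ltW.
- apply: derivable_within_continuous => t; rewrite in_itv /= => tI.
  by have [] := dg t tI.
rewrite in_itv /= => cI; rewrite scale1r scale0r addr0 subr0 mulr1 => ->.
by exists c.
Qed.

(** Differentiating along [v] is differentiating [h |-> f (h *: v + x)] at 0, so the one-variable
    chain rule suffices in any normed space. *)
Lemma is_derive_comp1 (psi : R -> R) (dpsi : R) f x v df :
  is_derive (f x) 1 psi dpsi -> is_derive x v f df ->
  is_derive x v (fun y => psi (f y)) (dpsi * df).
Proof.
move=> dp [dfe dfv].
have H : is_derive (0 : R) 1 (fun h : R => f (h *: v + x)) df.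
  split; first exact: (derivable1P f x v).1.
  rewrite -dfv /derive; apply: (congr1 (fun g : R -> R => lim (g @ 0^'))); apply/funext => h /=.
  by rewrite addr0 scale0r add0r [h *: 1]mulr1.
have dp' : is_derive (f (0 *: v + x)) 1 psi dpsi by rewrite scale0r add0r.
have [H1 H2] := @is_derive1_comp R psi (fun h : R => f (h *: v + x)) 0 _ _ dp' H.
split; first exact: (derivable1P (fun y => psi (f y)) x v).2.
rewrite -H2 /derive; apply: (congr1 (fun g : R -> R => lim (g @ 0^'))); apply/funext => h /=.
by rewrite addr0 scale0r add0r [h *: 1]mulr1.
Qed.

(** The outer function comes with the sequence [psi j] of its successive derivatives, so that the
    induction on [k] may pass from [psi j] to [psi j.+1]. Meant for functions such as [flat], whose
    derivatives are new functions at every order. *)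
Lemma CkO_comp1 (psi : nat -> R -> R) (B : set R) :
  (forall j t, B t -> is_derive t 1 (psi j) (psi j.+1 t)) ->
  forall k j A f, open A -> (forall x, A x -> B (f x)) -> CkO k A f ->
  CkO k A (fun x => psi j (f x)).
Proof.
move=> dpsi.
have cpsi j t : B t -> {for t, continuous (psi j)}.
  move=> /(dpsi j) [d _]; apply: differentiable_continuous.
  exact/derivable1_diffP.
elim=> [|k IH] j A f oA AB cf.
  split=> // x Ax; apply: (@continuous_comp _ _ _ f (psi j)).
    exact: CkO_cont cf Ax.
  exact/cpsi/AB.
apply: CkO_succ => // [x Ax|v].
  apply: (@continuous_comp _ _ _ f (psi j)); first exact: CkO_cont cf Ax.
  exact/cpsi/AB.
exists (fun x => psi j.+1 (f x) * 'D_v f x); split=> [x Ax|].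
  apply: is_derive_comp1; first exact/dpsi/AB.
  exact/derivableP/(CkO_derivable cf).
by apply: CkO_mul => //; [apply: IH => //; exact: CkO_pred|exact: CkO_derive].
Qed.

(** For an outer function whose derivative is an expression in the function itself, as for the
    inverse, the exponential and the square root: the smoothness of [psi (f x)] just obtained by
    induction is handed over to prove that of [dpsi (f x)], and no sequence of derivatives is
    written down. *)
Lemma CkO_comp1_step (psi : R -> R) (dpsi : R -> R) (B : set R) :
  (forall t, B t -> is_derive t 1 psi (dpsi t)) ->
  (forall k A f, open A -> (forall x, A x -> B (f x)) ->
     CkO k.+1 A f -> CkO k A (fun x => psi (f x)) ->
     CkO k A (fun x => dpsi (f x))) ->
  forall k A f, open A -> (forall x, A x -> B (f x)) -> CkO k A f ->
  CkO k A (fun x => psi (f x)).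
Proof.
move=> dpsiP H.
have cpsi t : B t -> {for t, continuous psi}.
  move=> /dpsiP [d _]; apply: differentiable_continuous.
  exact/derivable1_diffP.
elim=> [|k IH] A f oA AB cf.
  split=> // x Ax; apply: (@continuous_comp _ _ _ f psi).
    exact: CkO_cont cf Ax.
  exact/cpsi/AB.
apply: CkO_succ => // [x Ax|v].
  apply: (@continuous_comp _ _ _ f psi); first exact: CkO_cont cf Ax.
  exact/cpsi/AB.
exists (fun x => dpsi (f x) * 'D_v f x); split=> [x Ax|].
  apply: is_derive_comp1; first exact/dpsiP/AB.
  exact/derivableP/(CkO_derivable cf).
apply: CkO_mul => //; last exact: CkO_derive.
by apply: H => //; apply: IH => //; exact: CkO_pred.
Qed.

Lemma CkO_inv k A f : open A -> (forall x, A x -> f x != 0) ->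
  CkO k A f -> CkO k A (fun x => (f x)^-1).
Proof.
apply: (@CkO_comp1_step (fun t => t^-1) (fun t => - (t^-1 ^+ 2)) [set t | t != 0]).
  move=> t /= t0; have := @is_deriveV R id t 1 1 t0 (is_derive_id _ _).
  by move=> H; apply: is_derive_eq H _; rewrite /GRing.scale /= mulr1 exprVn.
move=> {}k {}A {}f oA _ _ H.
by apply: CkO_opp => //; apply: CkO_exprn.
Qed.

Lemma CkO_expR k A f : open A -> CkO k A f -> CkO k A (fun x => expR (f x)).
Proof.
move=> oA; exact: (@CkO_comp1_step expR expR setT).
Qed.

Lemma CkO_ln k A f : open A -> (forall x, A x -> 0 < f x) ->
  CkO k A f -> CkO k A (fun x => ln (f x)).
Proof.
apply: (@CkO_comp1_step (@ln R) (fun t => t^-1) [set t | 0 < t]).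
move=> {}k {}A {}f oA fp cf _.
by apply: CkO_inv => // [x /fp /lt0r_neq0 //|]; exact: CkO_pred.
Qed.

Lemma CkO_sqrt k A f : open A -> (forall x, A x -> 0 < f x) ->
  CkO k A f -> CkO k A (fun x => Num.sqrt (f x)).
Proof.
apply: (@CkO_comp1_step (@Num.sqrt R) (fun t => (2 * Num.sqrt t)^-1)
  [set t | 0 < t]).
move=> {}k {}A {}f oA fp _ cf.
apply: CkO_inv => // [x /fp fx|]; last exact: CkO_scale.
by rewrite mulf_neq0// sqrtr_eq0 -ltNge.
Qed.

End Smoothness.

Lemma CkO_Ck (R : realType) (V : normedModType R) k (E A : set V) (f : V -> R) :
  CkO k setT f -> Ck k E A f.
Proof.
elim: k f => [|k IH] f cf; (split; first by
  apply: continuous_subspaceT => x; exact: CkO_cont cf I) => //.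
move=> v _; split=> [x _|]; first exact: CkO_derivable cf I.
by apply: IH; exact: CkO_derive.
Qed.

Lemma Ck_CkO (R : realType) (V : normedModType R) k (A : set V) (f : V -> R) :
  open A -> Ck k setT A f -> CkO k A f.
Proof.
move=> oA; elim: k f => [|k IH] f [fc fd].
  split=> // x Ax; move: fc; rewrite continuous_open_subspace//; apply.
  exact/mem_set.
split=> [x Ax|v].
  by move: fc; rewrite continuous_open_subspace//; apply; exact/mem_set.
by have [dv cv] := fd v Logic.I; split=> //; exact: IH.
Qed.

(** * The sup norm and entrywise limits *)

Section MatrixNorm.
Variables (R : realType).

Lemma ler_entry_norm m n (x : 'M[R]_(m, n)) i j : `|x i j| <= `|x|.
Proof.
rewrite [leRHS]/Num.norm /= mx_normrE.
exact: (le_bigmax _ (fun ij => `|x ij.1 ij.2|) (i, j)).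
Qed.

Lemma ler_norm_entry m n (x : 'M[R]_(m, n)) c :
  0 <= c -> (forall i j, `|x i j| <= c) -> `|x| <= c.
Proof.
move=> c0 H; rewrite [leLHS]/Num.norm /= mx_normrE.
by apply/bigmax_leP; split => // ij _; exact: H.
Qed.

Lemma cvg_mx (T : Type) (F : set_system T) (FF : Filter F) m n
  (f : T -> 'M[R]_(m, n)) (l : 'M[R]_(m, n)) :
  (forall i j, f x i j @[x --> F] --> l i j) -> f @ F --> l.
Proof.
move=> H; apply/cvgrPdist_le => e e0.
have : \forall x \near F, forall ij, `|l ij.1 ij.2 - f x ij.1 ij.2| <= e.
  apply: (@filter_forall T ('I_m * 'I_n)%type
    (fun ij x => `|l ij.1 ij.2 - f x ij.1 ij.2| <= e) F FF) => -[i j] /=.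
  by have /cvgrPdist_le := H i j; apply.
apply: filterS => x Hx; apply: ler_norm_entry; first exact: ltW.
by move=> i j; have := Hx (i, j); rewrite /= !mxE.
Qed.

Lemma cvg_sumr (T : Type) (F : set_system T) (FF : Filter F) (I : Type)
  (r : seq I) (P : pred I) (f : I -> T -> R) (l : I -> R) :
  (forall i, P i -> f i x @[x --> F] --> l i) ->
  \sum_(i <- r | P i) f i x @[x --> F] --> \sum_(i <- r | P i) l i.
Proof.
move=> H; apply: (@cvg_big _ I +%R 0 P _ T F r f l FF) => //.
exact: add_continuous.
Qed.

End MatrixNorm.

(** * Differentiability in several variables and the chain rule *)

Section Caratheodory.
Variables (R : realType) (m : nat).
Implicit Types (z h : 'rV[R]_m) (A : set 'rV[R]_m) (phi : 'rV[R]_m -> R).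

Local Notation e_ k := (delta_mx 0 k : 'rV[R]_m).

Lemma is_derive_scale (V : normedModType R) (f : V -> R) x v (c df : R) :
  is_derive x v f df -> is_derive x (c *: v) f (c * df).
Proof.
move=> dv.
have d1 : is_derive (c * 0) 1 (fun s : R => f (x + s *: v)) df.
  have := @is_derive_line R V f x v (c * 0).
  rewrite mulr0 scale0r addr0 => H.
  by case: dv => [/H [h1 h2] <-].
have d2 : is_derive (0 : R) 1 (fun s => c * s) c.
  have := @is_deriveZ R R R id c 0 1 1 (is_derive_id _ _).
  by move=> H; apply: is_derive_eq H _; rewrite [_ *: _]mulr1.
have := @is_derive1_comp R (fun s : R => f (x + s *: v)) (fun s => c * s) 0 _ _ d1 d2.
have -> : (fun s : R => f (x + s *: v)) \o (fun s => c * s)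
  = (fun s : R => f (s *: (c *: v) + x)).
  by apply/funext => s /=; rewrite addrC scalerA mulrC.
move=> [h1 h2]; split; first exact: (derivable1P _ _ _).2.
rewrite mulrC -h2 /derive.
apply: (congr1 (fun g : R -> R => lim (g @ 0^'))); apply/funext => h /=.
by rewrite addr0 scale0r add0r [h *: 1]mulr1.
Qed.

(** Changing one coordinate at a time and applying the mean value theorem to each change gives
    coefficients that are partial derivatives at intermediate points. The increment of [phi] becomes
    an exact combination of the coordinates of [h], an identity that survives division by a
    parameter; the chain rule and the derivative of the minimizer rest on it. *)
Lemma caratheodory phi A z : open A -> A z -> CkO 1 A phi ->
  exists psi : 'I_m -> 'rV[R]_m -> R,
    (forall j, psi j h @[h --> (0 : 'rV[R]_m)] --> 'D_(e_ j) phi z) /\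
    (\forall h \near (0 : 'rV[R]_m), phi (z + h) - phi z = \sum_j h 0 j * psi j h).
Proof.
move=> oA Az cphi.
have /nbhs_ballP[r /= r0 rA] : nbhs z A by exact: open_nbhs_nbhs.
have near0 (e : R) : 0 < e -> \forall h \near (0 : 'rV[R]_m), `|h| < e.
  move=> e0; apply/nbhs_ballP; exists e => // h.
  by rewrite -ball_normE /ball_ /= sub0r normrN.
(* [s k h] keeps the first [k] coordinates of [h]: a path from 0 to [h] by steps along the basis
   vectors. *)
pose s (k : nat) h : 'rV[R]_m := \row_j (if (j < k)%N then h 0 j else 0).
have s0 h : s 0%N h = 0 by apply/rowP => j; rewrite !mxE.
have sm h : s m h = h by apply/rowP => j; rewrite !mxE ltn_ord.
have sS h (k : 'I_m) : s k.+1 h = s k h + h 0 k *: e_ k.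
  apply/rowP => j; rewrite !mxE eqxx /= ltnS leq_eqVlt val_eqE.
  have [->|jk] := eqVneq j k; rewrite /= ?eqxx ?ltnn ?add0r ?mulr1//.
  by rewrite mulr0 addr0.
have norm_s h (k : 'I_m) (t : R) : 0 <= t <= 1 ->
    `|s k h + t *: (h 0 k *: e_ k)| <= `|h|.
  move=> /andP[t0 t1]; apply: ler_norm_entry => // i j; rewrite !mxE ord1 eqxx /=.
  have [->|jk] := eqVneq j k; rewrite /= ?eqxx ?ltnn.
    rewrite add0r mulr1 normrM ger0_norm//.
    by apply: le_trans (ler_entry_norm h 0 k); rewrite ler_piMl.
  rewrite !mulr0 addr0; case: ifP => _; first exact: ler_entry_norm.
  by rewrite normr0.
have : forall h, exists xi : 'I_m -> 'rV[R]_m, `|h| < r -> forall k : 'I_m,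
    `|xi k - z| <= `|h| /\
    phi (z + s k.+1 h) - phi (z + s k h) = h 0 k * 'D_(e_ k) phi (xi k).
  (* For [h] outside the ball nothing is asked of [xi]; 0 is a default. *)
  move=> h; have [hr|] := ltP `|h| r; last by exists (fun=> 0) => //.
  suff /choice[xi Hxi] : forall k : 'I_m, exists y, `|y - z| <= `|h| /\
    phi (z + s k.+1 h) - phi (z + s k h) = h 0 k * 'D_(e_ k) phi y.
    by exists xi.
  move=> k.
  have inA t : 0 <= t <= 1 -> A (z + s k h + t *: (h 0 k *: e_ k)).
    move=> /(norm_s h k) Hn; apply: rA; rewrite -ball_normE /ball_ /=.
    by rewrite -addrA opprD addNKr normrN (le_lt_trans Hn).
  have dk t : 0 <= t <= 1 ->
      derivable phi (z + s k h + t *: (h 0 k *: e_ k)) (e_ k).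
    by move=> /inA; exact: CkO_derivable cphi.
  have dk' t (tI : 0 <= t <= 1) := is_derive_scale (h 0 k) (derivableP (dk t tI)).
  have [|c cI Hc] := @MVT_line R _ phi (z + s k h) (h 0 k *: e_ k).
    by move=> t tI; have [] := dk' t tI.
  exists (z + s k h + c *: (h 0 k *: e_ k)); split.
    by rewrite [X in `|X|]addrC addrA addKr; exact: norm_s.
  by rewrite sS addrA Hc; have [_ ->] := dk' c cI.
move=> /choice[xi Hxi].
exists (fun k h => 'D_(e_ k) phi (xi h k)); split=> [j|]; last first.
  apply: filterS (near0 r r0) => h hr.
  rewrite -[in LHS](sm h) -[X in _ - phi X]addr0 -(s0 h).
  rewrite -(telescope_sumr (fun k => phi (z + s k h))) // big_mkord.
  by apply: eq_bigr => k _; have [_] := Hxi h hr k.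
have cD : 'D_(e_ j) phi x @[x --> z] --> 'D_(e_ j) phi z.
  exact: (CkO_cont (CkO_derive (e_ j) cphi) Az).
have xlim : xi h j @[h --> (0 : 'rV[R]_m)] --> z.
  apply/(@cvgrPdist_lt _ _ _ (nbhs (0 : 'rV[R]_m)) (nbhs_filter (0 : 'rV[R]_m))) => e e0.
  apply: filterS2 (near0 r r0) (near0 e e0) => h hr he.
  by have [Hx _] := Hxi h hr j; rewrite distrC (le_lt_trans Hx).
exact: (@cvg_comp _ _ _ (fun h => xi h j) ('D_(e_ j) phi) _ _ _ xlim cD).
Qed.

(** The difference quotient of [phi (Z y)] is the sum of the coordinate quotients of [Z] times the
    Caratheodory coefficients at the increment of [Z]; both factors converge. *)
Lemma is_derive_chain (V : normedModType R) phi A (Z : V -> 'rV[R]_m)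
    (dZ : 'rV[R]_m) x v :
  open A -> A (Z x) -> CkO 1 A phi ->
  (forall j, is_derive x v (fun y => Z y 0 j) (dZ 0 j)) ->
  is_derive x v (fun y => phi (Z y)) (\sum_j dZ 0 j * 'D_(e_ j) phi (Z x)).
Proof.
move=> oA AZ cphi dZP.
have [psi [psi_lim psiE]] := caratheodory oA AZ cphi.
pose q j (h : R) := h^-1 *: (((fun y => Z y 0 j) \o shift x) (h *: v) - Z x 0 j).
have qlim j : q j h @[h --> 0^'] --> dZ 0 j.
  by case: (dZP j) => d <-; exact: d.
have Zlim : (Z (h *: v + x) - Z x) @[h --> 0^'] --> (0 : 'rV[R]_m).
  apply: cvg_mx => i j; rewrite ord1 !mxE.
  have : h * q j h @[h --> (0 : R)^'] --> 0 * dZ 0 j.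
    apply: cvgM; last exact: qlim.
    apply/cvgrPdist_lt => e e0; near=> t; rewrite sub0r normrN.
    by near: t; exact: dnbhs0_lt.
  rewrite mul0r; apply: cvg_trans; apply: near_eq_cvg; near=> h.
  rewrite /q /= !mxE [_ *: _]/(_ * _) mulrA mulfV ?mul1r//.
  by near: h; exact: nbhs_dnbhs_neq.
have H : (fun h : R => h^-1 *: (((fun y => phi (Z y)) \o shift x) (h *: v) - phi (Z x)))
    @ 0^' --> \sum_j dZ 0 j * 'D_(e_ j) phi (Z x).
  have : \sum_j q j h * psi j (Z (h *: v + x) - Z x) @[h --> (0 : R)^'] -->
      \sum_j dZ 0 j * 'D_(e_ j) phi (Z x).
    apply: cvg_sumr => j _; apply: cvgM; first exact: qlim.
    exact: (@cvg_comp _ _ _ (fun h : R => Z (h *: v + x) - Z x) (psi j) _ _ _ Zlim (psi_lim j)).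
  apply: cvg_trans; apply: near_eq_cvg.
  have : \forall h \near (0 : R)^', phi (Z x + (Z (h *: v + x) - Z x)) - phi (Z x)
      = \sum_j (Z (h *: v + x) - Z x) 0 j * psi j (Z (h *: v + x) - Z x).
    exact: Zlim psiE.
  apply: filterS => h; rewrite addrCA subrr addr0 /= => ->.
  rewrite scaler_sumr; apply: eq_bigr => j _.
  by rewrite /q /= !mxE [in RHS]/GRing.scale /= mulrA.
by split; [apply/cvg_ex; eexists; exact: H|exact/cvg_lim].
Unshelve. all: by end_near. Qed.

Lemma derive_rowE phi A z v : open A -> A z -> CkO 1 A phi ->
  'D_v phi z = \sum_j v 0 j * 'D_(e_ j) phi z.
Proof.
move=> oA Az cphi.
have [|_ <- //] := @is_derive_chain _ phi A id v z v oA Az cphi.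
move=> j; have := @is_derive_line R _ (fun y : 'rV[R]_m => y 0 j) z v 0.
have H : is_derive z v (fun y : 'rV[R]_m => y 0 j) (v 0 j).
  have K : (fun h : R => h^-1 *: (((fun y : 'rV[R]_m => y 0 j) \o shift z) (h *: v) - z 0 j))
      @ 0^' --> v 0 j.
    apply: cvg_near_cst; near=> h.
    rewrite /= !mxE addrK /GRing.scale /= mulKf//.
    by near: h; exact: nbhs_dnbhs_neq.
  by split; [apply/cvg_ex; eexists; exact: K|exact/cvg_lim].
by [].
Unshelve. all: by end_near. Qed.

Lemma CkO_comp (V : normedModType R) k phi A (B : set V) (Z : V -> 'rV[R]_m) :
  open A -> open B -> (forall x, B x -> A (Z x)) ->
  CkO k A phi -> (forall j, CkO k B (fun y => Z y 0 j)) ->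
  CkO k B (fun y => phi (Z y)).
Proof.
move=> oA oB BA; elim: k phi => [|k IH] phi cphi cZ;
  have Zc x : B x -> Z @ x --> Z x;
  try by (move=> Bx; apply: cvg_mx => i j; rewrite ord1; exact: CkO_cont (cZ j) Bx).
  split=> // x Bx; apply: (@continuous_comp _ _ _ Z phi); first exact: Zc.
  exact: CkO_cont cphi (BA _ Bx).
apply: CkO_succ => // [x Bx|v].
  apply: (@continuous_comp _ _ _ Z phi); first exact: Zc.
  exact: CkO_cont cphi (BA _ Bx).
exists (fun x => \sum_j 'D_v (fun y => Z y 0 j) x * 'D_(e_ j) phi (Z x)); split.
  move=> x Bx.
  have := @is_derive_chain V phi A Z (\row_j 'D_v (fun y => Z y 0 j) x) x v
    oA (BA _ Bx) (CkO_leq (ltn0Sn k) cphi).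
  rewrite (eq_bigr (fun j => 'D_v (fun y => Z y 0 j) x * 'D_(e_ j) phi (Z x)))//; last first.
    by move=> j _; rewrite mxE.
  by apply=> j; rewrite mxE; apply: derivableP; exact: CkO_derivable (cZ j) Bx.
apply: CkO_sum => // j _; apply: CkO_mul => //; first exact: CkO_derive (cZ j).
apply: (IH ('D_(e_ j) phi)) => [|i]; first exact: CkO_derive.
exact: CkO_pred (cZ i).
Qed.

End Caratheodory.

(** * Uniform constants from compactness *)

Section Compactness.
Variable (R : realType).

(** The index [m] stands for a constant: as the property weakens when [m] grows, finitely many local
    constants can be replaced by the largest. In the applications [m.+1%:R] is the constant and its
    inverse a radius or a lower bound. *)
Lemma compact_unif (T : topologicalType) (K : set T) (P : nat -> T -> Prop) :
  compact K ->
  (forall m l x, (m <= l)%N -> P m x -> P l x) ->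
  (forall x, K x -> exists m, \forall y \near x, P m y) ->
  exists m, forall x, K x -> P m x.
Proof.
move=> /compact_near_coveringP cK mono H.
have [|N _ HN] := cK nat \oo P _.
  move=> x /H [m Hm].
  exists ([set y | P m y], [set i | (m <= i)%N]) => /=.
    by split=> //; exists m.
  by move=> [y i] [/= Py mi]; exact: mono mi Py.
by exists N => x Kx; apply: HN => //=.
Qed.

Lemma finite_net (V : normedModType R) (K : set V) (r : R) :
  compact K -> 0 < r ->
  exists s : seq V, (forall y, y \in s -> K y) /\
    forall x, K x -> exists2 y, y \in s & `|x - y| < r.
Proof.
move=> cK r0; move: cK; rewrite compact_cover => cK.
have [|x Kx|D' D'K HD'] := cK V K (fun y => ball y r).
- by move=> y _; exact: ball_open.
- by exists x => //; exact: ballxx.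
exists (finmap.enum_fset D'); split=> [y yD|x Kx].
  by have := D'K y yD; rewrite inE.
have [y /= yD yx] := HD' x Kx; exists y => //.
by rewrite distrC; move: yx; rewrite -ball_normE.
Qed.

End Compactness.

(** * Second differences and second derivatives *)

Section SecondOrder.
Variables (R : realType) (V : normedModType R).
Implicit Types (A : set V) (phi : V -> R).

Lemma derive_scaleE phi x v (c : R) : derivable phi x v ->
  'D_(c *: v) phi x = c * 'D_v phi x.
Proof. by move=> /derivableP /(is_derive_scale c)[]. Qed.

Lemma is_derive_shift_arg phi x v (b : V) (d : R) :
  is_derive (x + b) v phi d -> is_derive x v (fun y => phi (y + b)) d.
Proof.
have E : (fun h : R => h^-1 *: (((fun y => phi (y + b)) \o shift x) (h *: v) - phi (x + b)))
  = (fun h : R => h^-1 *: ((phi \o shift (x + b)) (h *: v) - phi (x + b))).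
  by apply/funext => h /=; rewrite addrA.
by move=> [h1 h2]; split; rewrite /derivable /derive E.
Qed.

(** The mean value theorem is applied to [phi (y + k) - phi y] along [h], then to ['D_h phi] along
    [k]. Symmetry of second derivatives is not assumed, so that it can be deduced from this
    formula. *)
Lemma second_difference A phi z h k : CkO 2 A phi ->
  (forall c c' : R, 0 <= c <= 1 -> 0 <= c' <= 1 -> A (z + c *: h + c' *: k)) ->
  exists c c' : R, [/\ 0 <= c <= 1, 0 <= c' <= 1 &
   phi (z + h + k) - phi (z + h) - phi (z + k) + phi z =
   'D_k ('D_h phi) (z + c *: h + c' *: k)].
Proof.
move=> cphi HA.
have A0 c : 0 <= c <= 1 -> A (z + c *: h).
  by move=> cI; rewrite -[z + _]addr0 -(scale0r k); apply: HA; rewrite // lexx ler01.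
have A1 c : 0 <= c <= 1 -> A (z + c *: h + k).
  by move=> cI; rewrite -[k]scale1r; apply: HA; rewrite // lexx ler01.
have d1 c : 0 <= c <= 1 -> is_derive (z + c *: h) h
    (fun y => phi (y + k) - phi y) ('D_h phi (z + c *: h + k) - 'D_h phi (z + c *: h)).
  move=> cI; apply: is_deriveB.
    apply: is_derive_shift_arg => //; apply/derivableP.
    exact: CkO_derivable cphi (A1 _ cI).
  apply/derivableP; exact: CkO_derivable cphi (A0 _ cI).
have [|c cI E1] := @MVT_line R V (fun y => phi (y + k) - phi y) z h.
  by move=> t /d1 [].
have [|c' c'I E2] := @MVT_line R V ('D_h phi) (z + c *: h) k.
  by move=> t tI; exact: CkO_derivable (CkO_derive _ cphi) (HA _ _ cI tI).
exists c, c'; split=> //; rewrite -E2.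
have [_ <-] := d1 c cI; rewrite -E1; ring.
Qed.

(** A crude remainder, with a factor [c] between 0 and 1 in place of 1 / 2: two applications of the
    mean value theorem suffice, only the order of magnitude being of interest. *)
Lemma taylor1 A phi z h : CkO 2 A phi ->
  (forall c : R, 0 <= c <= 1 -> A (z + c *: h)) ->
  exists c c' : R, [/\ 0 <= c <= 1, 0 <= c' <= 1 &
   phi (z + h) - phi z - 'D_h phi z = c * 'D_h ('D_h phi) (z + c' *: h)].
Proof.
move=> cphi HA.
have [|c cI E1] := @MVT_line R V phi z h.
  by move=> t tI; exact: CkO_derivable cphi (HA _ tI).
have HA' t : 0 <= t <= 1 -> A (z + t *: (c *: h)).
  move=> /andP[t0 t1]; case/andP: cI => c0 c1; rewrite scalerA; apply: HA.
  by rewrite mulr_ge0//= mulr_ile1.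
have dD t : 0 <= t <= 1 -> derivable ('D_h phi) (z + t *: (c *: h)) h.
  by move=> tI; exact: CkO_derivable (CkO_derive _ cphi) (HA' _ tI).
have [|c' c'I E2] := @MVT_line R V ('D_h phi) z (c *: h).
  by move=> t tI; have [] := is_derive_scale c (derivableP (dD t tI)).
exists c, (c' * c); split=> //.
  case/andP: cI => c0 c1; case/andP: c'I => d0 d1.
  by rewrite mulr_ge0//= mulr_ile1.
by rewrite E1 E2 (derive_scaleE c (dD c' c'I)) scalerA.
Qed.

Let near_small (z h k : V) (e : R) : 0 < e ->
  exists2 t : R, 0 < t & forall c c' : R, 0 <= c <= 1 -> 0 <= c' <= 1 ->
    `|c *: (t *: h) + c' *: (t *: k)| < e.
Proof.
move=> e0; exists (e / (`|h| + `|k| + 1)); first by rewrite divr_gt0// ltr_wpDl// addr_ge0.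
move=> c c' /andP[c0 c1] /andP[d0 d1].
have D0 : 0 < `|h| + `|k| + 1 by rewrite ltr_wpDl// addr_ge0.
have t0 : 0 < e / (`|h| + `|k| + 1) by rewrite divr_gt0.
apply: (le_lt_trans (ler_normD _ _)).
rewrite !normrZ !ger0_norm// ?(ltW t0)//; last exact: ltW.
apply: (@le_lt_trans _ _ (e / (`|h| + `|k| + 1) * `|h| + e / (`|h| + `|k| + 1) * `|k|)).
  by apply: lerD; rewrite ler_piMl// mulr_ge0// ltW.
by rewrite -mulrDr mulrAC ltr_pdivrMr// ltr_pM2l// ltrDl.
Qed.

(** One second difference, read in both orders, equals each mixed derivative at some point near [z];
    continuity brings these points to [z]. *)
Lemma schwarz A phi z u v : open A -> A z -> CkO 2 A phi ->
  'D_u ('D_v phi) z = 'D_v ('D_u phi) z.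
Proof.
have swap (p q r s : R) : p - q - r + s = p - r - q + s by ring.
have close (e p q s : R) : `|p - s| < e / 2 -> `|q - s| < e / 2 -> `|p - q| <= e.
  move=> ps qs; rewrite -(subrKA s) (le_trans (ler_normD _ _))//.
  by rewrite [leRHS](splitr e); apply: lerD; rewrite ?(distrC s) ltW.
move=> oA Az cphi.
have c1 : {for z, continuous ('D_u ('D_v phi))}.
  exact: (CkO_cont (CkO_derive u (CkO_derive v cphi)) Az).
have c2 : {for z, continuous ('D_v ('D_u phi))}.
  exact: (CkO_cont (CkO_derive v (CkO_derive u cphi)) Az).
apply/eqP; rewrite -subr_eq0 -normr_le0; apply/ler_addgt0Pr => e e0; rewrite add0r.
have e20 : 0 < e / 2 by rewrite divr_gt0.
have : \forall y \near z, [/\ A y, `|'D_u ('D_v phi) z - 'D_u ('D_v phi) y| < e / 2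
   & `|'D_v ('D_u phi) z - 'D_v ('D_u phi) y| < e / 2].
  have N1 : nbhs z A by exact: open_nbhs_nbhs.
  have N2 : \forall y \near z, `|'D_u ('D_v phi) z - 'D_u ('D_v phi) y| < e / 2.
    by have /cvgrPdist_lt /(_ _ e20) := c1.
  have N3 : \forall y \near z, `|'D_v ('D_u phi) z - 'D_v ('D_u phi) y| < e / 2.
    by have /cvgrPdist_lt /(_ _ e20) := c2.
  by apply: filterS3 N1 N2 N3 => y; split.
move=> /nbhs_ballP[r /= r0 rH].
have [t t0 Ht] := near_small z u v r0.
have HA c c' : 0 <= c <= 1 -> 0 <= c' <= 1 ->
    ball z r (z + c *: (t *: u) + c' *: (t *: v)).
  move=> cI c'I; rewrite -ball_normE /ball_ /=.
  by rewrite -addrA opprD addNKr normrN; exact: Ht.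
have HA' c c' : 0 <= c <= 1 -> 0 <= c' <= 1 ->
    ball z r (z + c *: (t *: v) + c' *: (t *: u)).
  by move=> cI c'I; rewrite addrAC; exact: HA.
have DD a b y : A y -> 'D_(t *: a) ('D_(t *: b) phi) y = t * (t * 'D_a ('D_b phi) y).
  move=> Ay.
  have -> : 'D_(t *: a) ('D_(t *: b) phi) y = 'D_(t *: a) (fun x => t * 'D_b phi x) y.
    apply: near_eq_derive; have := open_nbhs_nbhs (conj oA Ay).
    by apply: filterS => x Ax; exact: derive_scaleE (CkO_derivable cphi Ax).
  have dd := CkO_derivable (v := a) (CkO_derive b cphi) Ay.
  have /(is_deriveZ t) dd2 := derivableP dd.
  have := is_derive_scale t dd2.
  by move=> [_ ->].
have [|c [c' [cI c'I E1]]] := @second_difference A phi z (t *: u) (t *: v) cphi.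
  by move=> c c' cI c'I; have [] := rH _ (HA _ _ cI c'I).
have [|d [d' [dI d'I E2]]] := @second_difference A phi z (t *: v) (t *: u) cphi.
  by move=> d d' dI d'I; have [] := rH _ (HA' _ _ dI d'I).
have [B1 _ B2] := rH _ (HA _ _ cI c'I).
have [B3 B4 _] := rH _ (HA' _ _ dI d'I).
rewrite DD// in E1; rewrite DD// in E2.
have E : t * (t * 'D_v ('D_u phi) (z + c *: (t *: u) + c' *: (t *: v))) =
  t * (t * 'D_u ('D_v phi) (z + d *: (t *: v) + d' *: (t *: u))).
  apply: (etrans (esym E1)); apply: (etrans _ E2); rewrite (addrAC z (t *: v)); exact: swap.
have tn0 : t != 0 by rewrite gt_eqF.
move: E => /(mulfI tn0) /(mulfI tn0) E; rewrite E in B2.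
exact: close B4 B2.
Qed.

(** A centred second difference is a positive multiple of the second derivative at a nearby point,
    which is therefore not positive there; continuity carries the sign to [z]. *)
Lemma second_derivative_le0 A phi z v : open A -> A z -> CkO 2 A phi ->
  (\forall t \near (0 : R), phi (z + t *: v) + phi (z - t *: v) <= 2 * phi z) ->
  'D_v ('D_v phi) z <= 0.
Proof.
have fin0 (a b c0 d : R) : a - b - b + c0 = d -> a + c0 <= 2 * b -> d <= 0 by move=> ? ?; lra.
have fin (e p q : R) : q <= 0 -> `|p - q| < e -> p <= e by move=> ?; rewrite ltr_norml; lra.
move=> oA Az cphi /nbhs_ballP[r0 /= r0_gt0 H].
have c1 : {for z, continuous ('D_v ('D_v phi))}.
  exact: (CkO_cont (CkO_derive v (CkO_derive v cphi)) Az).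
apply/ler_addgt0Pr => e e0; rewrite add0r.
have N1 : nbhs z A by exact: open_nbhs_nbhs.
have N2 : \forall y \near z, `|'D_v ('D_v phi) z - 'D_v ('D_v phi) y| < e.
  by have /cvgrPdist_lt /(_ _ e0) := c1.
have /nbhs_ballP[r /= r_gt0 rH] : \forall y \near z, A y /\
    `|'D_v ('D_v phi) z - 'D_v ('D_v phi) y| < e.
  by apply: filterS2 N1 N2 => y; split.
pose t := Num.min (r0 / 2) (r / (`|v| + 1)).
have v0 : 0 < `|v| + 1 by rewrite ltr_wpDl.
have t0 : 0 < t by rewrite lt_min !divr_gt0.
have tv : t * `|v| < r.
  apply: (@lt_le_trans _ _ (t * (`|v| + 1))); first by rewrite ltr_pM2l// ltrDl.
  by rewrite -ler_pdivlMr// ge_min lexx orbT.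
have HA c c' : 0 <= c <= 1 -> 0 <= c' <= 1 ->
    ball z r (z - t *: v + c *: (t *: v) + c' *: (t *: v)).
  move=> /andP[a0 a1] /andP[b0 b1]; rewrite -ball_normE /ball_ /=.
  have -> : z - (z - t *: v + c *: (t *: v) + c' *: (t *: v)) = (1 - c - c') *: (t *: v).
    by rewrite !scalerBl scale1r !opprD addrA addrA addrA subrr add0r opprK.
  rewrite normrZ; apply: le_lt_trans tv; rewrite normrZ (ger0_norm (ltW t0)).
  by rewrite ler_piMl ?mulr_ge0 ?(ltW t0)// ler_norml; apply/andP; split; lra.
(* Started at [z - t *: v] with both steps equal to [t *: v], the second difference is the one
   centred at [z]. *)
have [|c [c' [cI c'I E]]] := @second_difference A phi (z - t *: v) (t *: v) (t *: v) cphi.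
  by move=> c c' cI c'I; have [] := rH _ (HA _ _ cI c'I).
have [B1 B2] := rH _ (HA _ _ cI c'I).
have : phi (z + t *: v) + phi (z - t *: v) <= 2 * phi z.
  apply: H; rewrite -ball_normE /ball_ /= sub0r normrN (ger0_norm (ltW t0)).
  by apply: (@le_lt_trans _ _ (r0 / 2)); [rewrite ge_min lexx|rewrite ltr_pdivrMr// ltr_pMr// ltr1n].
move: B1 B2 E; set y := (z - t *: v + c *: (t *: v) + c' *: (t *: v)) => B1 B2 E H1.
have E2 : 'D_(t *: v) ('D_(t *: v) phi) y = t * (t * 'D_v ('D_v phi) y).
  have -> : 'D_(t *: v) ('D_(t *: v) phi) y = 'D_(t *: v) (fun x => t * 'D_v phi x) y.
    apply: near_eq_derive; have := open_nbhs_nbhs (conj oA B1).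
    by apply: filterS => x Ax; exact: derive_scaleE (CkO_derivable cphi Ax).
  have /derivableP dd := CkO_derivable (v := v) (CkO_derive v cphi) B1.
  have := is_derive_scale t (is_deriveZ t dd).
  by move=> [_ ->].
rewrite E2 !subrK in E.
have S := fin0 _ _ _ _ E H1.
have {}S : 'D_v ('D_v phi) y <= 0 by move: S; rewrite !pmulr_rle0.
exact: fin S B2.
Qed.

End SecondOrder.

(** * Uniform Taylor bounds *)

Section Taylor.
Variables (R : realType) (d : nat).
Implicit Types (A K : set 'rV[R]_d) (phi : 'rV[R]_d -> R) (x h z u v : 'rV[R]_d).

Local Notation e_ k := (delta_mx 0 k : 'rV[R]_d).

Lemma derive2_rowE phi A z u v : open A -> A z -> CkO 2 A phi ->
  'D_v ('D_u phi) z =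
  \sum_i \sum_j v 0 i * (u 0 j * 'D_(e_ i) ('D_(e_ j) phi) z).
Proof.
move=> oA Az cphi.
have -> : 'D_v ('D_u phi) z = 'D_v (fun y => \sum_j u 0 j * 'D_(e_ j) phi y) z.
  apply: near_eq_derive; have := open_nbhs_nbhs (conj oA Az).
  by apply: filterS => y Ay; exact: derive_rowE oA Ay (CkO_pred cphi).
have cS : CkO 1 A (fun y => \sum_j u 0 j * 'D_(e_ j) phi y).
  by apply: CkO_sum => // j _; apply: CkO_scale => //; exact: CkO_derive.
rewrite (derive_rowE v oA Az cS); apply: eq_bigr => i _.
rewrite -mulr_sumr; congr (_ * _).
have H j : is_derive z (e_ i) (fun y => u 0 j * 'D_(e_ j) phi y)
    (u 0 j * 'D_(e_ i) ('D_(e_ j) phi) z).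
  have dd := CkO_derivable (v := e_ i) (CkO_derive (e_ j) cphi) Az.
  exact: is_deriveZ (derivableP dd).
have := @is_derive_sum _ _ _ _ (fun j y => u 0 j * 'D_(e_ j) phi y) z (e_ i) _ H.
by rewrite fct_sumE => -[_ ->].
Qed.

Definition taylor_bound A phi (m : nat) x := forall h, `|h| <= m.+1%:R^-1 ->
  [/\ A (x + h), `|phi (x + h) - phi x - 'D_h phi x| <= m.+1%:R * `|h| ^+ 2
    & `|'D_h phi x| <= m.+1%:R * `|h|].

Lemma taylor_bound_mono A phi m l x : (m <= l)%N ->
  taylor_bound A phi m x -> taylor_bound A phi l x.
Proof.
move=> ml H h hl.
have [|H1 H2 H3] := H h.
  by apply: le_trans hl _; rewrite lef_pV2 ?posrE ?ltr0n// ler_nat.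
have mlR : m.+1%:R <= l.+1%:R :> R by rewrite ler_nat.
split=> //; [apply: le_trans H2 _|apply: le_trans H3 _]; exact: ler_wpM2r.
Qed.

Lemma taylor_bound_local A phi z : open A -> A z -> CkO 2 A phi ->
  exists m, \forall x \near z, taylor_bound A phi m x.
Proof.
move=> oA Az cphi.
have N1 : nbhs z A by exact: open_nbhs_nbhs.
pose M2 := \sum_i \sum_j (`|'D_(e_ i) ('D_(e_ j) phi) z| + 1).
pose M1 := \sum_i (`|'D_(e_ i) phi z| + 1).
have N2 : \forall y \near z, forall ij : 'I_d * 'I_d,
    `|'D_(e_ ij.1) ('D_(e_ ij.2) phi) y| <= `|'D_(e_ ij.1) ('D_(e_ ij.2) phi) z| + 1.
  apply: (@filter_forall _ _ (fun ij y => `|'D_(e_ ij.1) ('D_(e_ ij.2) phi) y|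
    <= `|'D_(e_ ij.1) ('D_(e_ ij.2) phi) z| + 1) (nbhs z) (nbhs_filter z)) => -[i j] /=.
  have : {for z, continuous ('D_(e_ i) ('D_(e_ j) phi))}.
    exact: CkO_cont (CkO_derive (e_ i) (CkO_derive (e_ j) cphi)) Az.
  move=> /cvgrPdist_le /(_ _ ltr01); apply: filterS => y.
  have K (a b : R) : `|a - b| <= 1 -> `|b| <= `|a| + 1.
    by move=> ab; rewrite -lerBlDl; apply: le_trans (lerB_dist _ _) _; rewrite distrC.
  exact: K.
have N3 : \forall y \near z, forall i : 'I_d,
    `|'D_(e_ i) phi y| <= `|'D_(e_ i) phi z| + 1.
  apply: (@filter_forall _ _ (fun i y => `|'D_(e_ i) phi y|
    <= `|'D_(e_ i) phi z| + 1) (nbhs z) (nbhs_filter z)) => i /=.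
  have : {for z, continuous ('D_(e_ i) phi)}.
    exact: CkO_cont (CkO_derive (e_ i) cphi) Az.
  move=> /cvgrPdist_le /(_ _ ltr01); apply: filterS => y.
  have K (a b : R) : `|a - b| <= 1 -> `|b| <= `|a| + 1.
    by move=> ab; rewrite -lerBlDl; apply: le_trans (lerB_dist _ _) _; rewrite distrC.
  exact: K.
have B2 h y : A y -> (forall ij : 'I_d * 'I_d,
    `|'D_(e_ ij.1) ('D_(e_ ij.2) phi) y| <= `|'D_(e_ ij.1) ('D_(e_ ij.2) phi) z| + 1) ->
    `|'D_h ('D_h phi) y| <= M2 * `|h| ^+ 2.
  move=> Ay Hy; rewrite (derive2_rowE h h oA Ay cphi).
  rewrite /M2 mulr_suml; apply: le_trans (ler_norm_sum _ _ _) _.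
  apply: ler_sum => i _; rewrite mulr_suml; apply: le_trans (ler_norm_sum _ _ _) _.
  apply: ler_sum => j _; rewrite !normrM mulrA mulrC.
  apply: ler_pM => //; first exact: (Hy (i, j)).
  by rewrite expr2; apply: ler_pM => //; exact: ler_entry_norm.
have B1 h y : A y -> (forall i : 'I_d,
    `|'D_(e_ i) phi y| <= `|'D_(e_ i) phi z| + 1) -> `|'D_h phi y| <= M1 * `|h|.
  move=> Ay Hy; rewrite (derive_rowE h oA Ay (CkO_pred cphi)).
  rewrite /M1 mulr_suml; apply: le_trans (ler_norm_sum _ _ _) _.
  apply: ler_sum => i _; rewrite normrM mulrC.
  by apply: ler_pM => //; exact: ler_entry_norm.
have /nbhs_ballP[r /= r0 rH] : \forall y \near z, [/\ A y, forall ij : 'I_d * 'I_d,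
    `|'D_(e_ ij.1) ('D_(e_ ij.2) phi) y| <= `|'D_(e_ ij.1) ('D_(e_ ij.2) phi) z| + 1
  & forall i : 'I_d, `|'D_(e_ i) phi y| <= `|'D_(e_ i) phi z| + 1].
  by apply: filterS3 N1 N2 N3 => y; split.
(* The radius [m.+1%:R^-1] is below [r / 2], so that segments issued from points within [r / 2] of
   [z] stay in the ball where the partial derivatives are bounded. *)
have [m Hm] : exists m : nat, [/\ M2 <= m.+1%:R, M1 <= m.+1%:R & m.+1%:R^-1 < r / 2].
  have M20 : 0 <= M2 by do 2![apply: sumr_ge0 => ? _]; rewrite addr_ge0.
  have M10 : 0 <= M1 by apply: sumr_ge0 => ? _; rewrite addr_ge0.
  have r20 : 0 <= (r / 2)^-1 by rewrite invr_ge0 divr_ge0// ltW.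
  exists (Num.truncn (M1 + M2 + (r / 2)^-1)).
  have H := truncnS_gt (M1 + M2 + (r / 2)^-1).
  split; try by apply: ltW; apply: le_lt_trans H; lra.
  rewrite -[ltRHS]invrK ltf_pV2 ?posrE ?invr_gt0 ?divr_gt0//.
  by apply: le_lt_trans H; lra.
case: Hm => Hm2 Hm1 Hmr.
exists m; apply/nbhs_ballP; exists (r / 2); first by rewrite /= divr_gt0.
move=> x xz h hm.
have S c : 0 <= c <= 1 -> ball z r (x + c *: h).
  move=> /andP[c0 c1]; move: xz; rewrite -!ball_normE /ball_ /= => xz.
  rewrite opprD addrA (le_lt_trans (ler_normB _ _))// (splitr r).
  apply: ltrD => //; rewrite normrZ ger0_norm//.
  by apply: le_lt_trans Hmr; apply: le_trans hm; rewrite ler_piMl.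
have Sh : A (x + h) by have [] := rH _ (S 1 _); rewrite ?scale1r ?ler01 ?lexx.
have [|c [c' [/andP[c0 c1] c'I E]]] := @taylor1 R _ A phi x h cphi.
  by move=> t tI; have [] := rH _ (S _ tI).
split=> //.
  rewrite E normrM ger0_norm//.
  have [Ac H2 _] := rH _ (S _ c'I).
  apply: le_trans (ler_wpM2r _ Hm2); last by rewrite exprn_ge0.
  by apply: le_trans (B2 h _ Ac H2); rewrite ler_piMl.
have [Ax _ H3] : [/\ A x, forall ij : 'I_d * 'I_d,
    `|'D_(e_ ij.1) ('D_(e_ ij.2) phi) x| <= `|'D_(e_ ij.1) ('D_(e_ ij.2) phi) z| + 1
  & forall i : 'I_d, `|'D_(e_ i) phi x| <= `|'D_(e_ i) phi z| + 1].
  by apply: rH; have := S 0; rewrite scale0r addr0; apply; rewrite lexx ler01.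
apply: le_trans (B1 h _ Ax H3) _; exact: ler_wpM2r.
Qed.

Lemma taylor_compact (I : finType) (phi : I -> 'rV[R]_d -> R) A K :
  open A -> compact K -> K `<=` A -> (forall i, CkO 2 A (phi i)) ->
  exists m, forall i x, K x -> taylor_bound A (phi i) m x.
Proof.
move=> oA cK KA cphi.
have /choice[m Hm] : forall i, exists m, forall x, K x -> taylor_bound A (phi i) m x.
  move=> i; apply: compact_unif => // [m l x ml|x Kx].
    exact: taylor_bound_mono.
  exact: taylor_bound_local (KA _ Kx) _.
exists (\max_i m i)%N => i x Kx.
by apply: taylor_bound_mono (Hm i x Kx); exact: (leq_bigmax i).
Qed.

End Taylor.

(** * Quadratic forms *)

Section Dot.
Variables (R : realType) (d : nat).
Implicit Types (x y z v w : 'rV[R]_d) (M N : 'M[R]_d).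

Lemma sum_ord_const (c : R) : \sum_(i < d) c = d%:R * c.
Proof. by rewrite sumr_const card_ord mulr_natl. Qed.

Definition dot x y : R := \sum_i x 0 i * y 0 i.

Lemma dotC x y : dot x y = dot y x.
Proof. by apply: eq_bigr => i _; rewrite mulrC. Qed.

Lemma dotDl x y z : dot (x + y) z = dot x z + dot y z.
Proof. by rewrite -big_split; apply: eq_bigr => i _; rewrite mxE mulrDl. Qed.

Lemma dotZl (c : R) x y : dot (c *: x) y = c * dot x y.
Proof. by rewrite mulr_sumr; apply: eq_bigr => i _; rewrite mxE mulrA. Qed.

Lemma dotNl x y : dot (- x) y = - dot x y.
Proof. by rewrite -scaleN1r dotZl mulN1r. Qed.

Lemma dotBl x y z : dot (x - y) z = dot x z - dot y z.
Proof. by rewrite dotDl dotNl. Qed.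

Lemma dotDr x y z : dot z (x + y) = dot z x + dot z y.
Proof. by rewrite ![dot z _]dotC dotDl. Qed.

Lemma dotZr (c : R) x y : dot y (c *: x) = c * dot y x.
Proof. by rewrite ![dot y _]dotC dotZl. Qed.

Lemma dotNr x y : dot y (- x) = - dot y x.
Proof. by rewrite ![dot y _]dotC dotNl. Qed.

Lemma dotBr x y z : dot z (x - y) = dot z x - dot z y.
Proof. by rewrite ![dot z _]dotC dotBl. Qed.

Lemma dot_ge0 x : 0 <= dot x x.
Proof. by apply: sumr_ge0 => i _; rewrite -expr2 sqr_ge0. Qed.

Lemma sqr_norm_le_dot x : `|x| ^+ 2 <= dot x x.
Proof.
rewrite -[leRHS]sqr_sqrtr ?dot_ge0// ler_sqr ?nnegrE ?sqrtr_ge0//.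
apply: ler_norm_entry => [|i j]; first exact: sqrtr_ge0.
rewrite -ler_sqr ?nnegrE ?sqrtr_ge0// sqr_sqrtr ?dot_ge0// ord1 real_normK ?num_real//.
rewrite /dot (bigD1 j)//= -expr2 lerDl; apply: sumr_ge0 => k _.
by rewrite -expr2 sqr_ge0.
Qed.

Lemma dot_le_sqr_norm x : dot x x <= d%:R * `|x| ^+ 2.
Proof.
apply: (@le_trans _ _ (\sum_(i < d) `|x| ^+ 2)); last by rewrite sumr_const card_ord mulr_natl.
apply: ler_sum => i _; rewrite -expr2 -[leLHS]real_normK ?num_real//.
by rewrite ler_sqr ?nnegrE//; exact: ler_entry_norm.
Qed.

Lemma dot_eq0 x : (dot x x == 0) = (x == 0).
Proof.
apply/eqP/eqP => [x0|->]; last by rewrite -(scale0r 0) dotZl mul0r.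
apply/eqP; rewrite -normr_le0 -(@ler_pXn2r _ 2)// ?nnegrE// expr0n.
by have := sqr_norm_le_dot x; rewrite x0.
Qed.

Lemma dot_norm_le x y : `|dot x y| <= d%:R * `|x| * `|y|.
Proof.
apply: le_trans (ler_norm_sum _ _ _) _.
apply: (@le_trans _ _ (\sum_(i < d) `|x| * `|y|)).
  by apply: ler_sum => i _; rewrite normrM; apply: ler_pM => //; exact: ler_entry_norm.
by rewrite sum_ord_const mulrA.
Qed.

Lemma sphere_norm_le1 x : dot x x = 1 -> `|x| <= 1.
Proof.
by move=> x1; rewrite -(@ler_pXn2r _ 2)// ?nnegrE// expr1n -x1 sqr_norm_le_dot.
Qed.

Lemma sphere_neq0 x : dot x x = 1 -> x != 0.
Proof. by rewrite -dot_eq0 => ->; rewrite oner_eq0. Qed.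

Lemma continuous_dot (T : Type) (F : set_system T) (FF : Filter F)
    (f g : T -> 'rV[R]_d) (a b : 'rV[R]_d) :
  (f @ F --> a) -> (g @ F --> b) -> dot (f x) (g x) @[x --> F] --> dot a b.
Proof.
move=> fa gb; apply: cvg_sumr => i _; apply: cvgM.
  exact: (@cvg_comp _ _ _ f (fun z => z 0 i) _ _ _ fa (@coord_continuous _ _ _ 0 i a)).
exact: (@cvg_comp _ _ _ g (fun z => z 0 i) _ _ _ gb (@coord_continuous _ _ _ 0 i b)).
Qed.

Definition qf N v : R := \sum_i \sum_j N i j * (v 0 i * v 0 j).

Lemma qfE N v : qf N v = (v *m N *m v^T) 0 0.
Proof.
rewrite /qf exchange_big mxE; apply: eq_bigr => j _.
rewrite mxE [v^T _ _]mxE mulr_suml; apply: eq_bigr => i _; ring.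
Qed.

Lemma qfD M N v : qf (M + N) v = qf M v + qf N v.
Proof.
rewrite /qf -big_split; apply: eq_bigr => i _; rewrite -big_split.
by apply: eq_bigr => j _; rewrite mxE mulrDl.
Qed.

Lemma qfZ (c : R) N v : qf (c *: N) v = c * qf N v.
Proof.
rewrite /qf mulr_sumr; apply: eq_bigr => i _; rewrite mulr_sumr.
by apply: eq_bigr => j _; rewrite mxE -mulrA.
Qed.

Lemma qfN N v : qf (- N) v = - qf N v.
Proof. by rewrite -scaleN1r qfZ mulN1r. Qed.

Lemma qfB M N v : qf (M - N) v = qf M v - qf N v.
Proof. by rewrite qfD qfN. Qed.

Lemma qf_scale N (c : R) v : qf N (c *: v) = c ^+ 2 * qf N v.
Proof.
rewrite /qf mulr_sumr; apply: eq_bigr => i _; rewrite mulr_sumr.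
by apply: eq_bigr => j _; rewrite !mxE; ring.
Qed.

Lemma qf_norm_le N v : `|qf N v| <= d%:R ^+ 2 * `|N| * `|v| ^+ 2.
Proof.
apply: le_trans (ler_norm_sum _ _ _) _.
apply: (@le_trans _ _ (\sum_(i < d) \sum_(j < d) `|N| * `|v| ^+ 2)).
  apply: ler_sum => i _; apply: le_trans (ler_norm_sum _ _ _) _.
  apply: ler_sum => j _; rewrite !normrM expr2.
  apply: ler_pM => //; first exact: ler_entry_norm.
  by apply: ler_pM => //; exact: ler_entry_norm.
by rewrite !sum_ord_const le_eqVlt; apply/orP; left; apply/eqP; ring.
Qed.

Lemma qf_dist_le N v w : `|qf N v - qf N w| <=
  d%:R ^+ 2 * `|N| * (`|v| + `|w|) * `|v - w|.
Proof.
rewrite /qf -sumrB; apply: le_trans (ler_norm_sum _ _ _) _.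
apply: (@le_trans _ _ (\sum_(i < d) \sum_(j < d) `|N| * (`|v| + `|w|) * `|v - w|)).
  apply: ler_sum => i _; rewrite -sumrB; apply: le_trans (ler_norm_sum _ _ _) _.
  apply: ler_sum => j _; rewrite -mulrBr normrM -mulrA.
  apply: ler_pM => //; first exact: ler_entry_norm.
  have -> : v 0 i * v 0 j - w 0 i * w 0 j = v 0 i * (v - w) 0 j + w 0 j * (v - w) 0 i.
    by rewrite !mxE; ring.
  apply: le_trans (ler_normD _ _) _; rewrite !normrM mulrDl.
  by apply: lerD; apply: ler_pM => //; exact: ler_entry_norm.
by rewrite !sum_ord_const le_eqVlt; apply/orP; left; apply/eqP; ring.
Qed.

Local Notation e_ k := (delta_mx 0 k : 'rV[R]_d).

Lemma qf_delta N i : qf N (e_ i) = N i i.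
Proof.
rewrite /qf (bigD1 i)//= (bigD1 i)//= !mxE !eqxx !mulr1.
rewrite !big1 ?addr0//.
  by move=> j ji; rewrite big1// => k _; rewrite mxE eqxx (negbTE ji) mul0r mulr0.
by move=> j ji; rewrite !mxE !eqxx (negbTE ji) !mulr0.
Qed.

Definition bf N v w : R := \sum_i \sum_j N i j * (v 0 i * w 0 j).

Lemma qf_bf N v : qf N v = bf N v v. Proof. by []. Qed.

Lemma bfDl N v w z : bf N (v + w) z = bf N v z + bf N w z.
Proof.
rewrite /bf -big_split; apply: eq_bigr => i _; rewrite -big_split.
by apply: eq_bigr => j _; rewrite !mxE mulrDl mulrDr.
Qed.

Lemma bfDr N v w z : bf N z (v + w) = bf N z v + bf N z w.
Proof.
rewrite /bf -big_split; apply: eq_bigr => i _; rewrite -big_split.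
by apply: eq_bigr => j _; rewrite !mxE mulrDr mulrDr.
Qed.

Lemma bfZl N (c : R) v z : bf N (c *: v) z = c * bf N v z.
Proof.
rewrite /bf mulr_sumr; apply: eq_bigr => i _; rewrite mulr_sumr.
by apply: eq_bigr => j _; rewrite !mxE; ring.
Qed.

Lemma bfZr N (c : R) v z : bf N z (c *: v) = c * bf N z v.
Proof.
rewrite /bf mulr_sumr; apply: eq_bigr => i _; rewrite mulr_sumr.
by apply: eq_bigr => j _; rewrite !mxE; ring.
Qed.

Lemma bf_delta N i j : bf N (e_ i) (e_ j) = N i j.
Proof.
rewrite /bf (bigD1 i)//= (bigD1 j)//= !mxE !eqxx !mulr1.
rewrite !big1 ?addr0//.
  by move=> k ki; rewrite big1// => l _; rewrite mxE eqxx (negbTE ki) mul0r mulr0.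
by move=> k kj; rewrite !mxE !eqxx (negbTE kj) !mulr0.
Qed.

Lemma nonneg_def_qf N v : nonneg_def N -> 0 <= qf N v.
Proof. by move=> [_ H]; rewrite qfE; exact: H. Qed.

Lemma nonneg_def_diag N i : nonneg_def N -> 0 <= N i i.
Proof. by move=> H; rewrite -qf_delta; exact: nonneg_def_qf. Qed.

(** Testing the form on [e_ i + e_ j] and on [e_ i - e_ j] bounds twice an off-diagonal entry by the
    sum of two diagonal ones. The trace can thus provide ellipticity. *)
Lemma nonneg_def_norm_le_tr N : nonneg_def N -> `|N| <= \tr N.
Proof.
move=> nN; have tr0 i : N i i <= \tr N.
  rewrite /mxtrace (bigD1 i)//= lerDl; apply: sumr_ge0 => k _.
  exact: nonneg_def_diag.
apply: ler_norm_entry => [|i j].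
  by apply: sumr_ge0 => i _; exact: nonneg_def_diag.
have NT : N^T = N by case: nN.
have H1 := nonneg_def_qf (e_ i + e_ j) nN.
have H2 := nonneg_def_qf (e_ i - e_ j) nN.
move: H1 H2; rewrite !qf_bf -scaleN1r !(bfDl, bfDr, bfZl, bfZr) !bf_delta.
have -> : N j i = N i j by rewrite -{1}NT mxE.
have := tr0 i; have := tr0 j; rewrite ler_norml => ? ? ? ?.
by apply/andP; split; lra.
Qed.

Lemma tr_le_norm N : \tr N <= d%:R * `|N|.
Proof.
apply: (@le_trans _ _ (\sum_(i < d) `|N|)); last by rewrite sumr_const card_ord mulr_natl.
by apply: ler_sum => i _; apply: le_trans (ler_norm _) (ler_entry_norm _ _ _).
Qed.

End Dot.

(** * Uniform hyperbolicity *)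

Section Net.
Variables (R : realType) (d : nat).
Implicit Types (x y z v w a b tau : 'rV[R]_d) (M N : 'M[R]_d).

Local Notation e_ k := (delta_mx 0 k : 'rV[R]_d).
Local Notation nz := [set x : 'rV[R]_d | x != 0].

Lemma qf0 N : qf N 0 = 0.
Proof. by rewrite -(scale0r (0 : 'rV[R]_d)) qf_scale expr0n mul0r. Qed.

Lemma open_nz : open nz.
Proof.
rewrite openE => x /= x0; apply/nbhs_ballP; exists `|x|; first by rewrite /= normr_gt0.
move=> y; rewrite -ball_normE /ball_ /= => xy; apply/eqP => y0.
by move: xy; rewrite y0 subr0 ltxx.
Qed.

Lemma closed_dot_eq (c : R) : closed [set x : 'rV[R]_d | dot x x = c].
Proof.
have -> : [set x : 'rV[R]_d | dot x x = c] = (fun x : 'rV[R]_d => dot x x) @^-1` [set c] by [].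
apply: closed_comp; last exact: closed_eq.
by move=> x _; exact: (@continuous_dot _ _ _ (nbhs x) _ id id x x cvg_id cvg_id).
Qed.

Lemma sphere_compact : compact [set x : 'rV[R]_d | dot x x = 1].
Proof.
apply: bounded_closed_compact; last exact: closed_dot_eq.
exists 1; split; first exact: num_real.
by move=> M M1 x /= /sphere_norm_le1 x1; apply: le_trans x1 (ltW M1).
Qed.

Lemma cvg_qf (T : Type) (F : set_system T) (FF : Filter F)
    (N : T -> 'M[R]_d) (v : T -> 'rV[R]_d) (N0 : 'M[R]_d) (v0 : 'rV[R]_d) :
  (N @ F --> N0) -> (v @ F --> v0) -> qf (N t) (v t) @[t --> F] --> qf N0 v0.
Proof.
move=> cN cv; rewrite /qf.
apply: (@cvg_sumr _ _ _ _ _ _ _ (fun i t => \sum_j N t i j * (v t 0 i * v t 0 j))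
  (fun i => \sum_j N0 i j * (v0 0 i * v0 0 j))) => i _.
apply: (@cvg_sumr _ _ _ _ _ _ _ (fun j t => N t i j * (v t 0 i * v t 0 j))
  (fun j => N0 i j * (v0 0 i * v0 0 j))) => j _.
have cvi k : v t 0 k @[t --> F] --> v0 0 k.
  exact: (@cvg_comp _ _ _ v (fun z => z 0 k) _ _ _ cv (@coord_continuous _ _ _ 0 k v0)).
have cNij : N t i j @[t --> F] --> N0 i j.
  have cc : {for N0, continuous (fun z : 'M[R]_d => z i j)} := @coord_continuous _ _ _ i j N0.
  exact: (@cvg_comp _ _ _ N (fun z : 'M[R]_d => z i j) F _ _ cN cc).
exact: (cvgM cNij (cvgM (cvi i) (cvi j))).
Qed.

Variable f : 'rV[R]_d -> 'M[R]_d.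
Hypothesis f_smooth : forall k i j, CkO k nz (fun x => f x i j).
Hypothesis f_homog : forall (t : R) x, 0 < t -> x != 0 -> f (t *: x) = f x.

Definition Df a tau : 'M[R]_d := \matrix_(i, j) 'D_tau (fun x => f x i j) a.

Lemma DfE a tau i j : a != 0 ->
  Df a tau i j = \sum_k tau 0 k * 'D_(e_ k) (fun x => f x i j) a.
Proof. by move=> a0; rewrite mxE; exact: (@derive_rowE _ _ _ nz a tau open_nz a0 (f_smooth 1 i j)). Qed.

Lemma Df_is_linear a : a != 0 -> forall (c : R) u v, Df a (c *: u + v) = c *: Df a u + Df a v.
Proof.
move=> a0 c u v; apply/matrixP => i j.
have -> : (c *: Df a u + Df a v) i j = c * Df a u i j + Df a v i j.
  by rewrite mxE [X in X + _]mxE.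
rewrite !DfE// mulr_sumr -big_split; apply: eq_bigr => k _ /=.
by rewrite !mxE; ring.
Qed.

Lemma DfZ a : a != 0 -> forall (c : R) u, Df a (c *: u) = c *: Df a u.
Proof.
move=> a0 c u; have D0 : Df a 0 = 0.
  have := Df_is_linear a0 1 0 0; rewrite !scale1r addr0 => /eqP.
  by rewrite -subr_eq subrr => /eqP <-.
by have := Df_is_linear a0 c u 0; rewrite !addr0 D0 addr0.
Qed.

Lemma DfN a : a != 0 -> forall u, Df a (- u) = - Df a u.
Proof. by move=> a0 u; rewrite -scaleN1r DfZ// scaleN1r. Qed.

Lemma cvg_f (T : Type) (F : set_system T) (FF : Filter F) (g : T -> 'rV[R]_d) a :
  a != 0 -> (g @ F --> a) -> f (g t) @[t --> F] --> f a.
Proof.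
move=> a0 ga; apply: cvg_mx => i j.
exact: (@cvg_comp _ _ _ g (fun x => f x i j) _ _ _ ga (CkO_cont (f_smooth 0 i j) a0)).
Qed.

Lemma cvg_Df (T : Type) (F : set_system T) (FF : Filter F) (g h : T -> 'rV[R]_d) a tau :
  a != 0 -> (g @ F --> a) -> (h @ F --> tau) ->
  Df (g t) (h t) @[t --> F] --> Df a tau.
Proof.
move=> a0 ga ht; apply: cvg_mx => i j; rewrite DfE//.
have g0 : \forall t \near F, g t != 0 := ga nz (open_nbhs_nbhs (conj open_nz a0)).
suff : \sum_k h t 0 k * 'D_(e_ k) (fun x => f x i j) (g t) @[t --> F] -->
    \sum_k tau 0 k * 'D_(e_ k) (fun x => f x i j) a.
  apply: cvg_trans; apply: (@near_eq_cvg _ _ F FF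
    (fun t => \sum_k h t 0 k * 'D_(e_ k) (fun x => f x i j) (g t))
    (fun t => Df (g t) (h t) i j)).
  by apply: filterS g0 => t gt0; rewrite DfE.
apply: cvg_sumr => k _; apply: cvgM.
  exact: (@cvg_comp _ _ _ h (fun z => z 0 k) _ _ _ ht (@coord_continuous _ _ _ 0 k tau)).
exact: (@cvg_comp _ _ _ g ('D_(e_ k) (fun x => f x i j)) _ _ _ ga
  (CkO_cont (CkO_derive (e_ k) (f_smooth 1 i j)) a0)).
Qed.

(** Central projection onto the tangent hyperplane at [a]: with [c = dot a b], the vector
    [tau = b / c - a] is orthogonal to [a], and a map constant on rays has the same value at [b] and
    at [a + tau]. As [1 - c] is half of [dot (a - b) (a - b)], one has [c >= 1 / 2], and lengths are
    distorted by bounded factors. *)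
Lemma tangent_chart a b : dot a a = 1 -> dot b b = 1 -> d%:R * `|a - b| <= 1 -> `|a - b| <= 1 ->
  exists tau, [/\ dot a tau = 0, `|tau| <= 3 * `|a - b|, `|a - b| <= 2 * `|tau|
    & exists2 l : R, 0 < l & b = l *: (a + tau)].
Proof.
move=> a1 b1 ab ab1.
pose c := dot a b.
have cE : 1 - c = dot (a - b) (a - b) / 2.
  by rewrite dotBl !dotBr a1 b1 (dotC b a) /c; field.
have a1n := sphere_norm_le1 a1.
have sq : dot (a - b) (a - b) <= `|a - b|.
  apply: le_trans (dot_le_sqr_norm _) _.
  by rewrite expr2 mulrA ler_piMl.
have c1 : 1 - c <= `|a - b| / 2 by rewrite cE ler_wpM2r.
have c0 : 0 <= 1 - c by rewrite cE divr_ge0// dot_ge0.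
have ch : 1 / 2 <= c by lra.
have cp : 0 < c by lra.
pose tau := c^-1 *: b - a.
have bE : b = c *: (a + tau).
  by rewrite /tau addrC subrK scalerA mulfV ?gt_eqF// scale1r.
have tE : c *: tau = (b - a) + (1 - c) *: a.
  by rewrite /tau scalerBr scalerA mulfV ?gt_eqF// scale1r scalerBl scale1r addrA subrK.
have nb : `|b - a| = `|a - b| by rewrite distrC.
have n2 : `|(1 - c) *: a| <= `|a - b| / 2.
  rewrite normrZ ger0_norm//; apply: le_trans c1.
  by rewrite ler_piMr.
have nct : c * `|tau| = `|c *: tau| by rewrite normrZ gtr0_norm.
exists tau; split.
- by rewrite /tau dotBr dotZr a1 -/c mulVf ?subrr ?gt_eqF.
- have : c * `|tau| <= `|a - b| + `|a - b| / 2.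
    by rewrite nct tE; apply: le_trans (ler_normD _ _) _; rewrite nb lerD.
  have : 1 / 2 * `|tau| <= c * `|tau| by rewrite ler_wpM2r.
  lra.
- have E : b - a = c *: tau - (1 - c) *: a by rewrite tE addrK.
  have : `|b - a| <= `|c *: tau| + `|a - b| / 2.
    by rewrite {1}E; apply: le_trans (ler_normB _ _) _; rewrite lerD2l.
  rewrite nb -nct.
  have : c * `|tau| <= `|tau| by rewrite ler_piMl//; lra.
  lra.
by exists c.
Qed.

Hypothesis secant : forall a b, dot a a = 1 -> dot b b = 1 -> a != b ->
  exists v, 0 < qf (f a - f b) v.
Hypothesis tangent : forall a tau, dot a a = 1 -> dot tau tau = 1 -> dot a tau = 0 ->
  exists v, 0 < qf (Df a tau) v.

Let normalize N v : 0 < qf N v -> exists w, `|w| <= 1 /\ 0 < qf N w.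
Proof.
move=> Nv; have v0 : v != 0.
  apply/eqP => v0; move: Nv; by rewrite v0 qf0 ltxx.
exists (`|v|^-1 *: v); split.
  by rewrite normrZ ger0_norm ?invr_ge0// mulVf ?normr_eq0.
by rewrite qf_scale mulr_gt0// exprn_gt0// invr_gt0 normr_gt0.
Qed.

Let inv_nat (e : R) : 0 < e -> exists m : nat, m.+1%:R^-1 < e.
Proof.
move=> e0; exists (Num.truncn e^-1); rewrite -[ltRHS]invrK ltf_pV2 ?posrE ?invr_gt0//.
exact: truncnS_gt.
Qed.

(** For fixed [v] positivity is an open condition on [(a, tau)], and pairs of orthogonal unit
    vectors form a compact set; linearity of [Df f a] then removes the normalization of [tau]. *)
Lemma tangent_unif : exists m : nat, forall a tau, dot a a = 1 -> dot a tau = 0 ->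
  exists2 v, `|v| <= 1 & `|tau| <= m.+1%:R * qf (Df a tau) v.
Proof.
pose S : set 'rV[R]_d := [set x | dot x x = 1].
pose K : set ('rV[R]_d * 'rV[R]_d) := (S `*` S) `&` [set p | dot p.1 p.2 = 0].
have cK : compact K.
  apply: compact_closedI; first by apply: compact_setX; exact: sphere_compact.
  have -> : [set p : 'rV[R]_d * 'rV[R]_d | dot p.1 p.2 = 0] =
    (fun p : 'rV[R]_d * 'rV[R]_d => dot p.1 p.2) @^-1` [set 0] by [].
  apply: closed_comp; last exact: closed_eq.
  move=> p _; exact: (@continuous_dot _ _ _ (nbhs p) _ fst snd p.1 p.2 cvg_fst cvg_snd).
pose P (m : nat) (p : 'rV[R]_d * 'rV[R]_d) := exists2 v, `|v| <= 1 &
  m.+1%:R^-1 <= qf (Df p.1 p.2) v.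
have [m Hm] : exists m, forall p, K p -> P m p.
  apply: compact_unif => // [m l p ml [v v1 Hv]|[a tau] [[/= Sa St] /= at0]].
    by exists v => //; apply: le_trans Hv; rewrite lef_pV2 ?posrE ?ltr0n// ler_nat.
  have [v0 /normalize [v [v1 Hv]]] := tangent Sa St at0.
  have [m Hm] := inv_nat Hv; exists m.
  have c1 : fst @ nbhs (a, tau) --> a by exact: cvg_fst.
  have c2 : snd @ nbhs (a, tau) --> tau by exact: cvg_snd.
  have cV : (fun=> v) @ nbhs (a, tau) --> v by exact: cvg_cst.
  have cD := @cvg_Df _ (nbhs (a, tau)) (nbhs_filter _) fst snd a tau (sphere_neq0 Sa) c1 c2.
  have cq := @cvg_qf _ (nbhs (a, tau)) (nbhs_filter _) (fun p => Df p.1 p.2) (fun=> v)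
      _ _ cD cV.
  apply: (@filterS _ (nbhs (a, tau)) (nbhs_filter _) _ (P m) _ (cvgr_gt _ cq _ Hm)).
  by move=> p Hp; exists v => //; exact: ltW.
exists m => a tau a1 at0.
have a0 := sphere_neq0 a1.
have [->|t0] := eqVneq tau 0.
  exists 0; rewrite normr0 ?ler01//.
  by rewrite qf0 mulr0.
pose s := Num.sqrt (dot tau tau).
have s0 : 0 < s by rewrite sqrtr_gt0 lt_neqAle dot_ge0 eq_sym dot_eq0 t0.
have s2 : s ^+ 2 = dot tau tau by rewrite sqr_sqrtr ?dot_ge0.
have [|v v1 Hv] := Hm (a, s^-1 *: tau).
  split; last by rewrite /= dotZr at0 mulr0.
  split=> //=; rewrite /S /= dotZl dotZr -s2; field.
  by rewrite gt_eqF.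
exists v => //.
have ts : `|tau| <= s.
  by rewrite -(@ler_pXn2r _ 2)// ?nnegrE ?(ltW s0)// s2 sqr_norm_le_dot.
apply: le_trans ts _.
move: Hv; rewrite /= DfZ// qfZ ler_pdivlMl// => Hv.
by rewrite -ler_pdivrMl ?ltr0n// mulrC.
Qed.

Lemma remainder_bound m a tau :
  (forall i j, taylor_bound nz (fun x => f x i j) m a) -> `|tau| <= m.+1%:R^-1 ->
  `|f (a + tau) - f a - Df a tau| <= m.+1%:R * `|tau| ^+ 2.
Proof.
move=> H ht; apply: ler_norm_entry => [|i j].
  by rewrite mulr_ge0// exprn_ge0.
have [_ + _] := H i j tau ht.
by rewrite !mxE.
Qed.

Lemma taylor_sphere : exists m, forall a, dot a a = 1 ->
  forall i j, taylor_bound nz (fun x => f x i j) m a.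
Proof.
have [|m Hm] := @taylor_compact R d ('I_d * 'I_d)%type (fun ij x => f x ij.1 ij.2) nz
  [set x | dot x x = 1] open_nz sphere_compact _ (fun ij => f_smooth 2 ij.1 ij.2).
  by move=> x /=; exact: sphere_neq0.
by exists m => a a1 i j; exact: Hm (i, j) a a1.
Qed.

Let secant_arith (M q e t A u : R) : 0 < M -> 0 <= t -> t <= M * - q ->
  `|e| <= A * t ^+ 2 -> A * M * 2 * t <= 1 -> u <= 2 * t -> u <= 4 * M * (- q - e).
Proof.
move=> M0 t0 tq /ler_normlW eA At ut.
have h1 : M * e <= M * (A * t ^+ 2) by rewrite ler_pM2l.
have h2 : A * M * 2 * t * t <= t by rewrite ler_piMl.
have h3 : M * (A * t ^+ 2) * 2 = A * M * 2 * t * t by ring.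
have h4 : 4 * M * (- q - e) = 4 * (M * - q) - 4 * (M * e) by ring.
by rewrite h4; lra.
Qed.

(** Off the diagonal positivity is open and [|a - b|] is bounded. At the diagonal it degenerates,
    and the bound comes from the tangent case: in the chart at [a], [f a - f b] is [- Df f a tau] up
    to a quadratic remainder. *)
Lemma secant_unif : exists m : nat, forall a b, dot a a = 1 -> dot b b = 1 ->
  exists2 v, `|v| <= 1 & `|a - b| <= m.+1%:R * qf (f a - f b) v.
Proof.
have [m1 Hm1] := tangent_unif.
have [m2 Hm2] := taylor_sphere.
pose S : set 'rV[R]_d := [set x | dot x x = 1].
have cK : compact (S `*` S) by apply: compact_setX; exact: sphere_compact.
pose P (m : nat) (p : 'rV[R]_d * 'rV[R]_d) := dot p.1 p.1 = 1 -> dot p.2 p.2 = 1 ->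
  exists2 v, `|v| <= 1 & `|p.1 - p.2| <= m.+1%:R * qf (f p.1 - f p.2) v.
have mono m l p : (m <= l)%N -> P m p -> P l p.
  move=> ml Hp p1 p2; have [v v1 Hv] := Hp p1 p2; exists v => //.
  have q0 : 0 <= qf (f p.1 - f p.2) v.
    by have := le_trans (normr_ge0 _) Hv; rewrite pmulr_rge0.
  by apply: le_trans Hv _; apply: ler_wpM2r => //; rewrite ler_nat.
have loc p : (S `*` S) p -> exists m, \forall y \near p, P m y.
  case: p => a0 b0 [/= Sa0 Sb0].
  have c1 : fst @ nbhs (a0, b0) --> a0 by exact: cvg_fst.
  have c2 : snd @ nbhs (a0, b0) --> b0 by exact: cvg_snd.
  have [ab|ab] := eqVneq a0 b0.
    (* The successor of this index is [4 * m1.+1], the constant produced by [secant_arith]. *)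
    exists (4 * m1 + 3)%N.
    pose D : R := d%:R; pose M1 : R := m1.+1%:R; pose M2 : R := m2.+1%:R.
    have D0 : 0 <= D by rewrite ler0n.
    have M10 : 0 < M1 by rewrite ltr0n.
    have M20 : 0 < M2 by rewrite ltr0n.
    have DM : 0 <= D ^+ 2 * M1 * M2 by apply: mulr_ge0; [apply: mulr_ge0; [exact: exprn_ge0|exact: ltW]|exact: ltW].
    (* [Q] dominates every constant whose product with [|a - b|] has to be at most 1. *)
    pose Q := 1 + D + 3 * M2 + 6 * (D ^+ 2 * M1 * M2).
    have Q0 : 0 < Q by rewrite /Q; lra.
    pose r := Q^-1.
    have r0 : 0 < r by rewrite invr_gt0.
    have rb (c : R) : 0 <= c -> c <= Q -> c * r <= 1.
      by move=> c0 cQ; rewrite ler_pdivrMr// mul1r.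
    have r20 : 0 < r / 2 by rewrite divr_gt0.
    have N1 : \forall p \near (a0, b0), `|a0 - p.1| < r / 2.
      by have /cvgrPdist_lt := c1; apply.
    have N2 : \forall p \near (a0, b0), `|b0 - p.2| < r / 2.
      by have /cvgrPdist_lt := c2; apply.
    apply: (@filterS2 _ (nbhs (a0, b0)) (nbhs_filter _) _ _ (P _) _ N1 N2).
    move=> [a b] /= aa0 bb0; rewrite /P /= => a1 b1.
    have abr : `|a - b| <= r.
      have -> : a - b = (b0 - b) - (a0 - a) by rewrite ab opprB [RHS]addrC addrA subrK.
      by apply: le_trans (ler_normB _ _) _; rewrite [leRHS]splitr; apply: lerD; exact: ltW.
    have DMQ : D ^+ 2 * M1 * M2 * 6 <= Q by rewrite /Q; lra.
    have rD : D * `|a - b| <= 1.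
      by apply: le_trans (rb D _ _) => //; [exact: ler_wpM2l|rewrite /Q; lra].
    have r1 : `|a - b| <= 1.
      by apply: le_trans (rb 1 _ _); rewrite ?mul1r//; rewrite /Q; lra.
    have [tau [at0 t3 t2 [l l0 bE]]] := tangent_chart a1 b1 rD r1.
    have a_n0 := sphere_neq0 a1.
    have fb : f b = f (a + tau).
      rewrite bE f_homog//; apply/eqP => E; move: b1.
      by rewrite bE E scaler0 => /sphere_neq0; rewrite eqxx.
    have tM2 : `|tau| <= m2.+1%:R^-1.
      apply: le_trans t3 _; rewrite -/M2 -[M2^-1]mul1r ler_pdivlMr//.
      have M230 : 0 <= 3 * M2 by rewrite mulr_ge0// ltW.
      have M23Q : 3 * M2 <= Q by rewrite /Q; lra.
      by apply: le_trans (rb _ M230 M23Q); rewrite mulrAC; apply: ler_wpM2l.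
    have Rem := remainder_bound (Hm2 a a1) tM2.
    (* The leading term of [f a - f b] is [- Df f a tau], whence the tangent bound for [- tau]. *)
    have at0' : dot a (- tau) = 0 by rewrite dotNr at0 oppr0.
    have [v v1] := Hm1 a (- tau) a1 at0'; rewrite normrN DfN// qfN => Hv.
    exists v => //.
    have E : qf (f a - f b) v = - qf (Df a tau) v - qf (f (a + tau) - f a - Df a tau) v.
      by rewrite fb !qfB; ring.
    have B : `|qf (f (a + tau) - f a - Df a tau) v| <= D ^+ 2 * (M2 * `|tau| ^+ 2).
      apply: le_trans (qf_norm_le _ _) _.
      apply: (@le_trans _ _ (D ^+ 2 * `|f (a + tau) - f a - Df a tau|)).
        by rewrite ler_piMr ?mulr_ge0 ?exprn_ge0// exprn_ile1.
      by apply: ler_wpM2l => //; rewrite exprn_ge0.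
    have S1 : D ^+ 2 * M1 * M2 * 2 * `|tau| <= 1.
      apply: le_trans (rb _ _ DMQ); last by rewrite mulr_ge0.
      apply: (@le_trans _ _ (D ^+ 2 * M1 * M2 * 2 * (3 * r))).
        apply: ler_wpM2l; first by rewrite mulr_ge0.
        by apply: le_trans t3 _; exact: ler_wpM2l.
      by rewrite le_eqVlt; apply/orP; left; apply/eqP; ring.
    have M4 : ((4 * m1 + 3).+1%:R : R) = 4 * M1.
      by rewrite /M1 -addnS -natrM mulnS addnC.
    rewrite mulrA in B.
    rewrite M4 E; apply: (secant_arith M10 (normr_ge0 tau) Hv B _ t2).
    by apply: le_trans S1; rewrite le_eqVlt; apply/orP; left; apply/eqP; ring.
  have [v0 /normalize [v [v1 Hv]]] := secant Sa0 Sb0 ab.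
  (* A factor 2 is lost when [(a, b)] varies, another one because [|a - b|] may reach 2. *)
  have v20 : 0 < qf (f a0 - f b0) v / 4 by rewrite divr_gt0.
  have [m Hm] := inv_nat v20; exists m.
  have cV : (fun=> v) @ nbhs (a0, b0) --> v by exact: cvg_cst.
  have cf1 := @cvg_f _ (nbhs (a0, b0)) (nbhs_filter _) fst a0 (sphere_neq0 Sa0) c1.
  have cf2 := @cvg_f _ (nbhs (a0, b0)) (nbhs_filter _) snd b0 (sphere_neq0 Sb0) c2.
  have cB : (f p.1 - f p.2) @[p --> nbhs (a0, b0)] --> f a0 - f b0 by exact: cvgB.
  have cq := @cvg_qf _ (nbhs (a0, b0)) (nbhs_filter _) (fun p => f p.1 - f p.2) (fun=> v)
     _ _ cB cV.
  have v2 : qf (f a0 - f b0) v / 2 < qf (f a0 - f b0) v by lra.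
  have Hn FF : nbhs (a0, b0) [set p | qf (f a0 - f b0) v / 2 < qf (f p.1 - f p.2) v] :=
    @cvgr_gt _ _ _ FF _ _ cq _ v2.
  suff Hs : [set p | qf (f a0 - f b0) v / 2 < qf (f p.1 - f p.2) v] `<=` P m.
    exact: (@filterS _ _ (nbhs_filter (a0, b0)) _ _ Hs (Hn (nbhs_filter (a0, b0)))).
  move=> [a b] /= Hp; rewrite /P /= => a1 b1; exists v => //.
  have ab2 : `|a - b| <= 2.
    have := sphere_norm_le1 a1; have := sphere_norm_le1 b1.
    by have := ler_normB a b; lra.
  apply: le_trans ab2 _; rewrite mulrC -ler_pdivrMr ?ltr0n//.
  apply: le_trans (ltW Hp).
  apply: (@le_trans _ _ (2 * (qf (f a0 - f b0) v / 4))); last by lra.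
  by apply: ler_wpM2l => //; exact: ltW.
have [m Hm] := compact_unif cK mono loc.
by exists m => a b a1 b1; apply: (Hm (a, b)).
Qed.

(** Close points are compared through the tangent chart and the Taylor bound; for distant ones the
    bound on [f] itself is enough. *)
Lemma lipschitz_sphere : exists2 L : R, 0 < L &
  [/\ forall a, dot a a = 1 -> `|f a| <= L,
      forall a b, dot a a = 1 -> dot b b = 1 -> `|f a - f b| <= L * `|a - b|
    & forall a tau, dot a a = 1 -> `|Df a tau| <= L * `|tau|].
Proof.
have [m2 Hm2] := taylor_sphere.
pose M : R := m2.+1%:R.
have M0 : 0 < M by rewrite ltr0n.
have HD a tau : dot a a = 1 -> `|Df a tau| <= M * `|tau|.
  move=> a1; have a0 := sphere_neq0 a1.
  have [->|t0] := eqVneq tau 0.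
    have := DfZ a0 0 0; rewrite !scale0r => ->.
    by rewrite !normr0 mulr0.
  have tn : 0 < `|tau| by rewrite normr_gt0.
  have k0 : 0 < M * `|tau| by rewrite mulr_gt0.
  (* The Taylor bound concerns small increments only: [tau] is rescaled to length [M^-1], and
     linearity does the rest. *)
  have tE : tau = (M * `|tau|) *: ((M * `|tau|)^-1 *: tau).
    by rewrite scalerA mulfV ?scale1r// gt_eqF.
  have hn : `|(M * `|tau|)^-1 *: tau| = M^-1.
    rewrite normrZ ger0_norm ?invr_ge0 ?(ltW k0)// invfM -mulrA mulVf ?mulr1//.
    by rewrite gt_eqF.
  rewrite {1}tE DfZ// normrZ (ger0_norm (ltW k0)) ler_piMr ?(ltW k0)//.
  apply: ler_norm_entry => // i j.
  have [] := Hm2 a a1 i j ((M * `|tau|)^-1 *: tau); first by rewrite hn.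
  by move=> _ _; rewrite hn mxE -/M mulfV// gt_eqF.
have [B HB] : exists B : nat, forall a, dot a a = 1 -> `|f a| <= B%:R.
  apply: (@compact_unif _ [set a | dot a a = 1] (fun m a => `|f a| <= m%:R)).
  - exact: sphere_compact.
  - by move=> m l x ml H; apply: le_trans H _; rewrite ler_nat.
  move=> a /= a1; exists (Num.truncn (`|f a| + 1)).+1.
  have c1 := @cvg_f _ (nbhs a) (nbhs_filter _) id a (sphere_neq0 a1) cvg_id.
  have c2 := @cvgr_dist_lt _ _ _ (nbhs a) (nbhs_filter _) _ _ c1 _ ltr01.
  apply: (@filterS _ _ (nbhs_filter a) _ _ _ c2) => y /= Hy.
  apply: le_trans (ltW (truncnS_gt _)).
  by rewrite -lerBlDl (le_trans (lerB_dist _ _))// distrC ltW.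
have B0 : 0 <= B%:R :> R by rewrite ler0n.
have D0 : 0 <= d%:R :> R by rewrite ler0n.
pose Q : R := 1 + d%:R + 3 * M.
have Q0 : 0 < Q by rewrite /Q; lra.
exists (6 * M + B%:R + 2 * B%:R * Q); first by rewrite ltr_wpDr ?mulr_ge0// ?ltr_wpDr// ?mulr_gt0// ltW.
have BQ : 0 <= B%:R * Q by rewrite mulr_ge0// ltW.
split.
- by move=> a /HB H; apply: le_trans H _; lra.
- move=> a b a1 b1.
  have [abr|abr] := leP (`|a - b| * Q) 1; last first.
    apply: (@le_trans _ _ (2 * B%:R)).
      by apply: le_trans (ler_normB _ _) _; have := HB a a1; have := HB b b1; lra.
    apply: (@le_trans _ _ (2 * B%:R * (`|a - b| * Q))).
      by rewrite ler_peMr ?mulr_ge0// ltW.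
    have -> : 2 * B%:R * (`|a - b| * Q) = (2 * B%:R * Q) * `|a - b| by ring.
    by apply: ler_wpM2r => //; lra.
  have rb (c : R) : 0 <= c -> c <= Q -> c * `|a - b| <= 1.
    move=> c0 cQ; apply: le_trans abr; rewrite mulrC; exact: ler_wpM2l.
  have rD : d%:R * `|a - b| <= 1 by apply: rb => //; rewrite /Q; lra.
  have r1 : `|a - b| <= 1 by rewrite -[leLHS]mul1r; apply: rb => //; rewrite /Q; lra.
  have [tau [at0 t3 t2 [l l0 bE]]] := tangent_chart a1 b1 rD r1.
  have fb : f b = f (a + tau).
    rewrite bE f_homog//; apply/eqP => E; move: b1.
    by rewrite bE E scaler0 => /sphere_neq0; rewrite eqxx.
  have tM : `|tau| <= M^-1.
    apply: le_trans t3 _; rewrite -[leRHS]mul1r ler_pdivlMr//.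
    have -> : 3 * `|a - b| * M = 3 * M * `|a - b| by ring.
    by apply: rb; rewrite ?mulr_ge0 ?(ltW M0)// /Q; lra.
  have Rem := remainder_bound (Hm2 a a1) tM.
  have HDt := HD a tau a1.
  rewrite distrC fb.
  have -> : f (a + tau) - f a = (f (a + tau) - f a - Df a tau) + Df a tau by rewrite subrK.
  apply: le_trans (ler_normD _ _) _.
  have S1 : m2.+1%:R * `|tau| ^+ 2 <= `|tau|.
    rewrite expr2 mulrA ler_piMl// -ler_pdivlMl ?ltr0n// mulr1; exact: tM.
  have tab : M * `|tau| <= M * (3 * `|a - b|) by rewrite ler_pM2l.
  have M1 : 1 <= M by rewrite ler1n.
  have tab2 : `|tau| <= M * `|tau| by rewrite ler_peMl.
  have ab0 : 0 <= `|a - b| by [].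
  have e1 : 0 <= (B%:R + 2 * B%:R * Q) * `|a - b| by rewrite mulr_ge0//; lra.
  have -> : (6 * M + B%:R + 2 * B%:R * Q) * `|a - b| =
    2 * (M * (3 * `|a - b|)) + (B%:R + 2 * B%:R * Q) * `|a - b| by ring.
  have fin (x y t u z r : R) : x <= y -> y <= t -> t <= u -> z <= u -> u <= r -> x + z <= 2 * r.
    by lra.
  have := fin _ _ _ _ _ _ Rem S1 tab2 HDt tab; lra.
move=> a tau a1; apply: le_trans (HD a tau a1) _; apply: ler_wpM2r => //; lra.
Qed.

(** With [t = |a - b|] or [t = |tau|], the matrices in question have norm at most [L * t] and a
    value at least [t / M], so replacing [v] by a nearby point of a net costs a small multiple of
    [t] itself. One finite set of directions thus serves for all pairs, and a profile with finitely
    many terms can detect hyperbolicity. *)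
Lemma hyperbolic_net : exists (Vs : seq 'rV[R]_d) (c : R),
  [/\ 0 < c, forall v, v \in Vs -> `|v| <= 1,
   forall a b, dot a a = 1 -> dot b b = 1 ->
     exists2 v, v \in Vs & c * `|a - b| <= qf (f a - f b) v
   & forall a tau, dot a a = 1 -> dot a tau = 0 ->
     exists2 v, v \in Vs & c * `|tau| <= qf (Df a tau) v].
Proof.
have [m1 Hm1] := tangent_unif.
have [m2 Hm2] := secant_unif.
have [L L0 [_ L1 L2]] := lipschitz_sphere.
pose M : R := (m1 + m2).+1%:R.
have M0 : 0 < M by rewrite ltr0n.
pose D : R := d%:R.
have D0 : 0 <= D by rewrite ler0n.
have DL0 : 0 <= D ^+ 2 * L by apply: mulr_ge0; [exact: exprn_ge0|exact: ltW].
have E0 : 0 < D ^+ 2 * L + 1 by rewrite ltr_wpDl.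
(* Moving [v] by [del] changes the form by at most [2 * D ^+ 2 * L * t * del], which is at most half
   of [t / M]. *)
pose del := (4 * M * (D ^+ 2 * L + 1))^-1.
have del0 : 0 < del by rewrite invr_gt0 !mulr_gt0.
have [Vs [VsB Vsn]] : exists s : seq 'rV[R]_d, (forall y, y \in s -> `|y| <= 1) /\
    forall x, `|x| <= 1 -> exists2 y, y \in s & `|x - y| < del.
  apply: (@finite_net R _ [set x : 'rV[R]_d | `|x| <= 1]) => //.
  apply: bounded_closed_compact.
    exists 1; split; first exact: num_real.
    by move=> B B1 x /= x1; apply: le_trans x1 (ltW B1).
  have -> : [set x : 'rV[R]_d | `|x| <= 1] = (fun x => `|x|) @^-1` [set t | t <= 1] by [].
  by apply: closed_comp; [move=> x _; exact: norm_continuous|exact: closed_le].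
have key (N : 'M[R]_d) (t : R) v : 0 <= t -> `|N| <= L * t -> `|v| <= 1 -> M^-1 * t <= qf N v ->
    exists2 w, w \in Vs & (2 * M)^-1 * t <= qf N w.
  move=> t0 Nt v1 Nv; have [w wV vw] := Vsn v v1; exists w => //.
  have H := qf_dist_le N v w.
  have : `|qf N v - qf N w| <= (2 * M)^-1 * t.
    apply: le_trans H _.
    apply: (@le_trans _ _ (D ^+ 2 * (L * t) * 2 * del)).
      have D20 : 0 <= D ^+ 2 by exact: exprn_ge0.
      have P1 : D ^+ 2 * `|N| <= D ^+ 2 * (L * t) by exact: ler_wpM2l.
      have P10 : 0 <= D ^+ 2 * `|N| by exact: mulr_ge0.
      have P2 : `|v| + `|w| <= 2 by have := VsB w wV; lra.
      have P20 : 0 <= `|v| + `|w| by exact: addr_ge0.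
      have P3 := ler_pM P10 P20 P1 P2.
      exact: ler_pM (mulr_ge0 P10 P20) (normr_ge0 _) P3 (ltW vw).
    have -> : (2 * M)^-1 * t = (D ^+ 2 * L + 1) * t * 2 * del.
      by rewrite /del; field; rewrite ?gt_eqF.
    apply: ler_wpM2r; first exact: ltW.
    apply: ler_wpM2r => //; rewrite mulrA; apply: ler_wpM2r => //; lra.
  have E2 : M^-1 * t = 2 * ((2 * M)^-1 * t) by field; rewrite gt_eqF.
  rewrite E2 in Nv.
  have fin (x y u : R) : 2 * u <= x -> x - y <= u -> u <= y by lra.
  by move=> /ler_normlW; exact: fin.
exists Vs, (2 * M)^-1; split=> //.
- by rewrite invr_gt0 mulr_gt0.
- move=> a b a1 b1; have [v v1 Hv] := Hm2 a b a1 b1.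
  apply: (key _ _ v) => //; first exact: L1.
  have q0 := le_trans (normr_ge0 _) Hv.
  rewrite ler_pdivrMl//; apply: le_trans Hv _; apply: ler_wpM2r.
    by move: q0; rewrite pmulr_rge0.
  by rewrite ler_nat ltnS leq_addl.
move=> a tau a1 at0; have [v v1 Hv] := Hm1 a tau a1 at0.
apply: (key _ _ v) => //; first exact: L2.
have q0 := le_trans (normr_ge0 _) Hv.
  rewrite ler_pdivrMl//; apply: le_trans Hv _; apply: ler_wpM2r.
  by move: q0; rewrite pmulr_rge0.
by rewrite ler_nat ltnS leq_addr.
Qed.

End Net.

(** * Elliptic profiles, tents and soft minima *)

Section SquareRootProfile.
Variable R : realType.
Implicit Types (x y z t : R).

(** A smooth substitute for the absolute value: its second derivative [(1 + t ^ 2) ^ (-3 / 2)] is at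
    most 1, and bounded below on bounded sets. *)
Definition rt t : R := Num.sqrt (1 + t ^+ 2).

Lemma rt_sqr t : rt t ^+ 2 = 1 + t ^+ 2.
Proof. by rewrite sqr_sqrtr// addr_ge0// sqr_ge0. Qed.

Lemma rt_ge0 t : 0 <= rt t. Proof. exact: sqrtr_ge0. Qed.

Let le_sq (a b : R) : 0 <= b -> a ^+ 2 <= b ^+ 2 -> a <= b.
Proof.
move=> b0 ab; have [a0|a0] := leP 0 a; first by rewrite -(@ler_pXn2r _ 2).
exact: le_trans (ltW a0) b0.
Qed.

Lemma rt_ge_norm t : `|t| <= rt t.
Proof. by apply: le_sq; rewrite ?rt_ge0// real_normK ?num_real// rt_sqr lerDr. Qed.

Lemma rt_ge1 t : 1 <= rt t.
Proof. by apply: le_sq; rewrite ?rt_ge0// rt_sqr expr1n lerDl sqr_ge0. Qed.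

Lemma rt_lipschitz x y : `|rt x - rt y| <= `|x - y|.
Proof.
have s0 : 0 < rt x + rt y by rewrite ltr_wpDl ?rt_ge0// (lt_le_trans _ (rt_ge1 y)).
rewrite -(ler_pM2r s0) -{1}(ger0_norm (ltW s0)) -normrM.
have -> : (rt x - rt y) * (rt x + rt y) = (x - y) * (x + y).
  have -> : (rt x - rt y) * (rt x + rt y) = rt x ^+ 2 - rt y ^+ 2 by ring.
  by rewrite !rt_sqr; ring.
rewrite normrM; apply: ler_wpM2l => //.
by apply: le_trans (ler_normD _ _) _; apply: lerD; exact: rt_ge_norm.
Qed.

Lemma rt_second_difference x y : rt (x + y) + rt (x - y) - 2 * rt x <= y ^+ 2.
Proof.
have a1 := rt_ge1 x; have sa := rt_sqr x.
have sb := rt_sqr (x + y); have sc := rt_sqr (x - y).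
rewrite lerBlDr; apply: le_sq.
  by rewrite addr_ge0 ?sqr_ge0// mulr_ge0// rt_ge0.
move: a1 sa sb sc; move: (rt x) (rt (x + y)) (rt (x - y)) => a b c a1 sa sb sc.
have h1 : (b + c) ^+ 2 <= 2 * (b ^+ 2 + c ^+ 2).
  have := sqr_ge0 (b - c); rewrite !expr2; lra.
apply: le_trans h1 _; rewrite sb sc.
have y0 := sqr_ge0 y.
have -> : (y ^+ 2 + 2 * a) ^+ 2 = (y ^+ 2) ^+ 2 + 4 * a * y ^+ 2 + 4 * a ^+ 2 by ring.
rewrite sa.
have h2 : y ^+ 2 <= a * y ^+ 2 by rewrite ler_peMl.
have h3 : 0 <= (y ^+ 2) ^+ 2 by exact: sqr_ge0.
have -> : 2 * (1 + (x + y) ^+ 2 + (1 + (x - y) ^+ 2)) = 4 + 4 * x ^+ 2 + 4 * y ^+ 2 by ring.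
lra.
Qed.

(** Where [rt <= B] the second derivative is at least [1 / B ^ 3], and an eighth of this is the gain
    at the midpoint. The proof avoids derivatives: the gap is multiplied twice by conjugate
    expressions. *)
Lemma rt_midpoint (B x z : R) : 1 <= B -> rt x <= B -> rt z <= B ->
  rt ((x + z) / 2) <= (rt x + rt z) / 2 - (x - z) ^+ 2 / (8 * B ^+ 3).
Proof.
move=> B1 xB zB.
have B0 : 0 < B by lra.
have sa := rt_sqr x; have sb := rt_sqr z; have sm := rt_sqr ((x + z) / 2).
have a1 := rt_ge1 x; have b1 := rt_ge1 z; have m1 := rt_ge1 ((x + z) / 2).
move: sa sb sm a1 b1 m1 xB zB.
move: (rt x) (rt z) (rt ((x + z) / 2)) => a b m sa sb sm a1 b1 m1 aB bB.
have ab0 : 0 <= a * b by rewrite mulr_ge0//; lra.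
have xz : 1 + x * z <= a * b.
  apply: le_sq => //; rewrite exprMn sa sb.
  have := sqr_ge0 (x - z); rewrite !expr2; lra.
have E1 : ((a + b) / 2 - m) * ((a + b) / 2 + m) = (a * b - (1 + x * z)) / 2.
  have -> : ((a + b) / 2 - m) * ((a + b) / 2 + m) = (a ^+ 2 + b ^+ 2 + 2 * a * b) / 4 - m ^+ 2 by field.
  by rewrite sa sb sm; field.
have E2 : (a * b - (1 + x * z)) * (a * b + (1 + x * z)) = (x - z) ^+ 2.
  have -> : (a * b - (1 + x * z)) * (a * b + (1 + x * z)) = a ^+ 2 * b ^+ 2 - (1 + x * z) ^+ 2 by ring.
  by rewrite sa sb; ring.
have S0 : 0 < (a + b) / 2 + m by lra.
have d0 : 0 <= (a + b) / 2 - m.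
  by rewrite -(pmulr_lge0 _ S0) E1 divr_ge0// subr_ge0.
have abB : a * b <= B ^+ 2 by rewrite expr2; apply: ler_pM => //; lra.
have mB : m <= B by lra.
rewrite lerBrDr -lerBrDl ler_pdivrMr; last by rewrite mulr_gt0// exprn_gt0.
rewrite -E2.
have T0 : 0 <= a * b + (1 + x * z).
  have : - (1 + x * z) <= a * b.
    apply: le_sq => //; rewrite sqrrN exprMn sa sb.
    have := sqr_ge0 (x - z); rewrite !expr2; lra.
  lra.
have h1 : (a * b - (1 + x * z)) * (a * b + (1 + x * z)) <= (a * b - (1 + x * z)) * (2 * B ^+ 2).
  apply: ler_wpM2l; lra.
apply: le_trans h1 _.
have -> : (a * b - (1 + x * z)) = 2 * (((a + b) / 2 - m) * ((a + b) / 2 + m)) by rewrite E1; field.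
have h2 : ((a + b) / 2 - m) * ((a + b) / 2 + m) <= ((a + b) / 2 - m) * (2 * B).
  by apply: ler_wpM2l => //; lra.
have B20 : 0 <= B ^+ 2 by exact: sqr_ge0.
have -> : ((a + b) / 2 - m) * (8 * B ^+ 3) = 2 * (((a + b) / 2 - m) * (2 * B)) * (2 * B ^+ 2) by ring.
by apply: ler_wpM2r; [rewrite mulr_ge0|rewrite ler_pM2l].
Qed.

Lemma rt_le t B : `|t| <= B -> rt t <= 1 + B.
Proof.
move=> tB; have B0 : 0 <= B by apply: le_trans tB.
apply: le_sq; first by rewrite addr_ge0.
rewrite rt_sqr; have : t ^+ 2 <= B ^+ 2 by rewrite -(real_normK (num_real t)) ler_sqr ?nnegrE.
have -> : (1 + B) ^+ 2 = 1 + 2 * B + B ^+ 2 by ring.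
lra.
Qed.

End SquareRootProfile.

(** * Convex elliptic profiles *)

Section Profile.
Variables (R : realType) (d : nat).
Implicit Types (M N P : 'M[R]_d) (Vs : seq 'rV[R]_d).

Lemma CkO_entry k A (i j : 'I_d) : CkO k A (fun N : 'M[R]_d => N i j).
Proof.
apply: CkO_linear => [a x y|]; first by rewrite !mxE.
exact: coord_continuous.
Qed.

Lemma CkO_qf k (v : 'rV[R]_d) : CkO k setT (fun N => qf N v).
Proof.
apply: CkO_sum => [|i _]; first exact: openT.
apply: CkO_sum => [|j _]; first exact: openT.
apply: CkO_mul; [exact: openT|exact: CkO_entry|exact: CkO_cst].
Qed.

Lemma CkO_rt (V : normedModType R) k A (g : V -> R) : open A -> CkO k A g ->
  CkO k A (fun x => rt (g x)).
Proof.
move=> oA cg; apply: CkO_sqrt => // [x _|].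
  by rewrite ltr_wpDr ?sqr_ge0.
by apply: CkO_add => //; [exact: CkO_cst|exact: CkO_exprn].
Qed.

(** Three terms with three tasks. The trace makes [phi] elliptic with room to spare. The function
    [q + rt q] of [q = qf N v] is nonnegative, nondecreasing and at least [2 * q], so it forces
    growth when a direction of [Vs] is positive. The sum of the [rt] of the entries brings strict
    convexity on bounded sets. *)
Lemma exists_profile Vs (c L : R) : 0 < c -> 0 <= L ->
  (forall v, v \in Vs -> `|v| <= 1) ->
  exists (phi : 'M[R]_d -> R) (C : R),
  [/\ 0 < C,
    forall k, CkO k setT phi,
    forall N P, nonneg_def P -> `|P| <= phi (N + P) - phi N &
  [/\ forall M N, `|phi M - phi N| <= C * `|M - N|,
    forall B : R, exists2 kappa : R, 0 < kappa & forall M N, `|M| <= B -> `|N| <= B ->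
      phi (2^-1 *: (M + N)) <= (phi M + phi N) / 2 - kappa * `|M - N| ^+ 2,
    forall M N, phi (M + N) + phi (M - N) - 2 * phi M <= C * `|N| ^+ 2
    & forall N t, 0 <= t -> `|N| <= L * t -> (exists2 v, v \in Vs & c * t <= qf N v) ->
      t <= phi N]].
Proof.
move=> c0 L0 V1.
pose D : R := d%:R.
have D0 : 0 <= D by rewrite ler0n.
have D20 : 0 <= D ^+ 2 by exact: sqr_ge0.
(* [K] lets one positive direction outweigh the most negative possible trace: [2 * K * c * t = (D ^+
   2 + 1) * D * L * t + t]. *)
pose K : R := ((D ^+ 2 + 1) * D * L + 1) / (2 * c).
have K0 : 0 < K.
  by rewrite divr_gt0// ?mulr_gt0// ltr_wpDl// !mulr_ge0// addr_ge0.
pose phi N : R := (D ^+ 2 + 1) * \tr N + K * (\sum_(v <- Vs) (qf N v + rt (qf N v)))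
  + \sum_i \sum_j rt (N i j).
pose S : R := (size Vs)%:R.
have S0 : 0 <= S by rewrite ler0n.
(* The first three terms bound the Lipschitz constant, the third and the fourth the second
   differences; the 1 makes [C] positive. *)
pose C : R := (D ^+ 2 + 1) * D + 2 * K * S * D ^+ 2 + D ^+ 2 + K * S * D ^+ 4 + 1.
have KS : 0 <= K * S by rewrite mulr_ge0// ltW.
have C1 : 0 <= (D ^+ 2 + 1) * D by rewrite mulr_ge0// addr_ge0.
have C2 : 0 <= 2 * K * S * D ^+ 2.
  by rewrite -(mulrA 2); exact: mulr_ge0 (mulr_ge0 (ler0n _ 2) KS) D20.
have D40 : 0 <= D ^+ 4 by rewrite exprn_ge0.
have C3 : 0 <= K * S * D ^+ 4 := mulr_ge0 KS D40.
have sumVs (g h : 'rV[R]_d -> R) : (forall v, v \in Vs -> g v <= h v) ->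
    \sum_(v <- Vs) g v <= \sum_(v <- Vs) h v.
  by move=> gh; rewrite !big_seq; apply: ler_sum => v; exact: gh.
have sumc (z : R) : \sum_(v <- Vs) z = S * z.
  by rewrite big_const_seq count_predT iter_addr_0 mulr_natl.
exists phi, C; split.
- by rewrite /C; lra.
- move=> k; apply: CkO_add; [exact: openT| |].
    apply: CkO_add; [exact: openT| |].
      apply: CkO_scale; first exact: openT.
      by apply: CkO_sum => [|i _]; [exact: openT|exact: CkO_entry].
    apply: CkO_scale; first exact: openT.
    apply: CkO_sum => [|v _]; first exact: openT.
    apply: CkO_add; [exact: openT|exact: CkO_qf|apply: CkO_rt; [exact: openT|exact: CkO_qf]].
  apply: CkO_sum => [|i _]; first exact: openT.
  apply: CkO_sum => [|j _]; first exact: openT.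
  by apply: CkO_rt; [exact: openT|exact: CkO_entry].
- move=> N P nP.
  have t1 := nonneg_def_norm_le_tr nP.
  have q1 : \sum_(v <- Vs) (qf N v + rt (qf N v)) <= \sum_(v <- Vs) (qf (N + P) v + rt (qf (N + P) v)).
    apply: sumVs => v _; rewrite qfD.
    have := nonneg_def_qf v nP => q0.
    have := rt_lipschitz (qf N v) (qf N v + qf P v).
    have -> : qf N v - (qf N v + qf P v) = - qf P v by ring.
    rewrite normrN (ger0_norm q0) => /ler_normlW; lra.
  (* The entries of [P] have no sign, so this term may decrease by [D ^+ 2 * |P|]; the coefficient
     [D ^+ 2 + 1] of the trace absorbs it. *)
  have r1 : \sum_i \sum_j rt (N i j) - D ^+ 2 * `|P| <= \sum_i \sum_j rt ((N + P) i j).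
    have -> : D ^+ 2 * `|P| = \sum_(i < d) \sum_(j < d) `|P|.
      by rewrite !sum_ord_const mulrA.
    rewrite -sumrB; apply: ler_sum => i _; rewrite -sumrB; apply: ler_sum => j _.
    rewrite mxE lerBlDr -lerBlDl.
    have := rt_lipschitz (N i j) (N i j + P i j).
    have -> : N i j - (N i j + P i j) = - P i j by ring.
    rewrite normrN => /ler_normlW H; apply: le_trans H _; exact: ler_entry_norm.
  rewrite /phi [\tr _]mxtraceD.
  have := ler_wpM2l (ltW K0) q1; have : (D ^+ 2 + 1) * `|P| <= (D ^+ 2 + 1) * \tr P.
    by apply: ler_wpM2l => //; rewrite addr_ge0.
  move: q1 r1; set q := \sum_(v <- Vs) _; set q' := \sum_(v <- Vs) _.
  set s := \sum_i _; set s' := \sum_i _ => q1 r1 t2 q2.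
  have -> : (D ^+ 2 + 1) * (\tr N + \tr P) = (D ^+ 2 + 1) * \tr N + (D ^+ 2 + 1) * \tr P by ring.
  lra.
split.
- move=> M N.
  have trl : `|\tr M - \tr N| <= D * `|M - N|.
    rewrite -[\tr M - _](raddfB (@mxtrace R d)) /=.
    apply: le_trans (ler_norm_sum _ _ _) _; rewrite -sum_ord_const.
    by apply: ler_sum => i _; exact: ler_entry_norm.
  have ql : `|\sum_(v <- Vs) (qf M v + rt (qf M v)) - \sum_(v <- Vs) (qf N v + rt (qf N v))|
      <= S * (2 * D ^+ 2 * `|M - N|).
    rewrite -sumrB -sumc; apply: le_trans (ler_norm_sum _ _ _) _.
    apply: sumVs => v vV.
    have q1 : `|qf M v - qf N v| <= D ^+ 2 * `|M - N|.
      rewrite -qfB; apply: le_trans (qf_norm_le _ _) _.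
      rewrite ler_piMr ?mulr_ge0//.
      by rewrite exprn_ile1// V1.
    have := rt_lipschitz (qf M v) (qf N v).
    have -> : qf M v + rt (qf M v) - (qf N v + rt (qf N v)) =
      (qf M v - qf N v) + (rt (qf M v) - rt (qf N v)) by ring.
    move=> r1; apply: le_trans (ler_normD _ _) _; lra.
  have rl : `|\sum_i \sum_j rt (M i j) - \sum_i \sum_j rt (N i j)| <= D ^+ 2 * `|M - N|.
    have -> : D ^+ 2 * `|M - N| = \sum_(i < d) \sum_(j < d) `|M - N|.
      by rewrite !sum_ord_const mulrA.
    rewrite -sumrB; apply: le_trans (ler_norm_sum _ _ _) _; apply: ler_sum => i _.
    rewrite -sumrB; apply: le_trans (ler_norm_sum _ _ _) _; apply: ler_sum => j _.
    apply: le_trans (rt_lipschitz _ _) _.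
    have -> : M i j - N i j = (M - N) i j by rewrite !mxE.
    exact: ler_entry_norm.
  rewrite /phi; move: ql rl trl.
  set q := \sum_(v <- Vs) _; set q' := \sum_(v <- Vs) _.
  set s := \sum_i _; set s' := \sum_i _ => ql rl trl.
  have -> : (D ^+ 2 + 1) * \tr M + K * q + s - ((D ^+ 2 + 1) * \tr N + K * q' + s') =
    (D ^+ 2 + 1) * (\tr M - \tr N) + K * (q - q') + (s - s') by ring.
  have D21 : 0 <= D ^+ 2 + 1 by rewrite addr_ge0.
  have e1 : `|(D ^+ 2 + 1) * (\tr M - \tr N)| <= (D ^+ 2 + 1) * (D * `|M - N|).
    by rewrite normrM (ger0_norm D21) ler_wpM2l.
  have e2 : `|K * (q - q')| <= K * (S * (2 * D ^+ 2 * `|M - N|)).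
    by rewrite normrM (gtr0_norm K0) ler_pM2l.
  apply: le_trans (ler_normD _ _) _; apply: le_trans (lerD (ler_normD _ _) (lexx _)) _.
  have e3 : 0 <= (K * S * D ^+ 4 + 1) * `|M - N| by apply: mulr_ge0 => //; lra.
  have -> : C * `|M - N| = (D ^+ 2 + 1) * (D * `|M - N|) + K * (S * (2 * D ^+ 2 * `|M - N|))
    + D ^+ 2 * `|M - N| + (K * S * D ^+ 4 + 1) * `|M - N| by rewrite /C; ring.
  lra.
- move=> B.
  pose B1 : R := 1 + `|B|.
  have B11 : 1 <= B1 by rewrite lerDl.
  have B30 : 0 < 8 * B1 ^+ 3 by rewrite mulr_gt0// exprn_gt0//; lra.
  exists (8 * B1 ^+ 3)^-1; first by rewrite invr_gt0.
  move=> M N MB NB.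
  have D1 (X : 'M[R]_d) i j : `|X| <= B -> rt (X i j) <= B1.
    move=> XB; apply: rt_le; apply: le_trans (ler_entry_norm X i j) _.
    exact: le_trans XB (ler_norm _).
  have mid (q q' : R) : rt (2^-1 * (q + q')) <= (rt q + rt q') / 2.
    pose Bq := rt q + rt q'.
    have := @rt_midpoint R Bq q q'; have := rt_ge1 q; have := rt_ge1 q' => h1 h2 h3.
    have : (q - q') ^+ 2 / (8 * Bq ^+ 3) >= 0.
      by apply: divr_ge0; [exact: sqr_ge0|rewrite mulr_ge0// exprn_ge0// addr_ge0 ?rt_ge0].
    by rewrite (mulrC 2^-1); have := h3 _ _ _; rewrite /Bq; lra.
  have q1 : \sum_(v <- Vs) (qf (2^-1 *: (M + N)) v + rt (qf (2^-1 *: (M + N)) v)) <=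
     (\sum_(v <- Vs) (qf M v + rt (qf M v)) + \sum_(v <- Vs) (qf N v + rt (qf N v))) / 2.
    rewrite -big_split mulr_suml; apply: sumVs => v _ /=; rewrite qfZ qfD.
    by have := mid (qf M v) (qf N v); lra.
  have r1 : \sum_i \sum_j rt ((2^-1 *: (M + N)) i j) <=
     (\sum_i \sum_j rt (M i j) + \sum_i \sum_j rt (N i j)) / 2
       - (8 * B1 ^+ 3)^-1 * \sum_i \sum_j (M i j - N i j) ^+ 2.
    rewrite -big_split mulr_suml mulr_sumr -sumrB; apply: ler_sum => i _ /=.
    rewrite -big_split mulr_suml mulr_sumr -sumrB; apply: ler_sum => j _ /=.
    have := rt_midpoint B11 (D1 M i j MB) (D1 N i j NB).
    rewrite !mxE mulrC [(8 * B1 ^+ 3)^-1 * _]mulrC; exact.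
  have n1 : `|M - N| ^+ 2 <= \sum_i \sum_j (M i j - N i j) ^+ 2.
    set s := \sum_i _.
    have s0 : 0 <= s by apply: sumr_ge0 => i _; apply: sumr_ge0 => j _; exact: sqr_ge0.
    rewrite -[leRHS]sqr_sqrtr// ler_sqr ?nnegrE ?sqrtr_ge0//.
    apply: ler_norm_entry => [|i j]; first exact: sqrtr_ge0.
    rewrite -ler_sqr ?nnegrE ?sqrtr_ge0// sqr_sqrtr// real_normK ?num_real//.
    rewrite !mxE /s (bigD1 i)//= (bigD1 j)//= -addrA lerDl; apply: addr_ge0.
      by apply: sumr_ge0 => k _; exact: sqr_ge0.
    by apply: sumr_ge0 => k _; apply: sumr_ge0 => l _; exact: sqr_ge0.
  have tE : \tr (2^-1 *: (M + N)) = 2^-1 * (\tr M + \tr N) by rewrite mxtraceZ mxtraceD.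
  have B3i : 0 <= (8 * B1 ^+ 3)^-1 by rewrite invr_ge0 ltW.
  have q2 := ler_wpM2l (ltW K0) q1; have n2 := ler_wpM2l B3i n1.
  rewrite /phi tE; move: q2 r1 n2.
  set q := \sum_(v <- Vs) _; set q' := \sum_(v <- Vs) _; set q'' := \sum_(v <- Vs) _.
  set s := \sum_i _; set s' := \sum_i _; set s'' := \sum_i _; set s3 := \sum_i _.
  set k := (8 * B1 ^+ 3)^-1; set n := k * _; set n3 := k * s3.
  have -> : K * ((q' + q'') / 2) = K * q' / 2 + K * q'' / 2 by field.
  have -> : (D ^+ 2 + 1) * (2^-1 * (\tr M + \tr N)) =
     (D ^+ 2 + 1) * \tr M / 2 + (D ^+ 2 + 1) * \tr N / 2 by field.
  lra.
- move=> M N.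
  have q1 : \sum_(v <- Vs) (qf (M + N) v + rt (qf (M + N) v)) +
      \sum_(v <- Vs) (qf (M - N) v + rt (qf (M - N) v)) -
      2 * \sum_(v <- Vs) (qf M v + rt (qf M v)) <= S * (D ^+ 4 * `|N| ^+ 2).
    rewrite -big_split mulr_sumr -sumrB -sumc; apply: sumVs => v vV /=.
    have := rt_second_difference (qf M v) (qf N v); rewrite -qfD -qfB.
    have qn : `|qf N v| <= D ^+ 2 * `|N|.
      apply: le_trans (qf_norm_le _ _) _.
      by rewrite ler_piMr ?mulr_ge0// exprn_ile1// V1.
    have : qf N v ^+ 2 <= D ^+ 4 * `|N| ^+ 2.
      have -> : D ^+ 4 * `|N| ^+ 2 = (D ^+ 2 * `|N|) ^+ 2 by ring.
      by rewrite -(real_normK (num_real (qf N v))) ler_sqr ?nnegrE ?mulr_ge0.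
    have : qf (M + N) v + qf (M - N) v = 2 * qf M v by rewrite qfD qfB; ring.
    lra.
  have r1 : \sum_i \sum_j rt ((M + N) i j) + \sum_i \sum_j rt ((M - N) i j)
       - 2 * \sum_i \sum_j rt (M i j) <= D ^+ 2 * `|N| ^+ 2.
    have -> : D ^+ 2 * `|N| ^+ 2 = \sum_(i < d) \sum_(j < d) `|N| ^+ 2.
      by rewrite !sum_ord_const mulrA.
    rewrite -big_split mulr_sumr -sumrB; apply: ler_sum => i _ /=.
    rewrite -big_split mulr_sumr -sumrB; apply: ler_sum => j _ /=.
    have := rt_second_difference (M i j) (N i j).
    have : N i j ^+ 2 <= `|N| ^+ 2.
      rewrite -(real_normK (num_real (N i j))) ler_sqr ?nnegrE//; exact: ler_entry_norm.
    rewrite !mxE; lra.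
  have q2 := ler_wpM2l (ltW K0) q1.
  have trB : \tr (M - N) = \tr M - \tr N by rewrite raddfB.
  rewrite /phi mxtraceD trB; move: q2 r1.
  set q := \sum_(v <- Vs) _; set q' := \sum_(v <- Vs) _; set q'' := \sum_(v <- Vs) _.
  set s := \sum_i _; set s' := \sum_i _; set s'' := \sum_i _.
  have n0 : 0 <= ((D ^+ 2 + 1) * D + 2 * K * S * D ^+ 2 + 1) * `|N| ^+ 2.
    by apply: mulr_ge0; [lra|exact: exprn_ge0].
  have -> : C * `|N| ^+ 2 = K * (S * (D ^+ 4 * `|N| ^+ 2)) + D ^+ 2 * `|N| ^+ 2 +
     ((D ^+ 2 + 1) * D + 2 * K * S * D ^+ 2 + 1) * `|N| ^+ 2 by rewrite /C; ring.
  have -> : K * (q + q' - 2 * q'') = K * q + K * q' - 2 * (K * q'') by ring.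
  have -> : (D ^+ 2 + 1) * (\tr M + \tr N) + K * q + s + ((D ^+ 2 + 1) * (\tr M - \tr N) + K * q' + s')
    - 2 * ((D ^+ 2 + 1) * \tr M + K * q'' + s'') =
    K * q + K * q' - 2 * (K * q'') + (s + s' - 2 * s'') by ring.
  move: (_ * `|N| ^+ 2) n0 => n n0; lra.
move=> N t t0 Nt [v vV Hv].
have q0 (u : 'rV[R]_d) : 0 <= qf N u + rt (qf N u).
  by have := rt_ge_norm (qf N u); rewrite ler_norml; lra.
have q1 : 2 * (c * t) <= \sum_(u <- Vs) (qf N u + rt (qf N u)).
  rewrite (big_rem v vV) /=.
  have : 0 <= \sum_(u <- rem v Vs) (qf N u + rt (qf N u)) by apply: sumr_ge0 => u _; exact: q0.
  have := rt_ge_norm (qf N v); rewrite ler_norml; lra.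
have tr1 : - (D * (L * t)) <= \tr N.
  have : - \tr N <= D * `|N|.
    by rewrite -(raddfN (@mxtrace R d)) -normrN; exact: tr_le_norm.
  have : D * `|N| <= D * (L * t) by exact: ler_wpM2l.
  lra.
have r0 : 0 <= \sum_i \sum_j rt (N i j).
  by apply: sumr_ge0 => i _; apply: sumr_ge0 => j _; exact: rt_ge0.
have D21 : 0 <= D ^+ 2 + 1 by rewrite addr_ge0.
have h1 := ler_wpM2l D21 tr1; have h2 := ler_wpM2l (ltW K0) q1.
have KE : K * (2 * (c * t)) = (D ^+ 2 + 1) * (D * (L * t)) + t.
  by rewrite /K; field; rewrite gt_eqF.
rewrite KE in h2; rewrite mulrN in h1; rewrite /phi.
move: h1 h2 r0; set q := \sum_(v <- Vs) _; set s := \sum_i _; lra.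
Qed.

End Profile.

Lemma nonneg_def_scale (R : realType) d (P : 'M[R]_d) (c : R) :
  0 <= c -> nonneg_def P -> nonneg_def (c *: P).
Proof.
move=> c0 nP; split.
  by have [PT _] := nP; rewrite /symmx /= linearZ /= PT.
by move=> x; rewrite -qfE qfZ mulr_ge0//; exact: nonneg_def_qf.
Qed.

Lemma lipschitz_continuous (R : realType) (V W : normedModType R) (g : V -> W) (C : R) :
  (forall x y, `|g x - g y| <= C * `|x - y|) -> continuous g.
Proof.
move=> H x; apply/(@cvgrPdist_le _ _ _ (nbhs x) (nbhs_filter x)) => e e0.
have C0 : 0 < `|C| + 1 by rewrite ltr_wpDl.
apply/nbhs_ballP; exists (e / (`|C| + 1)); first by rewrite /= divr_gt0.
move=> y; rewrite -ball_normE /ball_ /= => xy.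
apply: le_trans (H _ _) _; apply: (@le_trans _ _ ((`|C| + 1) * `|x - y|)).
  by apply: ler_wpM2r => //; have := ler_norm C; lra.
by rewrite mulrC -ler_pdivlMr// ltW.
Qed.

Lemma CkO_affine (R : realType) (V : normedModType R) k (phi : V -> R) (c : R) (a b : V) :
  CkO k setT phi -> CkO k setT (fun x => phi (a + c *: (x - b))).
Proof.
elim: k phi => [|k IH] phi cphi.
  split=> // x _; apply: (@continuous_comp _ _ _ (fun x => a + c *: (x - b)) phi).
    apply: cvgD; first exact: cvg_cst.
    by apply: cvgZr; apply: cvgB; [exact: cvg_id|exact: cvg_cst].
  exact: CkO_cont cphi I.
have cE x : {for x, continuous (fun x => a + c *: (x - b))}.
  apply: cvgD; first exact: cvg_cst.
  by apply: cvgZr; apply: cvgB; [exact: cvg_id|exact: cvg_cst].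
apply: CkO_succ; first exact: openT.
  move=> x _; apply: (@continuous_comp _ _ _ (fun x => a + c *: (x - b)) phi); first exact: cE.
  exact: CkO_cont cphi I.
move=> v; exists (fun x => 'D_(c *: v) phi (a + c *: (x - b))); split; last first.
  by apply: (IH ('D_(c *: v) phi)); exact: CkO_derive.
move=> x _.
have [d1 d2] := derivableP (CkO_derivable (v := c *: v) cphi (I : setT (a + c *: (x - b)))).
have E : (fun h : R => h^-1 *: (((fun x => phi (a + c *: (x - b))) \o shift x) (h *: v)
    - phi (a + c *: (x - b)))) =
  (fun h : R => h^-1 *: ((phi \o shift (a + c *: (x - b))) (h *: (c *: v)) - phi (a + c *: (x - b)))).
  apply/funext => h /=; congr (_ *: (phi _ - _)).
  by rewrite -addrA scalerDr addrCA !scalerA mulrC.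
by split; rewrite /derivable /derive E.
Qed.

(** * Tents attached to the points of the sphere *)

Section Tents.
Variables (R : realType) (d : nat).
Implicit Types (x y z v w a b tau : 'rV[R]_d) (M N P : 'M[R]_d).

Local Notation nz := [set x : 'rV[R]_d | x != 0].

Let half_double M : 2^-1 *: (M + M) = M.
Proof. by apply/matrixP => i j; rewrite !mxE; field. Qed.

Variable f : 'rV[R]_d -> 'M[R]_d.
Hypothesis f_smooth : forall k i j, CkO k nz (fun x => f x i j).
Hypothesis f_homog : forall (t : R) x, 0 < t -> x != 0 -> f (t *: x) = f x.
Hypothesis secant : forall a b, dot a a = 1 -> dot b b = 1 -> a != b ->
  exists v, 0 < qf (f a - f b) v.
Hypothesis tangent : forall a tau, dot a a = 1 -> dot tau tau = 1 -> dot a tau = 0 ->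
  exists v, 0 < qf (Df f a tau) v.

Let Df a tau := Df f a tau.

(* The base point of the tent at [a] is a minimizer of [phi] on the tangent space of
   [f] at [a], so that [phi] restricted to that space, recentred there, is nonnegative. *)
Lemma exists_tents : exists (Phi : 'rV[R]_d -> 'M[R]_d -> R) (C : R), 0 < C /\
  forall a, dot a a = 1 ->
  [/\ forall k, CkO k setT (Phi a),
    forall N P, nonneg_def P -> `|P| <= Phi a (N + P) - Phi a N,
    forall M N, `|Phi a M - Phi a N| <= C * `|M - N| &
  [/\ forall b, dot b b = 1 -> 0 <= Phi a (f b),
    forall b, dot b b = 1 -> Phi a (f b) <= C * `|a - b| ^+ 2
    & forall M N, Phi a (M + N) + Phi a (M - N) - 2 * Phi a M <= C * `|N| ^+ 2]].
Proof.
have low_bound (p1 p2 p3 q0 C1 C2 t : R) : p1 - p2 <= C1 -> t <= p1 -> C2 + q0 + 1 <= t ->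
  p3 <= q0 -> C1 <= C2 -> p3 <= p2 by move=> *; lra.
have mid_bound (p1 p2 p3 p4 g1 g2 c1 c2 : R) : p2 <= (p1 + p3) / 2 - g2 -> p1 <= p2 -> g1 <= g2 ->
  c1 <= c2 -> p3 - p4 <= c1 -> c2 <= 2 * g1 -> p1 <= p4 by move=> *; lra.
have up_bound (p1 p2 p3 p4 c1 c2 c3 c4 : R) : p3 + p2 - 2 * p1 <= c1 -> p1 <= p2 -> p4 - p3 <= c3 ->
  c3 <= c4 -> c1 <= c2 -> p4 - p1 <= c2 + c4 by move=> *; lra.
have sum_bound (x y z t : R) : 0 < x -> 0 <= y -> 0 <= z -> 0 <= t ->
  [/\ 0 < x + y + z + t, y <= x + y + z + t, z <= x + y + z + t & t <= x + y + z + t].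
  by move=> *; split; lra.
have [Vs [c [c0 V1 Hsec Htan]]] := hyperbolic_net f_smooth f_homog secant tangent.
have [L L0 [_ L1 L2]] := lipschitz_sphere f_smooth f_homog.
have [m2 Hm2] := taylor_sphere f_smooth.
have [phi [C [C0 phi_smooth phi_ell [phi_lip phi_mid phi_sec phi_low]]]] :=
  exists_profile c0 (ltW L0) V1.
pose D : R := d%:R.
have D0 : 0 <= D by rewrite ler0n.
pose M2 : R := m2.+1%:R.
have M20 : 0 < M2 by rewrite ltr0n.
pose p0 := `|phi 0|.
have p00 : 0 <= p0 := normr_ge0 _.
(* For [tau] orthogonal to [a] one has [phi (Df a tau) >= |tau|], so a minimizer in the ball of
   radius [|phi 0|] is a minimizer among all such [tau]. For [a] off the sphere, 0 is a default. *)
have min_exists a : exists ta, dot a a = 1 -> [/\ dot a ta = 0, `|ta| <= p0 &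
    forall tau, dot a tau = 0 -> phi (Df a ta) <= phi (Df a tau)].
  have [a1|na] := pselect (dot a a = 1); last by exists 0.
  have a0 := sphere_neq0 a1.
  pose K : set 'rV[R]_d := [set tau | `|tau| <= p0] `&` [set tau | dot a tau = 0].
  have K0 : K 0 by split; rewrite /= ?normr0// -(scale0r (0 : 'rV[R]_d)) dotZr mul0r.
  have cK : compact K.
    apply: bounded_closed_compact.
      exists p0; split; first exact: num_real.
      by move=> B B1 x [/= x1 _]; apply: le_trans x1 (ltW B1).
    apply: closedI.
      have -> : [set x : 'rV[R]_d | `|x| <= p0] = (fun x => `|x|) @^-1` [set t | t <= p0] by [].
      by apply: closed_comp; [move=> x _; exact: norm_continuous|exact: closed_le].
    have -> : [set x : 'rV[R]_d | dot a x = 0] = (fun x => dot a x) @^-1` [set 0] by [].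
    apply: closed_comp; last exact: closed_eq.
    move=> x _.
    have ca : (fun=> a) @ nbhs x --> a by exact: cvg_cst.
    exact: (@continuous_dot _ _ _ (nbhs x) _ (fun=> a) id _ _ ca cvg_id).
  have cg : continuous (fun tau => phi (Df a tau)).
    apply: (@lipschitz_continuous _ _ _ _ (C * L)) => x y.
    apply: le_trans (phi_lip _ _) _; rewrite -mulrA ler_pM2l//.
    have -> : Df a x - Df a y = Df a (x - y).
      rewrite /Df [LHS]addrC -scaleN1r -(Df_is_linear f_smooth a0) scaleN1r.
      by rewrite (addrC (- y)).
    exact: L2.
  have [|ta] := @compact_EVT_min _ R _ K _ cK (continuous_subspaceT cg); first by exists 0.
  rewrite inE => -[/= tap0 ta0] tamin; exists ta => _; split=> // tau at0.
  have [tp|tp] := leP `|tau| p0; first by apply: tamin; rewrite inE.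
  have Df0 : Df a 0 = 0 by have := DfZ f_smooth a0 0 0; rewrite !scale0r.
  apply: le_trans (tamin 0 _) _; first by rewrite inE.
  rewrite Df0; apply: le_trans (ler_norm _) _; apply: le_trans (ltW tp) _.
  by apply: phi_low => //; [exact: L2|exact: Htan].
have [ta taP] := choice min_exists.
pose Na a := Df a (ta a).
(* When [|a - b|] is at least [R0 * s], the linear growth of [phi] exceeds the cost of the shift by
   [Na a] and the value [phi (Na a)]. *)
pose R0 := C * (L * p0) + p0 + 1.
have CLp : 0 <= C * (L * p0) by rewrite !mulr_ge0// ltW.
have R00 : 0 < R0 by rewrite /R0; lra.
(* A bound for the base point and for its translates by [Df a (s^-1 *: tau)] when
   [|a - b| < R0 * s]; [kap] is the modulus of convexity there. *)
pose B := L * p0 + L * (3 * R0).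
have [kap kap0 Hkap] := phi_mid B.
(* For [tau] orthogonal to [a], [|Df a tau| >= c' * |tau|]. *)
pose c' := c / (D ^+ 2 + 1).
have D21 : 0 < D ^+ 2 + 1 by rewrite ltr_wpDl// sqr_ge0.
have c'0 : 0 < c' by rewrite divr_gt0.
(* The scale [s = Q^-1] is so small that the chart exists up to distance [R0 * s] and that the
   convexity gain, of order [(|tau| / s) ^ 2], beats the Taylor error, of order [|tau| ^ 2 / s]. *)
pose Q := R0 * (1 + D + 3 * M2) + C * M2 / (2 * kap * c' ^+ 2).
have Q1 : 0 < R0 * (1 + D + 3 * M2) by rewrite mulr_gt0//; lra.
have Q2 : 0 < C * M2 / (2 * kap * c' ^+ 2).
  by apply: divr_gt0; apply: mulr_gt0 => //; [exact: mulr_gt0|exact: exprn_gt0].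
have Q0 : 0 < Q by rewrite /Q; lra.
pose s := Q^-1.
have s0 : 0 < s by rewrite invr_gt0.
have sQ (t : R) : t <= Q -> t * s <= 1 by move=> tQ; rewrite ler_pdivrMr// mul1r.
(* The dilation keeps the ellipticity and Lipschitz constants and multiplies the bound on second
   differences by [s^-1]. *)
pose Phi a M := s * (phi (Na a + s^-1 *: (M - f a)) - phi (Na a)).
pose C' := C + C / s + 9 * (C * L ^+ 2 / s + C * M2) + C * L / (R0 * s).
have e1 : 0 <= C / s by rewrite divr_ge0// ltW.
have e2 : 0 <= C * L ^+ 2 / s by rewrite divr_ge0 ?mulr_ge0 ?sqr_ge0// ltW.
have e3 : 0 <= C * M2 by rewrite mulr_ge0// ltW.
have e4 : 0 <= C * L / (R0 * s) by rewrite divr_ge0 ?mulr_ge0// ltW.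
have [Cpos Cb1 Cb2 Cb3] := sum_bound _ _ _ _ C0 e1 (mulr_ge0 (ler0n R 9) (addr_ge0 e2 e3)) e4.
exists Phi, C'; split=> //.
move=> a a1; have a0 := sphere_neq0 a1.
have [at0 tap0 tamin] := taP a a1.
have Nmin tau : dot a tau = 0 -> phi (Na a) <= phi (Na a + Df a tau).
  move=> t0; have -> : Na a + Df a tau = Df a (ta a + tau).
    by have := Df_is_linear f_smooth a0 1 (ta a) tau; rewrite !scale1r.
  by apply: tamin; rewrite dotDr at0 t0 addr0.
have NaB : `|Na a| <= L * p0 by apply: le_trans (L2 _ _ a1) _; rewrite ler_pM2l.
have NaP : phi (Na a) <= p0.
  apply: le_trans (ler_norm (phi 0)).
  have -> : 0 = Df a 0 by have := DfZ f_smooth a0 0 0; rewrite !scale0r.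
  by apply: tamin; rewrite -(scale0r (0 : 'rV[R]_d)) dotZr mul0r.
have near b : dot b b = 1 -> `|a - b| < R0 * s -> exists tau, [/\ dot a tau = 0,
    `|tau| <= 3 * `|a - b|, `|tau| <= M2^-1 & f b = f (a + tau)].
  move=> b1 ab.
  have rb (t : R) : 0 <= t -> R0 * t <= Q -> t * `|a - b| <= 1.
    move=> t0 tQ; apply: le_trans (sQ _ tQ).
    have -> : R0 * t * s = t * (R0 * s) by ring.
    by apply: ler_wpM2l => //; exact: ltW.
  have leQ (t : R) : t <= 1 + D + 3 * M2 -> R0 * t <= Q.
    by move=> tt; apply: (@le_trans _ _ (R0 * (1 + D + 3 * M2))); [rewrite ler_pM2l|rewrite /Q; lra].
  have rD : d%:R * `|a - b| <= 1 by apply: rb => //; apply: leQ; rewrite -/D; lra.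
  have r1 : `|a - b| <= 1 by rewrite -[leLHS]mul1r; apply: rb => //; apply: leQ; lra.
  have [tau [at' t3 t2 [l l0 bE]]] := tangent_chart a1 b1 rD r1.
  exists tau; split=> //.
    apply: le_trans t3 _; rewrite -[leRHS]mul1r ler_pdivlMr//.
    have -> : 3 * `|a - b| * M2 = 3 * M2 * `|a - b| by ring.
    by apply: rb; [rewrite mulr_ge0// ltW|apply: leQ; lra].
  rewrite bE f_homog//; apply/eqP => E; move: b1.
  by rewrite bE E scaler0 => /sphere_neq0; rewrite eqxx.
pose err tau := s^-1 *: (f (a + tau) - f a - Df a tau).
have errE tau : Na a + s^-1 *: (f (a + tau) - f a) = (Na a + Df a (s^-1 *: tau)) + err tau.
  rewrite /Df DfZ// -addrA -scalerDr; congr (_ + _ *: _).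
  by rewrite [RHS]addrC subrK.
have errB tau : `|tau| <= M2^-1 -> C * `|err tau| <= C * M2 / s * `|tau| ^+ 2.
  move=> tM; rewrite normrZ gtr0_norm ?invr_gt0//.
  have -> : C * M2 / s * `|tau| ^+ 2 = C * (s^-1 * (M2 * `|tau| ^+ 2)) by ring.
  rewrite ler_pM2l// ler_pM2l ?invr_gt0//.
  exact: remainder_bound (Hm2 a a1) tM.
have DfN' tau : dot a tau = 0 -> `|Df a (s^-1 *: tau)| <= L * (s^-1 * `|tau|).
  by move=> _; apply: le_trans (L2 _ _ a1) _; rewrite normrZ gtr0_norm ?invr_gt0.
have DfL tau : dot a tau = 0 -> c' * (s^-1 * `|tau|) <= `|Df a (s^-1 *: tau)|.
  move=> at'.
  have [|v vV Hv] := Htan a (s^-1 *: tau) a1; first by rewrite dotZr at' mulr0.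
  move: Hv; rewrite normrZ gtr0_norm ?invr_gt0// => Hv.
  have : qf (Df a (s^-1 *: tau)) v <= (D ^+ 2 + 1) * `|Df a (s^-1 *: tau)|.
    apply: le_trans (ler_norm _) _; apply: le_trans (qf_norm_le _ _) _.
    apply: (@le_trans _ _ (D ^+ 2 * `|Df a (s^-1 *: tau)|)).
      by rewrite ler_piMr ?mulr_ge0 ?exprn_ge0// exprn_ile1// V1.
    by apply: ler_wpM2r => //; lra.
  move=> /(le_trans Hv) H.
  have -> : c' * (s^-1 * `|tau|) = (c * (s^-1 * `|tau|)) / (D ^+ 2 + 1) by rewrite /c'; ring.
  by rewrite ler_pdivrMr// [leRHS]mulrC.
have lipP M N : `|Phi a M - Phi a N| <= C * `|M - N|.
  rewrite /Phi -mulrBr normrM (gtr0_norm s0).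
  have := phi_lip (Na a + s^-1 *: (M - f a)) (Na a + s^-1 *: (N - f a)).
  have -> : Na a + s^-1 *: (M - f a) - (Na a + s^-1 *: (N - f a)) = s^-1 *: (M - N).
    by rewrite opprD addrACA subrr add0r -scalerBr opprB addrA subrK.
  rewrite normrZ gtr0_norm ?invr_gt0// => H.
  have -> : phi (Na a + s^-1 *: (M - f a)) - phi (Na a) - (phi (Na a + s^-1 *: (N - f a)) - phi (Na a))
     = phi (Na a + s^-1 *: (M - f a)) - phi (Na a + s^-1 *: (N - f a)) by ring.
  apply: (@le_trans _ _ (s * (C * (s^-1 * `|M - N|)))); first by rewrite ler_pM2l.
  by rewrite le_eqVlt; apply/orP; left; apply/eqP; field; rewrite gt_eqF.
split.
- move=> k; apply: CkO_scale; first exact: openT.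
  apply: CkO_sub2; [exact: openT| |exact: CkO_cst].
  exact: (@CkO_affine _ _ k phi s^-1 (Na a) (f a) (phi_smooth k)).
- move=> N P nP; rewrite /Phi -mulrBr.
  have -> : Na a + s^-1 *: (N + P - f a) = (Na a + s^-1 *: (N - f a)) + s^-1 *: P.
    by rewrite -[RHS]addrA -scalerDr [in RHS]addrAC.
  have sP : nonneg_def (s^-1 *: P) by apply: nonneg_def_scale => //; rewrite invr_ge0 ltW.
  have := phi_ell (Na a + s^-1 *: (N - f a)) _ sP.
  rewrite normrZ gtr0_norm ?invr_gt0// ler_pdivrMl// => H; apply: le_trans H _.
  by rewrite ler_pM2l//; lra.
- move=> M N; apply: le_trans (lipP M N) _.
  by apply: ler_wpM2r => //; rewrite /C'; lra.
split.
- move=> b b1; rewrite /Phi pmulr_rge0// subr_ge0.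
  (* Far from [a] the growth of [phi] along a positive direction of [f b - f a] decides; near [a],
     minimality and strict convexity do. *)
  have [ab|ab] := ltP `|a - b| (R0 * s); last first.
    have [v vV Hv] := Hsec b a b1 a1.
    have ab' : R0 <= s^-1 * `|b - a| by rewrite ler_pdivlMl// mulrC distrC.
    have low : s^-1 * `|b - a| <= phi (s^-1 *: (f b - f a)).
      apply: phi_low; first by rewrite mulr_ge0// invr_ge0 ltW.
        rewrite normrZ gtr0_norm ?invr_gt0//.
        have -> : L * (s^-1 * `|b - a|) = s^-1 * (L * `|b - a|) by ring.
        by rewrite ler_pM2l ?invr_gt0//; exact: L1.
      exists v => //; rewrite qfZ.
      have -> : c * (s^-1 * `|b - a|) = s^-1 * (c * `|b - a|) by ring.
      by rewrite ler_pM2l ?invr_gt0.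
    have := phi_lip (s^-1 *: (f b - f a)) (Na a + s^-1 *: (f b - f a)).
    have -> : s^-1 *: (f b - f a) - (Na a + s^-1 *: (f b - f a)) = - Na a by rewrite opprD addrCA subrr addr0.
    rewrite normrN => /ler_normlW H.
    have CN : C * `|Na a| <= C * (L * p0) by rewrite ler_pM2l.
    exact: low_bound H low ab' NaP CN.
  have [tau [at' t3 tM ->]] := near b b1 ab.
  rewrite errE.
  set N' := Df a (s^-1 *: tau).
  have t0' : dot a (s^-1 *: tau) = 0 by rewrite dotZr at' mulr0.
  have N'B : `|N'| <= L * (3 * R0).
    apply: le_trans (DfN' _ at') _; rewrite ler_pM2l// ler_pdivrMl//.
    apply: le_trans t3 _; have -> : s * (3 * R0) = 3 * (R0 * s) by ring.
    by apply: ler_wpM2l => //; exact: ltW.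
  have LR : 0 <= L * (3 * R0) by rewrite !mulr_ge0// ltW.
  have LP : 0 <= L * p0 by rewrite mulr_ge0// ltW.
  have B1 : `|Na a| <= B by apply: le_trans NaB _; rewrite lerDl.
  have B2 : `|Na a + N'| <= B by apply: le_trans (ler_normD _ _) _; exact: lerD.
  have := Hkap _ _ B1 B2.
  (* The midpoint of the base point and of its translate lies in the tangent space, where [phi] is
     at least [phi (Na a)]; strict convexity then raises the value at the translate by twice the
     gain. *)
  have -> : 2^-1 *: (Na a + (Na a + N')) = Na a + Df a (2^-1 *: (s^-1 *: tau)).
    rewrite addrA scalerDr half_double; congr (_ + _).
    exact/esym/(DfZ f_smooth a0).
  have t0'' : dot a (2^-1 *: (s^-1 *: tau)) = 0 by rewrite dotZr t0' mulr0.
  move=> Hm; have Hn := Nmin _ t0''.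
  have EN : Na a - (Na a + N') = - N' by rewrite opprD addrA subrr add0r.
  rewrite EN normrN in Hm.
  have gain : kap * (c' * (s^-1 * `|tau|)) ^+ 2 <= kap * `|N'| ^+ 2.
    rewrite ler_pM2l// ler_sqr ?nnegrE//; first exact: DfL.
    by rewrite !mulr_ge0// ?invr_ge0 ltW.
  have loss := errB tau tM.
  have lip := phi_lip (Na a + N') (Na a + N' + err tau).
  have E1 : Na a + N' - (Na a + N' + err tau) = - err tau by rewrite opprD addrA subrr add0r.
  rewrite E1 normrN in lip.
  have cmp : C * M2 / s * `|tau| ^+ 2 <= 2 * (kap * (c' * (s^-1 * `|tau|)) ^+ 2).
    have -> : 2 * (kap * (c' * (s^-1 * `|tau|)) ^+ 2) = (2 * kap * c' ^+ 2 / s) / s * `|tau| ^+ 2 by ring.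
    apply: ler_wpM2r; first exact: sqr_ge0.
    rewrite ler_pM2r ?invr_gt0// ler_pdivlMr//.
    have k0 : 0 < 2 * kap * c' ^+ 2 by apply: mulr_gt0; [exact: mulr_gt0|exact: exprn_gt0].
    have : C * M2 / (2 * kap * c' ^+ 2) * s <= 1 by apply: sQ; rewrite lerDr ltW.
    by rewrite mulrAC ler_pdivrMr// mul1r.
  move/ler_normlW: lip => lip.
  exact: mid_bound Hm Hn gain loss lip cmp.
- move=> b b1.
  have [ab|ab] := ltP `|a - b| (R0 * s); last first.
    have E0 : Phi a (f a) = 0 by rewrite /Phi subrr scaler0 addr0 subrr mulr0.
    have := lipP (f b) (f a); rewrite E0 subr0 => /ler_normlW H.
    apply: le_trans H _; apply: (@le_trans _ _ (C * (L * `|b - a|))).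
      by rewrite ler_pM2l//; exact: L1.
    rewrite distrC; have Rs : 0 < R0 * s by exact: mulr_gt0.
    apply: (@le_trans _ _ (C * L / (R0 * s) * `|a - b| ^+ 2)).
      have -> : C * L / (R0 * s) * `|a - b| ^+ 2 = C * (L * `|a - b|) * (`|a - b| / (R0 * s)) by ring.
      by rewrite ler_peMr ?mulr_ge0 ?(ltW C0) ?(ltW L0)// ler_pdivlMr// mul1r.
    by apply: ler_wpM2r; [exact: sqr_ge0|exact: Cb3].
  have [tau [at' t3 tM ->]] := near b b1 ab.
  rewrite /Phi errE.
  set N' := Df a (s^-1 *: tau).
  have t0' : dot a (- (s^-1 *: tau)) = 0 by rewrite dotNr dotZr at' mulr0 oppr0.
  (* By minimality the opposite translate is not below [phi (Na a)], so the second difference bounds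
     the increase by [C * |N'| ^ 2]: the contact is quadratic. *)
  have h1 := phi_sec (Na a) N'.
  have h2 := Nmin _ t0'.
  have EN : Df a (- (s^-1 *: tau)) = - N' by rewrite /N' /Df; exact: (DfN f_smooth a0).
  rewrite EN in h2.
  have := phi_lip (Na a + N' + err tau) (Na a + N').
  have EE : Na a + N' + err tau - (Na a + N') = err tau by rewrite addrC addKr.
  rewrite EE => /ler_normlW h3.
  have h4 := errB tau tM.
  have h5 : C * `|N'| ^+ 2 <= C * (L * (s^-1 * `|tau|)) ^+ 2.
    rewrite ler_pM2l// ler_sqr ?nnegrE//; first exact: DfN'.
    by rewrite !mulr_ge0 ?invr_ge0// ltW.
  have h6 : phi (Na a + N' + err tau) - phi (Na a) <=
      C * (L * (s^-1 * `|tau|)) ^+ 2 + C * M2 / s * `|tau| ^+ 2.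
    exact: up_bound h1 h2 h3 h4 h5.
  apply: (@le_trans _ _ (s * (C * (L * (s^-1 * `|tau|)) ^+ 2 + C * M2 / s * `|tau| ^+ 2))).
    by rewrite ler_pM2l.
  have -> : s * (C * (L * (s^-1 * `|tau|)) ^+ 2 + C * M2 / s * `|tau| ^+ 2) =
    (C * L ^+ 2 / s + C * M2) * `|tau| ^+ 2 by field; rewrite gt_eqF.
  apply: (@le_trans _ _ ((C * L ^+ 2 / s + C * M2) * (3 * `|a - b|) ^+ 2)).
    by apply: ler_wpM2l; [exact: addr_ge0|rewrite ler_sqr ?nnegrE ?mulr_ge0].
  have -> : (C * L ^+ 2 / s + C * M2) * (3 * `|a - b|) ^+ 2 =
    9 * (C * L ^+ 2 / s + C * M2) * `|a - b| ^+ 2 by ring.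
  by apply: ler_wpM2r; [exact: sqr_ge0|exact: Cb2].
move=> M N; rewrite /Phi.
have := phi_sec (Na a + s^-1 *: (M - f a)) (s^-1 *: N).
have -> : Na a + s^-1 *: (M - f a) + s^-1 *: N = Na a + s^-1 *: (M + N - f a).
  by rewrite -[LHS]addrA -scalerDr [in LHS]addrAC.
have -> : Na a + s^-1 *: (M - f a) - s^-1 *: N = Na a + s^-1 *: (M - N - f a).
  by rewrite -[LHS]addrA -scalerBr [in LHS]addrAC.
move: (phi _) (phi _) (phi _) (phi _) => u r q p.
rewrite normrZ gtr0_norm ?invr_gt0// => H.
have -> : s * (p - u) + s * (q - u) - 2 * (s * (r - u)) = s * (p + q - 2 * r) by ring.
apply: (@le_trans _ _ (s * (C * (s^-1 * `|N|) ^+ 2))); first by rewrite ler_pM2l.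
have -> : s * (C * (s^-1 * `|N|) ^+ 2) = C / s * `|N| ^+ 2 by field; rewrite gt_eqF.
by apply: ler_wpM2r; [exact: sqr_ge0|exact: Cb1].
Qed.

End Tents.

(** * Soft minima *)

Section Softmin.
Variables (R : realType) (T : eqType) (e : R).
Hypothesis e0 : 0 < e.
Implicit Types (J : seq T) (u w : T -> R).

Definition softmin J u : R := - (e * ln (\sum_(a <- J) expR (- (u a / e)))).

Lemma softmin_sum_gt0 J u : (0 < size J)%N -> 0 < \sum_(a <- J) expR (- (u a / e)).
Proof.
case: J => // a J _; rewrite big_cons ltr_wpDr ?expR_gt0//.
by apply: sumr_ge0 => b _; exact: expR_ge0.
Qed.

(** Monotonicity and compatibility with constants in one inequality: it transfers Lipschitz bounds
    and ellipticity from a family to its soft minimum. *)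
Lemma softmin_shift J u w (c : R) : (0 < size J)%N ->
  (forall a, a \in J -> u a <= w a + c) -> softmin J u <= softmin J w + c.
Proof.
move=> J0 uw; rewrite /softmin.
have Pu := softmin_sum_gt0 u J0; have Pw := softmin_sum_gt0 w J0.
set U := \sum_(a <- J) _ in Pu *; set W := \sum_(a <- J) _ in Pw *.
have H : expR (- (c / e)) * W <= U.
  rewrite /U /W mulr_sumr !big_seq; apply: ler_sum => a aJ.
  rewrite -expRD ler_expR -opprD lerN2 -mulrDl ler_pM2r ?invr_gt0// addrC.
  exact: uw.
have : ln (expR (- (c / e)) * W) <= ln U by rewrite ler_ln ?posrE ?mulr_gt0 ?expR_gt0.
rewrite lnM ?posrE ?expR_gt0// expRK => {}H.
have := ler_wpM2l (ltW e0) H.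
have -> : e * (- (c / e) + ln W) = - c + e * ln W by field; rewrite gt_eqF.
lra.
Qed.

Lemma expR_midpoint (s t : R) : expR ((s + t) / 2) <= (expR s + expR t) / 2.
Proof.
have -> : expR s = expR (s / 2) ^+ 2 by rewrite expr2 -expRD; congr expR; field.
have -> : expR t = expR (t / 2) ^+ 2 by rewrite expr2 -expRD; congr expR; field.
rewrite mulrDl expRD; have := sqr_ge0 (expR (s / 2) - expR (t / 2)).
rewrite !expr2; lra.
Qed.

(** Midpoint concavity, by which upper bounds on second differences pass to the soft minimum. After
    division by the sums [U] and [W] the exponentials have total 1, and convexity of [expR] applies
    termwise. *)
Lemma softmin_midpoint J u w : (0 < size J)%N ->
  (softmin J u + softmin J w) / 2 <= softmin J (fun a => (u a + w a) / 2).
Proof.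
move=> J0; rewrite /softmin.
have Pu := softmin_sum_gt0 u J0; have Pw := softmin_sum_gt0 w J0.
have Pm := softmin_sum_gt0 (fun a => (u a + w a) / 2) J0.
set U := \sum_(a <- J) _ in Pu *; set W := \sum_(a <- J) _ in Pw *.
set M := \sum_(a <- J) _ in Pm *.
have H : M <= expR ((ln U + ln W) / 2).
  rewrite -[leRHS]mul1r -ler_pdivrMr ?expR_gt0// -expRN mulr_suml.
  apply: (@le_trans _ _ (\sum_(a <- J) (expR (- (u a / e)) / U + expR (- (w a / e)) / W) / 2)).
    apply: ler_sum => a _.
    have -> : expR (- (u a / e)) / U = expR (- (u a / e) - ln U) by rewrite expRD (expRN (ln U)) lnK ?posrE.
    have -> : expR (- (w a / e)) / W = expR (- (w a / e) - ln W) by rewrite expRD (expRN (ln W)) lnK ?posrE.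
    rewrite -expRD.
    apply: le_trans (expR_midpoint _ _).
    by rewrite ler_expR le_eqVlt; apply/orP; left; apply/eqP; field; rewrite gt_eqF.
  rewrite -mulr_suml big_split -!mulr_suml /= -/U -/W !mulfV ?gt_eqF//.
have : ln M <= (ln U + ln W) / 2 by rewrite -[leRHS]expRK ler_ln ?posrE ?expR_gt0.
move=> /(ler_wpM2l (ltW e0)).
have -> : e * ((ln U + ln W) / 2) = (e * ln U + e * ln W) / 2 by field.
lra.
Qed.

Lemma CkO_softmin (V : normedModType R) k (J : seq T) (phi : T -> V -> R) :
  (0 < size J)%N -> (forall a, a \in J -> CkO k setT (phi a)) ->
  CkO k setT (fun x => softmin J (fun a => phi a x)).
Proof.
move=> J0 cphi; have oT : open (setT : set V) by exact: openT.
apply: CkO_opp => //; apply: CkO_scale => //; apply: CkO_ln => //.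
  by move=> x _; exact: softmin_sum_gt0.
have H : CkO k setT (fun x => \sum_(a <- J | a \in J) expR (- (phi a x / e))).
  apply: CkO_sum => // a aJ; apply: CkO_expR => //; apply: CkO_opp => //.
  by apply: CkO_mul => //; [exact: cphi|exact: CkO_cst].
by apply: CkO_ext H => // x _; rewrite -big_seq.
Qed.

End Softmin.

(** A bounded semiconcave sequence cannot start with a steep descent: the decrements [g k - g k.+1]
    fall by at most [c] at each step, and their sum is at most [2 * A]. *)
Lemma discrete_slope (R : realType) (g : nat -> R) (A c : R) (m : nat) : 0 <= c ->
  `|g 0%N| <= A -> `|g m.+1| <= A ->
  (forall k, (k < m)%N -> g k + g k.+2 - 2 * g k.+1 <= c) ->
  m.+1%:R * (g 0%N - g 1%N) <= 2 * A + m.+1%:R * (m%:R * c).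
Proof.
move=> c0 g0A gmA H.
have D k : (k <= m)%N -> g 0%N - g 1%N <= g k - g k.+1 + k%:R * c.
  elim: k => [|k IH] km; first by rewrite mul0r addr0.
  apply: le_trans (IH (ltnW km)) _; have := H k km.
  rewrite -[in k.+1%:R]addn1 natrD mulrDl mul1r; lra.
have : \sum_(0 <= k < m.+1) (g 0%N - g 1%N) <= \sum_(0 <= k < m.+1) (g k - g k.+1 + m%:R * c).
  rewrite !big_nat; apply: ler_sum => k /andP[_ km].
  apply: le_trans (D k _) _; first by rewrite -ltnS.
  by rewrite lerD2l; apply: ler_wpM2r => //; rewrite ler_nat -ltnS.
rewrite sumr_const_nat big_split /= sumr_const_nat subn0 -(mulr_natl (g 0%N - g 1%N)) -(mulr_natl (m%:R * c)).
have -> : \sum_(0 <= k < m.+1) (g k - g k.+1) = g 0%N - g m.+1.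
  rewrite -[RHS]opprB -(telescope_sumr g)// -sumrN.
  by apply: eq_bigr => k _; rewrite opprB.
move=> E; apply: le_trans E _; rewrite lerD2r.
move: g0A gmA; rewrite !ler_norml; lra.
Qed.

(** * Approximate operators, small and flat along the range *)

Section Approximate.
Variables (R : realType) (d : nat).
Implicit Types (x y z v w a b tau : 'rV[R]_d) (M N P : 'M[R]_d).

Local Notation nz := [set x : 'rV[R]_d | x != 0].

Variable f : 'rV[R]_d -> 'M[R]_d.
Hypothesis f_smooth : forall k i j, CkO k nz (fun x => f x i j).
Hypothesis f_homog : forall (t : R) x, 0 < t -> x != 0 -> f (t *: x) = f x.
Hypothesis secant : forall a b, dot a a = 1 -> dot b b = 1 -> a != b ->
  exists v, 0 < qf (f a - f b) v.
Hypothesis tangent : forall a tau, dot a a = 1 -> dot tau tau = 1 -> dot a tau = 0 ->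
  exists v, 0 < qf (Df f a tau) v.
Hypothesis sphere_nonempty : exists a : 'rV[R]_d, dot a a = 1.

Lemma normalize_sphere x : x != 0 -> exists2 a, dot a a = 1 & f x = f a.
Proof.
move=> x0; have p : 0 < dot x x by rewrite lt_neqAle dot_ge0 eq_sym dot_eq0 x0.
have s0 : 0 < Num.sqrt (dot x x) by rewrite sqrtr_gt0.
exists ((Num.sqrt (dot x x))^-1 *: x); last by rewrite f_homog// invr_gt0.
have s2 := sqr_sqrtr (ltW p); rewrite dotZl dotZr -[X in _ * (_ * X)]s2.
by field; rewrite gt_eqF.
Qed.

(** The bounds are on the squared Euclidean norm. *)
Definition annulus (p q : R) : set 'rV[R]_d := [set x | p <= dot x x <= q].

Lemma annulus_compact p q : compact (annulus p q).
Proof.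
have cd : continuous (fun x : 'rV[R]_d => dot x x).
  by move=> x; exact: (@continuous_dot _ _ _ (nbhs x) _ id id x x cvg_id cvg_id).
apply: bounded_closed_compact.
  exists (1 + `|q|); split; first exact: num_real.
  move=> B B1 x /= /andP[_ xq]; apply: le_trans (ltW B1).
  have x2 : `|x| ^+ 2 <= `|q|.
    by apply: le_trans (sqr_norm_le_dot x) _; apply: le_trans xq (ler_norm _).
  have := sqr_ge0 (`|x| - 1); have := normr_ge0 q; rewrite sqrrB expr1n mulr1; lra.
have -> : annulus p q = [set x : 'rV[R]_d | p <= dot x x] `&` [set x | dot x x <= q].
  by apply/seteqP; split => x /=; [move=> /andP[]|move=> [a b]; apply/andP].
apply: closedI.
  have -> : [set x : 'rV[R]_d | p <= dot x x] = (fun x => dot x x) @^-1` [set t | p <= t] by [].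
  by apply: closed_comp; [move=> x _; exact: cd|exact: closed_ge].
have -> : [set x : 'rV[R]_d | dot x x <= q] = (fun x => dot x x) @^-1` [set t | t <= q] by [].
by apply: closed_comp; [move=> x _; exact: cd|exact: closed_le].
Qed.

Lemma annulus_near x h (r : R) : annulus (1 / 2) 2 x -> `|h| <= r -> r <= 1 ->
  24 * d%:R * r <= 1 -> annulus (1 / 4) 4 (x + h).
Proof.
move=> /andP[x1 x2] hr r1 dr.
have D0 : 0 <= d%:R :> R by rewrite ler0n.
have r0 : 0 <= r by apply: le_trans hr.
have xn : `|x| <= 2.
  have := sqr_norm_le_dot x; have := sqr_ge0 (`|x| - 1); rewrite sqrrB expr1n mulr1; lra.
have E : dot (x + h) (x + h) - dot x x = 2 * dot x h + dot h h.
  by rewrite dotDl !dotDr (dotC h x); ring.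
have H1 := dot_norm_le x h; have H2 := dot_norm_le h h.
have H3 : d%:R * `|x| * `|h| <= d%:R * 2 * r.
  by apply: ler_pM => //; rewrite ler_wpM2l.
have H4 : d%:R * `|h| * `|h| <= d%:R * r.
  rewrite -mulrA; apply: ler_wpM2l => //; apply: le_trans (hr).
  by rewrite ler_piMl// (le_trans hr r1).
have := le_trans H1 H3; have := le_trans H2 H4; rewrite !ler_norml => h1 h2.
by apply/andP; split; lra.
Qed.

(* [G o f] is at most of size [rho ^ 2] and semiconcave, uniformly in [rho]; hence its
   slope is of order [rho]. *)
Lemma exists_approximate : exists C r : R, [/\ 0 < C, 0 < r &
  forall rho : R, 0 < rho -> rho <= r -> exists G : 'M[R]_d -> R,
  [/\ forall k, CkO k setT G,
    forall N P, nonneg_def P -> `|P| <= G (N + P) - G N,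
    forall M N, `|G M - G N| <= C * `|M - N|,
    forall x, x != 0 -> `|G (f x)| <= C * rho ^+ 2
    & forall x y, annulus (1 / 2) 2 x -> annulus (1 / 2) 2 y -> `|x - y| <= rho ->
      `|G (f x) - G (f y)| <= C * rho * `|x - y|]].
Proof.
have prod_bound (c s t : R) : 0 < c -> 0 < s -> s < t -> (2 + 2 * c) * s <= (2 + 3 * c) * t.
  by move=> c0 s0 st; apply: ler_pM; lra.
have [Phi [C [C0 PhiP]]] := exists_tents f_smooth f_homog secant tangent.
have nzK : annulus (1 / 4) 4 `<=` nz.
  move=> x /= /andP[x1 _]; rewrite -dot_eq0 gt_eqF//.
  by apply: lt_le_trans x1; rewrite divr_gt0.
have [m Hm] := @taylor_compact R d ('I_d * 'I_d)%type (fun ij x => f x ij.1 ij.2) nz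
  _ (@open_nz R d) (@annulus_compact (1 / 4) 4) nzK (fun ij => f_smooth 2 ij.1 ij.2).
pose Mm : R := m.+1%:R.
have Mm0 : 0 < Mm by rewrite ltr0n.
have D0 : 0 <= d%:R :> R by rewrite ler0n.
pose Q : R := 2 * (1 + 24 * d%:R + Mm).
have Q0 : 0 < Q by rewrite /Q; lra.
pose C3 := 4 * C * Mm ^+ 2 + 2 * C * Mm.
have C30 : 0 <= C3 by rewrite addr_ge0// !mulr_ge0 ?sqr_ge0// ltW.
exists (2 + 3 * C + C3), Q^-1; split; [lra|by rewrite invr_gt0|].
move=> rho rho0 rhor.
have rQ (t : R) : 2 * t <= Q -> t * (2 * rho) <= 1.
  move=> tQ; have := ler_wpM2r (ltW rho0) tQ.
  have : Q * rho <= 1 by rewrite -ler_pdivlMl// mulr1.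
  lra.
have [J [JS Jn]] := finite_net (@sphere_compact R d) rho0.
have J0 : (0 < size J)%N.
  have [a0 a01] := sphere_nonempty; have [y yJ _] := Jn a0 a01.
  by case: (J) yJ.
pose lJ := ln ((size J)%:R : R).
have lJ0 : 0 <= lJ by apply: ln_ge0; rewrite ler1n.
(* A soft minimum of nonnegative functions is at least [- e * ln (size J)]; with this [e] the loss
   is at most [rho ^+ 2]. *)
pose e := rho ^+ 2 / (1 + lJ).
have rho20 : 0 < rho ^+ 2 by rewrite exprn_gt0.
have e0 : 0 < e by rewrite divr_gt0// ltr_wpDr.
have eJ : e * lJ <= rho ^+ 2.
  rewrite /e mulrAC ler_pdivrMr ?ltr_wpDr//; apply: ler_wpM2l; [exact: ltW|lra].
pose G M := softmin e J (fun a => Phi a M).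
have PhiJ a : a \in J -> _ := fun aJ => PhiP a (JS a aJ).
have Glip M N : `|G M - G N| <= C * `|M - N|.
  have H X Y : G X <= G Y + C * `|X - Y|.
    apply: softmin_shift => // a aJ; have [_ _ lip _] := PhiJ a aJ.
    by have := lip X Y => /ler_normlW; rewrite lerBlDl.
  have h1 := H M N; have h2 := H N M; rewrite distrC in h2.
  by rewrite ler_norml; apply/andP; split; lra.
have Gsmall x : x != 0 -> `|G (f x)| <= (1 + C) * rho ^+ 2.
  move=> /normalize_sphere[b b1 ->].
  have P0 := softmin_sum_gt0 e (fun a => Phi a (f b)) J0.
  have low : - rho ^+ 2 <= G (f b).
    rewrite /G /softmin lerN2; apply: le_trans eJ; rewrite ler_pM2l//.
    rewrite ler_ln ?posrE ?ltr0n//.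
    have -> : ((size J)%:R : R) = \sum_(a <- J) 1.
      by rewrite big_const_seq count_predT iter_addr_0.
    rewrite !big_seq; apply: ler_sum => a aJ.
    have [_ _ _ [pos _ _]] := PhiJ a aJ.
    by rewrite -expR0 ler_expR oppr_le0 divr_ge0 ?pos// ltW.
  have up : G (f b) <= C * rho ^+ 2.
    have [a aJ ab] := Jn b b1; have [_ _ _ [_ sq _]] := PhiJ a aJ.
    have h1 : Phi a (f b) <= C * rho ^+ 2.
      apply: le_trans (sq b b1) _; rewrite ler_pM2l// ler_sqr ?nnegrE ?(ltW rho0)//.
      by rewrite distrC ltW.
    apply: le_trans h1; rewrite /G /softmin -mulrN -ler_pdivlMl// mulrC lerNl.
    rewrite -[leLHS]expRK ler_ln ?posrE ?expR_gt0//.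
    rewrite (big_rem a aJ) /= lerDl; apply: sumr_ge0 => c _; exact: expR_ge0.
  have Cr : 0 <= C * rho ^+ 2 by apply: mulr_ge0; exact: ltW.
  by rewrite ler_norml; apply/andP; split; lra.
have Gsec M N : G (M + N) + G (M - N) - 2 * G M <= C * `|N| ^+ 2.
  have h1 := softmin_midpoint e0 (fun a => Phi a (M + N)) (fun a => Phi a (M - N)) J0.
  have h2 : softmin e J (fun a => (Phi a (M + N) + Phi a (M - N)) / 2) <=
      G M + C * `|N| ^+ 2 / 2.
    apply: softmin_shift => // a aJ; have [_ _ _ [_ _ sec]] := PhiJ a aJ.
    have := sec M N; lra.
  have h3 : (G (M + N) + G (M - N)) / 2 <= G M + C * `|N| ^+ 2 / 2 := le_trans h1 h2.
  lra.
have idM (A B E D : 'M[R]_d) : A - (B - E) = (E - D) + (A - B + D).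
  by apply/matrixP => i j; rewrite !mxE; ring.
(* [f (p - h)] differs from [f p - N] by two Taylor remainders, so the semiconcavity of [G] at [f p]
   becomes that of [G] composed with [f]. *)
have fsec p h : annulus (1 / 4) 4 p -> `|h| <= Mm^-1 ->
    G (f (p + h)) + G (f (p - h)) - 2 * G (f p) <= C3 * `|h| ^+ 2.
  move=> Kp hM; have p0 := nzK p Kp.
  have TB i j : taylor_bound nz (fun x => f x i j) m p := Hm (i, j) p Kp.
  have r1 := remainder_bound TB hM.
  have hM' : `|- h| <= Mm^-1 by rewrite normrN.
  have r2 := remainder_bound TB hM'; rewrite normrN (DfN f_smooth p0) in r2.
  have Dn : `|Df f p h| <= Mm * `|h|.
    apply: ler_norm_entry => [|i j]; first by rewrite mulr_ge0// ltW.
    by have [_ _] := TB i j h hM; rewrite mxE.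
  set N := f (p + h) - f p.
  have Nn : `|N| <= 2 * Mm * `|h|.
    have -> : N = (N - Df f p h) + Df f p h by rewrite subrK.
    apply: le_trans (ler_normD _ _) _.
    have : Mm * `|h| ^+ 2 <= Mm * `|h|.
      rewrite ler_pM2l// expr2 ler_piMl//; apply: le_trans hM _.
      by rewrite invf_le1// ler1n.
    move: r1; rewrite -/Mm -/N; lra.
  have := Gsec (f p) N; have -> : f p + N = f (p + h) by rewrite addrC subrK.
  have := Glip (f (p - h)) (f p - N).
  have -> : f (p - h) - (f p - N) = (N - Df f p h) + (f (p - h) - f p + Df f p h).
    by apply: idM.
  move=> /ler_normlW g1 g2.
  rewrite opprK in r2.
  have g3 : `|(N - Df f p h) + (f (p - h) - f p + Df f p h)| <= 2 * (Mm * `|h| ^+ 2).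
    by apply: le_trans (ler_normD _ _) _; move: r1 r2; rewrite -/Mm -/N; lra.
  have g4 : C * `|(N - Df f p h) + (f (p - h) - f p + Df f p h)| <= C * (2 * (Mm * `|h| ^+ 2)).
    by rewrite ler_pM2l.
  have g5 : C * `|N| ^+ 2 <= C * (2 * Mm * `|h|) ^+ 2.
    by rewrite ler_pM2l// ler_sqr ?nnegrE ?mulr_ge0// ltW.
  have -> : C3 * `|h| ^+ 2 = C * (2 * Mm * `|h|) ^+ 2 + C * (2 * (Mm * `|h| ^+ 2)).
    by rewrite /C3; ring.
  move: g1 g2 g4 g5; clear; lra.
have slope x y : annulus (1 / 2) 2 x -> annulus (1 / 2) 2 y -> `|x - y| <= rho ->
    G (f y) - G (f x) <= (2 + 3 * C + C3) * rho * `|x - y|.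
  move=> Kx Ky xy.
  have [->|xny] := eqVneq x y; first by rewrite !subrr normr0 mulr0.
  pose h := y - x; have hn : `|h| = `|x - y| by rewrite distrC.
  have h0 : 0 < `|h| by rewrite hn normr_gt0 subr_eq0.
  (* The progression [y - k *: h] begins with [y] and [x]. About [rho / |h|] steps give it length
     about [rho], the scale at which size [rho ^ 2] and bounded second differences both yield slope
     [rho]. *)
  pose n := (Num.truncn (rho / `|h|))%N.
  have rh0 : 0 <= rho / `|h| by rewrite divr_ge0// ltW.
  have nle : n%:R * `|h| <= rho by rewrite -ler_pdivlMr//; rewrite truncn_le.
  have nlt : rho < n.+1%:R * `|h| by rewrite -ltr_pdivrMr//; exact: truncnS_gt.
  pose g k := G (f (y - k%:R *: h)).
  have inK k : (k <= n.+1)%N -> annulus (1 / 4) 4 (y - k%:R *: h).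
    move=> kn; apply: (@annulus_near y _ (2 * rho)) => //.
    - rewrite normrN normrZ ger0_norm//.
      apply: (@le_trans _ _ (n.+1%:R * `|h|)); first by rewrite ler_pM2r// ler_nat.
      rewrite -[in n.+1%:R]addn1 natrD mulrDl mul1r; move: nle xy; rewrite -hn; lra.
    - by have := rQ 1; rewrite mul1r; apply; rewrite /Q; lra.
    - apply: rQ; rewrite /Q; lra.
  have sec k : (k < n)%N -> g k + g k.+2 - 2 * g k.+1 <= C3 * `|h| ^+ 2.
    move=> kn.
    have hM : `|h| <= Mm^-1.
      apply: le_trans (_ : rho <= _); first by rewrite hn.
      rewrite -[leRHS]mul1r ler_pdivlMr//; have := rQ Mm _; rewrite /Q => H.
      have : Mm * (2 * rho) <= 1 by apply: H; lra.
      have : 0 <= Mm * rho by rewrite mulr_ge0// ltW.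
      lra.
    have := fsec (y - k.+1%:R *: h) h (inK _ _) hM.
    have -> : y - k.+1%:R *: h + h = y - k%:R *: h.
      by apply/rowP => i; rewrite !mxE -natr1; ring.
    have -> : y - k.+1%:R *: h - h = y - k.+2%:R *: h.
      by apply/rowP => i; rewrite !mxE -[k.+2%:R]natr1; ring.
    by apply; rewrite ltnS ltnW.
  have g0E : g 0%N = G (f y) by rewrite /g scale0r subr0.
  have g1E : g 1%N = G (f x) by rewrite /g scale1r /h opprB addrC subrK.
  have c0 : 0 <= C3 * `|h| ^+ 2 by rewrite mulr_ge0// exprn_ge0.
  have := discrete_slope c0 _ _ sec.
  have B k : (k <= n.+1)%N -> `|g k| <= (1 + C) * rho ^+ 2.
    by move=> kn; apply: Gsmall; apply: nzK; exact: inK.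
  move=> /(_ _ (B 0%N isT) (B n.+1 (leqnn _))).
  rewrite g0E g1E => H.
  have n0 : 0 < n.+1%:R :> R by rewrite ltr0n.
  rewrite -hn -(ler_pM2l n0).
  apply: le_trans H _.
  have -> : n.+1%:R * ((2 + 3 * C + C3) * rho * `|h|) =
     (2 + 3 * C) * rho * (n.+1%:R * `|h|) + n.+1%:R * (C3 * `|h| * rho) by ring.
  have k1 : 2 * ((1 + C) * rho ^+ 2) <= (2 + 3 * C) * rho * (n.+1%:R * `|h|).
    have k3 : (2 + 2 * C) * rho <= (2 + 3 * C) * (n.+1%:R * `|h|).
      exact: prod_bound.
    have -> : (2 + 3 * C) * rho * (n.+1%:R * `|h|) = rho * ((2 + 3 * C) * (n.+1%:R * `|h|)) by ring.
    have -> : 2 * ((1 + C) * rho ^+ 2) = rho * ((2 + 2 * C) * rho) by ring.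
    by rewrite ler_pM2l.
  have k2 : n.+1%:R * (n%:R * (C3 * `|h| ^+ 2)) <= n.+1%:R * (C3 * `|h| * rho).
    rewrite ler_pM2l//.
    have -> : n%:R * (C3 * `|h| ^+ 2) = C3 * `|h| * (n%:R * `|h|) by ring.
    by apply: ler_wpM2l => //; rewrite mulr_ge0.
  exact: lerD.
exists G; split.
- by move=> k; apply: CkO_softmin => // a aJ; have [] := PhiJ a aJ.
- move=> N P nP.
  have : G N <= G (N + P) + (- `|P|).
    apply: softmin_shift => // a aJ; have [_ ell _ _] := PhiJ a aJ.
    have := ell N P nP; lra.
  lra.
- move=> M N; apply: le_trans (Glip M N) _; apply: ler_wpM2r => //; lra.
- move=> x x0; apply: le_trans (Gsmall x x0) _; apply: ler_wpM2r; first exact: ltW.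
  lra.
move=> x y Kx Ky xy; rewrite ler_norml; apply/andP; split; last first.
  by rewrite distrC; apply: slope => //; rewrite distrC.
by rewrite lerNl opprB; exact: slope.
Qed.

End Approximate.

(** * Retraction onto the range of a homogeneous map *)

Lemma is_derive_sumr (R : realType) (V : normedModType R) (I : Type) (r : seq I)
    (h : I -> V -> R) (dh : I -> R) (x v : V) :
  (forall i, is_derive x v (h i) (dh i)) ->
  is_derive x v (fun y => \sum_(i <- r) h i y) (\sum_(i <- r) dh i).
Proof.
move=> H; elim: r => [|i r IH].
  rewrite big_nil; have -> : (fun y => \sum_(i <- [::]) h i y) = (fun=> 0).
    by apply/funext => y; rewrite big_nil.
  exact: is_derive_cst.
rewrite big_cons; have -> : (fun y => \sum_(j <- i :: r) h j y) =
  (fun y => h i y + \sum_(j <- r) h j y) by apply/funext => y; rewrite big_cons.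
exact: is_deriveD.
Qed.

Lemma is_derive_linear (R : realType) (V : normedModType R) (g : V -> R) x v :
  (forall (a : R) y z, g (a *: y + z) = a * g y + g z) -> is_derive x v g (g v).
Proof.
move=> gl.
have H : (fun h : R => h^-1 *: ((g \o shift x) (h *: v) - g x)) @ 0^' --> g v.
  apply: cvg_near_cst; near=> h.
  rewrite /= gl addrK /GRing.scale /= mulKf//.
  by near: h; exact: nbhs_dnbhs_neq.
by split; [apply/cvg_ex; exists (g v)|exact/cvg_lim].
Unshelve. all: by end_near. Qed.

Lemma is_derive_sqr (R : realType) (V : normedModType R) (g : V -> R) (dg : R) x v :
  is_derive x v g dg -> is_derive x v (fun y => g y ^+ 2) (2 * g x * dg).
Proof.
move=> dgP; have H := is_deriveM dgP dgP.
have -> : (fun y => g y ^+ 2) = g * g by apply/funext => y; rewrite expr2.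
by apply: is_derive_eq H _; rewrite /GRing.scale /=; ring.
Qed.

Section MatrixSmooth.
Variables (R : realType) (V : normedModType R) (A : set V).
Hypothesis oA : open A.

Lemma CkO_det k n (N : V -> 'M[R]_n) : (forall i j, CkO k A (fun x => N x i j)) ->
  CkO k A (fun x => \det (N x)).
Proof.
move=> cN; apply: CkO_sum => // s _; apply: CkO_scale => //.
by apply: CkO_prod => // i _; exact: cN.
Qed.

Lemma CkO_invmx k n (N : V -> 'M[R]_n) : (forall i j, CkO k A (fun x => N x i j)) ->
  (forall x, A x -> N x \in unitmx) -> forall i j, CkO k A (fun x => invmx (N x) i j).
Proof.
move=> cN uN i j.
have H : CkO k A (fun x => (\det (N x))^-1 * ((-1) ^+ (j + i) * \det (row' j (col' i (N x))))).
  apply: CkO_mul => //.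
    apply: CkO_inv => // [x Ax|]; last exact: CkO_det.
    by have := uN x Ax; rewrite unitmxE unitfE.
  apply: CkO_scale => //; apply: CkO_det => k' l'.
  by apply: CkO_ext (cN (lift j k') (lift i l')) => // x _; rewrite !mxE.
apply: CkO_ext H => // x Ax; rewrite /invmx uN// !mxE //.
Qed.

End MatrixSmooth.

Section Retraction.
Variables (R : realType) (d : nat).
Implicit Types (x y z v w a b tau : 'rV[R]_d) (M N P : 'M[R]_d).

Local Notation nz := [set x : 'rV[R]_d | x != 0].
Local Notation e_ k := (delta_mx 0 k : 'rV[R]_d).

Variable f : 'rV[R]_d -> 'M[R]_d.
Hypothesis f_smooth : forall k i j, CkO k nz (fun x => f x i j).
Hypothesis f_homog : forall (t : R) x, 0 < t -> x != 0 -> f (t *: x) = f x.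
Hypothesis secant : forall a b, dot a a = 1 -> dot b b = 1 -> a != b ->
  exists v, 0 < qf (f a - f b) v.
Hypothesis tangent : forall a tau, dot a a = 1 -> dot tau tau = 1 -> dot a tau = 0 ->
  exists v, 0 < qf (Df f a tau) v.
Hypothesis sphere_nonempty : exists a : 'rV[R]_d, dot a a = 1.

(* A minimizer in [x] is a retraction of a neighbourhood of the range of [f]; the last term selects
   the unit vector on each ray, along which [f] is constant. *)
Definition energy x M : R :=
  \sum_k \sum_l (M k l - f x k l) ^+ 2 + (dot x x - 1) ^+ 2.

(** Half the gradient of the energy in [x]; [hess] consists of the derivatives of [grad], hence is
    half the Hessian. *)
Definition grad i x M : R :=
  - (\sum_k \sum_l (M k l - f x k l) * 'D_(e_ i) (fun y => f y k l) x)
  + 2 * (dot x x - 1) * x 0 i.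

Definition hess i j x M : R :=
  \sum_k \sum_l ('D_(e_ j) (fun y => f y k l) x * 'D_(e_ i) (fun y => f y k l) x
     - (M k l - f x k l) * 'D_(e_ j) ('D_(e_ i) (fun y => f y k l)) x)
  + 4 * x 0 i * x 0 j + 2 * (dot x x - 1) * (i == j)%:R.

Let fd x v k l : x != 0 -> is_derive x v (fun y => f y k l) ('D_v (fun y => f y k l) x).
Proof. by move=> x0; apply: derivableP; exact: CkO_derivable (f_smooth 1 k l) x0. Qed.

Let coordd (x v : 'rV[R]_d) i : is_derive x v (fun y : 'rV[R]_d => y 0 i) (v 0 i).
Proof. by apply: is_derive_linear => a y z; rewrite !mxE. Qed.

Let dotd (x v : 'rV[R]_d) : is_derive x v (fun y => dot y y) (2 * dot x v).
Proof.
have H := is_derive_sumr (index_enum 'I_d) (fun i => is_deriveM (coordd x v i) (coordd x v i)).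
apply: is_derive_eq H _; rewrite /dot mulr_sumr; apply: eq_bigr => i _.
by rewrite /GRing.scale /=; ring.
Qed.

Let constB (c : R) (g : 'rV[R]_d -> R) x v dg : is_derive x v g dg ->
  is_derive x v (fun y => c - g y) (- dg).
Proof.
move=> H; have H2 := is_deriveB (is_derive_cst c x v) H.
by apply: is_derive_eq H2 _; rewrite sub0r.
Qed.

Let subC (c : R) (g : 'rV[R]_d -> R) x v dg : is_derive x v g dg ->
  is_derive x v (fun y => g y - c) dg.
Proof.
move=> H; have H2 := is_deriveB H (is_derive_cst c x v).
by apply: is_derive_eq H2 _; rewrite subr0.
Qed.

Lemma is_derive_energy x v M : x != 0 ->
  is_derive x v (energy^~ M) (2 * \sum_i v 0 i * grad i x M).
Proof.
move=> x0.
have H1 k l := is_derive_sqr (constB (M k l) (fd v k l x0)).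
have H2 k := is_derive_sumr (index_enum 'I_d) (H1 k).
have H3 := is_derive_sumr (index_enum 'I_d) H2.
have H4 := is_derive_sqr (subC 1 (dotd x v)).
have H5 := is_deriveD H3 H4.
apply: is_derive_eq H5 _.
have -> : \sum_i v 0 i * grad i x M =
    - (\sum_k \sum_l (M k l - f x k l) * 'D_v (fun y => f y k l) x)
    + 2 * (dot x x - 1) * dot x v.
  rewrite /grad.
  have -> : dot x v = \sum_i v 0 i * x 0 i by apply: eq_bigr => i _; rewrite mulrC.
  rewrite mulr_sumr -sumrN.
  have -> : \sum_k - \sum_l (M k l - f x k l) * 'D_v (fun y => f y k l) x =
     \sum_i v 0 i * - (\sum_k \sum_l (M k l - f x k l) * 'D_(e_ i) (fun y => f y k l) x).
    under [RHS]eq_bigr do rewrite -sumrN mulr_sumr.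
    rewrite [RHS]exchange_big; apply: eq_bigr => k _ /=.
    under [RHS]eq_bigr do rewrite -sumrN mulr_sumr.
    rewrite [RHS]exchange_big -sumrN; apply: eq_bigr => l _ /=.
    rewrite (derive_rowE v (@open_nz R d) x0 (f_smooth 1 k l)) mulr_sumr -sumrN.
    by apply: eq_bigr => i _; ring.
  rewrite -big_split; apply: eq_bigr => i _ /=; ring.
rewrite [RHS]mulrDr; congr (_ + _); last by ring.
rewrite mulrN mulr_sumr -sumrN; apply: eq_bigr => k _.
rewrite mulr_sumr -sumrN; apply: eq_bigr => l _; ring.
Qed.

Lemma is_derive_grad i x v M : x != 0 ->
  is_derive x v (fun y => grad i y M) (\sum_j v 0 j * hess i j x M).
Proof.
move=> x0.
have dd k l : is_derive x v ('D_(e_ i) (fun y => f y k l)) ('D_v ('D_(e_ i) (fun y => f y k l)) x).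
  by apply: derivableP; exact: CkO_derivable (CkO_derive (e_ i) (f_smooth 2 k l)) x0.
have H1 k l := is_deriveM (constB (M k l) (fd v k l x0)) (dd k l).
have H2 k := is_derive_sumr (index_enum 'I_d) (H1 k).
have H3 := is_deriveN (is_derive_sumr (index_enum 'I_d) H2).
have H4 : is_derive x v (fun y => 2 * (dot y y - 1) * y 0 i)
    (2 * (dot x x - 1) * v 0 i + x 0 i * (2 * (2 * dot x v))).
  exact: is_deriveM (is_deriveZ 2 (subC 1 (dotd x v))) (coordd x v i).
have H5 := is_deriveD H3 H4.
apply: is_derive_eq H5 _.
rewrite /hess.
have -> : \sum_j v 0 j * (\sum_k \sum_l ('D_(e_ j) (fun y => f y k l) x * 'D_(e_ i) (fun y => f y k l) x
     - (M k l - f x k l) * 'D_(e_ j) ('D_(e_ i) (fun y => f y k l)) x)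
     + 4 * x 0 i * x 0 j + 2 * (dot x x - 1) * (i == j)%:R) =
   \sum_k \sum_l ('D_v (fun y => f y k l) x * 'D_(e_ i) (fun y => f y k l) x
     - (M k l - f x k l) * 'D_v ('D_(e_ i) (fun y => f y k l)) x) +
   (4 * x 0 i * dot x v + 2 * (dot x x - 1) * v 0 i).
  have EC : \sum_j v 0 j * (2 * (dot x x - 1) * (i == j)%:R) = 2 * (dot x x - 1) * v 0 i.
    rewrite (bigD1 i)//= eqxx mulr1 big1 ?addr0 1?mulrC// => j ji.
    by rewrite eq_sym (negbTE ji) !mulr0.
  have EB : \sum_j v 0 j * (4 * x 0 i * x 0 j) = 4 * x 0 i * dot x v.
    by rewrite /dot mulr_sumr; apply: eq_bigr => j _; rewrite mulrCA [v 0 j * _]mulrC.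
  have EA : \sum_j v 0 j * \sum_k \sum_l ('D_(e_ j) (fun y => f y k l) x * 'D_(e_ i) (fun y => f y k l) x
     - (M k l - f x k l) * 'D_(e_ j) ('D_(e_ i) (fun y => f y k l)) x) =
     \sum_k \sum_l ('D_v (fun y => f y k l) x * 'D_(e_ i) (fun y => f y k l) x
     - (M k l - f x k l) * 'D_v ('D_(e_ i) (fun y => f y k l)) x).
    transitivity (\sum_j \sum_k v 0 j * \sum_l ('D_(e_ j) (fun y => f y k l) x * 'D_(e_ i) (fun y => f y k l) x
     - (M k l - f x k l) * 'D_(e_ j) ('D_(e_ i) (fun y => f y k l)) x)).
      by apply: eq_bigr => j _; rewrite mulr_sumr.
    rewrite exchange_big; apply: eq_bigr => k _ /=.
    transitivity (\sum_j \sum_l v 0 j * ('D_(e_ j) (fun y => f y k l) x * 'D_(e_ i) (fun y => f y k l) x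
     - (M k l - f x k l) * 'D_(e_ j) ('D_(e_ i) (fun y => f y k l)) x)).
      by apply: eq_bigr => j _; rewrite mulr_sumr.
    rewrite exchange_big; apply: eq_bigr => l _ /=.
    rewrite (derive_rowE v (@open_nz R d) x0 (f_smooth 1 k l)).
    rewrite (derive_rowE v (@open_nz R d) x0 (CkO_derive (e_ i) (f_smooth 2 k l))).
    rewrite mulr_suml mulr_sumr -sumrB; apply: eq_bigr => j _.
    by rewrite mulrBr mulrA [v 0 j * ((M k l - f x k l) * _)]mulrCA.
  under eq_bigr do rewrite mulrDr mulrDr.
  by rewrite !big_split /= EA EB EC addrA.
rewrite /GRing.scale /=; congr (_ + _); last by ring.
rewrite -sumrN; apply: eq_bigr => k _; rewrite -sumrN; apply: eq_bigr => l _; ring.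
Qed.

Definition hessmx x M : 'M[R]_d := \matrix_(i, j) hess i j x M.

Let exchange4 (X : 'I_d -> 'I_d -> 'I_d -> 'I_d -> R) :
  \sum_i \sum_j \sum_k \sum_l X i j k l = \sum_k \sum_l \sum_i \sum_j X i j k l.
Proof.
transitivity (\sum_i \sum_k \sum_j \sum_l X i j k l).
  by apply: eq_bigr => i _; rewrite exchange_big.
rewrite exchange_big; apply: eq_bigr => k _.
transitivity (\sum_i \sum_l \sum_j X i j k l).
  by apply: eq_bigr => i _; rewrite exchange_big.
by rewrite exchange_big.
Qed.

(** At a point of the range the residuals [M - f x] and [dot x x - 1] vanish, and with them the
    terms in second derivatives of [f]; squares are left. *)
Lemma qf_hessmx a u : dot a a = 1 ->
  qf (hessmx a (f a)) u =
  \sum_k \sum_l ('D_u (fun y => f y k l) a) ^+ 2 + 4 * dot a u ^+ 2.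
Proof.
move=> a1; have a0 := sphere_neq0 a1.
have -> : dot a u ^+ 2 = \sum_i \sum_j a 0 i * a 0 j * (u 0 i * u 0 j).
  rewrite expr2 {1}/dot mulr_suml; apply: eq_bigr => i _.
  by rewrite /dot mulr_sumr; apply: eq_bigr => j _; ring.
have -> : \sum_k \sum_l ('D_u (fun y => f y k l) a) ^+ 2 =
    \sum_k \sum_l \sum_i \sum_j 'D_(e_ j) (fun y => f y k l) a * 'D_(e_ i) (fun y => f y k l) a
      * (u 0 i * u 0 j).
  apply: eq_bigr => k _; apply: eq_bigr => l _.
  rewrite (derive_rowE u (@open_nz R d) a0 (f_smooth 1 k l)) expr2 mulr_suml.
  by apply: eq_bigr => i _; rewrite mulr_sumr; apply: eq_bigr => j _; ring.
rewrite -exchange4 mulr_sumr -big_split; apply: eq_bigr => i _ /=.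
rewrite mulr_sumr -big_split; apply: eq_bigr => j _ /=.
rewrite mxE /hess a1 subrr mulr0 mul0r addr0 mulrDl; congr (_ + _); last by ring.
rewrite mulr_suml; apply: eq_bigr => k _; rewrite mulr_suml; apply: eq_bigr => l _.
by rewrite subrr mul0r subr0.
Qed.

(** The double sum vanishes only if [Df f a u = 0], which hyperbolicity excludes for nonzero [u]
    orthogonal to [a]; the other directions are covered by the term in [dot a u]. *)
Lemma hessmx_pos a u : dot a a = 1 -> u != 0 -> 0 < qf (hessmx a (f a)) u.
Proof.
move=> a1 u0; have a0 := sphere_neq0 a1; rewrite qf_hessmx//.
set S := \sum_k _.
have S0 : 0 <= S by apply: sumr_ge0 => k _; apply: sumr_ge0 => l _; exact: sqr_ge0.
have Q0 : 0 <= 4 * dot a u ^+ 2 by rewrite mulr_ge0// sqr_ge0.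
rewrite lt_neqAle addr_ge0// andbT eq_sym; apply/negP => /eqP E.
have au : dot a u = 0.
  have : 4 * dot a u ^+ 2 = 0 by apply/eqP; rewrite eq_le Q0 andbT; lra.
  by move/eqP; rewrite mulf_eq0 pnatr_eq0 /= sqrf_eq0 => /eqP.
have SE : S = 0 by apply/eqP; rewrite eq_le S0 andbT; lra.
have D0 : Df f a u = 0.
  apply/matrixP => k l; rewrite !mxE.
  have : \sum_l ('D_u (fun y => f y k l) a) ^+ 2 = 0.
    move/eqP: SE; rewrite psumr_eq0; last first.
      by move=> i _; apply: sumr_ge0 => j _; exact: sqr_ge0.
    by move=> /allP /(_ k); rewrite mem_index_enum => /(_ isT) /eqP.
  move/eqP; rewrite psumr_eq0; last by move=> i _; exact: sqr_ge0.
  by move=> /allP /(_ l); rewrite mem_index_enum => /(_ isT); rewrite sqrf_eq0 => /eqP.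
have p : 0 < dot u u by rewrite lt_neqAle dot_ge0 eq_sym dot_eq0 u0.
have s0 : 0 < Num.sqrt (dot u u) by rewrite sqrtr_gt0.
have s2 := sqr_sqrtr (ltW p).
have [||v] := tangent (tau := (Num.sqrt (dot u u))^-1 *: u) a1.
- rewrite dotZl dotZr -[X in _ * (_ * X)]s2; field; by rewrite gt_eqF.
- by rewrite dotZr au mulr0.
rewrite (DfZ f_smooth a0) D0 scaler0.
have -> : qf (0 : 'M[R]_d) v = 0 by rewrite -(scale0r (0 : 'M[R]_d)) qfZ mul0r.
by rewrite ltxx.
Qed.

Lemma cvg_hessmx (T : Type) (F : set_system T) (FF : Filter F)
    (g : T -> 'rV[R]_d) (N : T -> 'M[R]_d) x M : x != 0 ->
  (g @ F --> x) -> (N @ F --> M) -> hessmx (g t) (N t) @[t --> F] --> hessmx x M.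
Proof.
move=> x0 gx NM; apply: cvg_mx => i j.
have cD p k l : 'D_(e_ p) (fun y => f y k l) (g t) @[t --> F] --> 'D_(e_ p) (fun y => f y k l) x.
  exact: (@cvg_comp _ _ _ g ('D_(e_ p) (fun y => f y k l)) _ _ _ gx
    (CkO_cont (CkO_derive (e_ p) (f_smooth 1 k l)) x0)).
have cDD p q k l : 'D_(e_ p) ('D_(e_ q) (fun y => f y k l)) (g t) @[t --> F] -->
    'D_(e_ p) ('D_(e_ q) (fun y => f y k l)) x.
  exact: (@cvg_comp _ _ _ g ('D_(e_ p) ('D_(e_ q) (fun y => f y k l))) _ _ _ gx
    (CkO_cont (CkO_derive (e_ p) (CkO_derive (e_ q) (f_smooth 2 k l))) x0)).
have cx p : g t 0 p @[t --> F] --> x 0 p.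
  exact: (@cvg_comp _ _ _ g (fun z : 'rV[R]_d => z 0 p) _ _ _ gx (@coord_continuous _ _ _ 0 p x)).
have cf k l : f (g t) k l @[t --> F] --> f x k l.
  exact: (@cvg_comp _ _ _ g (fun y => f y k l) _ _ _ gx (CkO_cont (f_smooth 0 k l) x0)).
have cN k l : N t k l @[t --> F] --> M k l.
  have cc : {for M, continuous (fun z : 'M[R]_d => z k l)} := @coord_continuous _ _ _ k l M.
  exact: (@cvg_comp _ _ _ N (fun z : 'M[R]_d => z k l) F _ _ NM cc).
have cd := continuous_dot FF gx gx.
suff : hess i j (g t) (N t) @[t --> F] --> hess i j x M.
  rewrite mxE; apply: cvg_trans; apply: near_eq_cvg.
  by apply: (@filterE _ F FF) => t; rewrite mxE.
rewrite /hess; apply: cvgD; last first.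
  by apply: cvgM; [apply: cvgM; [exact: cvg_cst|apply: cvgB; [exact: cd|exact: cvg_cst]]|exact: cvg_cst].
apply: cvgD; last by apply: cvgM; [apply: cvgM; [exact: cvg_cst|exact: cx]|exact: cx].
apply: (@cvg_sumr _ _ _ FF _ _ _ (fun k t => \sum_l ('D_(e_ j) (fun y => f y k l) (g t)
   * 'D_(e_ i) (fun y => f y k l) (g t) - (N t k l - f (g t) k l)
   * 'D_(e_ j) ('D_(e_ i) (fun y => f y k l)) (g t)))) => k _.
apply: (@cvg_sumr _ _ _ FF _ _ _ (fun l t => 'D_(e_ j) (fun y => f y k l) (g t)
   * 'D_(e_ i) (fun y => f y k l) (g t) - (N t k l - f (g t) k l)
   * 'D_(e_ j) ('D_(e_ i) (fun y => f y k l)) (g t))) => l _.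
apply: cvgB; first exact: (cvgM (cD j k l) (cD i k l)).
exact: (cvgM (cvgB (cN k l) (cf k l)) (cDD j i k l)).
Qed.

Let inv_nat (e : R) : 0 < e -> exists m : nat, m.+1%:R^-1 < e.
Proof.
move=> e0; exists (Num.truncn e^-1); rewrite -[ltRHS]invrK ltf_pV2 ?posrE ?invr_gt0//.
exact: truncnS_gt.
Qed.

(** Compactness over pairs [(a, u)] of unit vectors. A single [r] is the radius for [x], the radius
    for [M] and the lower bound. *)
Lemma hessmx_unif : exists2 r : R, 0 < r & forall a x M, dot a a = 1 ->
  `|x - a| <= r -> `|M - f a| <= r -> x != 0 /\ forall u, r * `|u| ^+ 2 <= qf (hessmx x M) u.
Proof.
pose S : set 'rV[R]_d := [set x | dot x x = 1].
have cK : compact (S `*` S) by apply: compact_setX; exact: sphere_compact.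
pose P (m : nat) (p : 'rV[R]_d * 'rV[R]_d) := forall x M, `|x - p.1| <= m.+1%:R^-1 ->
  `|M - f p.1| <= m.+1%:R^-1 -> x != 0 /\ m.+1%:R^-1 <= qf (hessmx x M) p.2.
have mono m l p : (m <= l)%N -> P m p -> P l p.
  move=> ml Hp x M xp Mp.
  have lm : l.+1%:R^-1 <= m.+1%:R^-1 :> R by rewrite lef_pV2 ?posrE ?ltr0n// ler_nat.
  have [x0 H] := Hp x M (le_trans xp lm) (le_trans Mp lm).
  by split=> //; exact: le_trans lm H.
have loc p : (S `*` S) p -> exists m, \forall y \near p, P m y.
  case: p => a0 u0 [/= Sa Su].
  have a00 := sphere_neq0 Sa; have u00 := sphere_neq0 Su.
  have q0 := hessmx_pos Sa u00.
  pose F := nbhs (a0, (f a0, u0)).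
  have FF : Filter F by exact: nbhs_filter.
  have c1 : fst @ F --> a0 by exact: cvg_fst.
  have c2 : snd @ F --> (f a0, u0) by exact: cvg_snd.
  have c3 : (fun p => p.2.1) @ F --> f a0.
    have cc : fst @ nbhs (f a0, u0) --> f a0 by exact: cvg_fst.
    exact: (@cvg_comp _ _ _ snd fst F _ _ c2 cc).
  have c4 : (fun p => p.2.2) @ F --> u0.
    have cc : snd @ nbhs (f a0, u0) --> u0 by exact: cvg_snd.
    exact: (@cvg_comp _ _ _ snd snd F _ _ c2 cc).
  have ch := @cvg_hessmx _ F FF fst (fun p => p.2.1) a0 (f a0) a00 c1 c3.
  have cq := @cvg_qf R d _ F FF (fun p => hessmx p.1 p.2.1) (fun p => p.2.2) _ _ ch c4.
  set q := qf _ _ in q0 cq.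
  have q2 : q / 2 < q by lra.
  have N1 : F [set p | q / 2 < qf (hessmx p.1 p.2.1) p.2.2] := @cvgr_gt _ _ F FF _ _ cq _ q2.
  have N2 : F [set p | p.1 != 0] := c1 nz (open_nbhs_nbhs (conj (@open_nz R d) a00)).
  have : F [set p | p.1 != 0 /\ q / 2 < qf (hessmx p.1 p.2.1) p.2.2].
    by apply: (@filterS2 _ F FF _ _ _ _ N2 N1) => p; split.
  move=> /nbhs_ballP[r /= r0 rH].
  have r20 : 0 < r / 2 by rewrite divr_gt0.
  have [m Hm] : exists m : nat, m.+1%:R^-1 < Num.min (r / 2) (q / 2).
    by apply: inv_nat; rewrite lt_min r20/= divr_gt0.
  exists m; move: Hm; rewrite lt_min => /andP[mr mq].
  have d1 : fst @ nbhs (a0, u0) --> a0 by exact: cvg_fst.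
  have d2 : snd @ nbhs (a0, u0) --> u0 by exact: cvg_snd.
  have d3 := @cvg_f _ _ _ f_smooth _ (nbhs (a0, u0)) (nbhs_filter _) fst a0 a00 d1.
  have K1 : \forall p \near (a0, u0), `|a0 - p.1| < r / 2 by have /cvgrPdist_lt := d1; apply.
  have K2 : \forall p \near (a0, u0), `|u0 - p.2| < r by have /cvgrPdist_lt := d2; apply.
  have K3 : nbhs (a0, u0) [set p | `|f a0 - f p.1| < r / 2].
    exact: (@cvgr_dist_lt _ _ _ _ (nbhs_filter _) _ _ d3 _ r20).
  apply: (@filterS3 _ (nbhs (a0, u0)) (nbhs_filter _) _ _ _ (P m) _ K1 K2 K3).
  move=> [a u] /= h1 h2 h3 x M /= xa Ma.
  have [] := rH (x, (M, u)).
    split => /=; last split => /=; rewrite -ball_normE /ball_ /=.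
    - rewrite -(subrKA a) (splitr r); apply: le_lt_trans (ler_normD _ _) _.
      by apply: ltrD => //; rewrite distrC; exact: le_lt_trans xa mr.
    - rewrite -(subrKA (f a)) (splitr r); apply: le_lt_trans (ler_normD _ _) _.
      by apply: ltrD => //; rewrite distrC; exact: le_lt_trans Ma mr.
    - exact: h2.
  move=> /= x0 Hq; split=> //.
  by apply: le_trans (ltW Hq); exact: ltW.
have [m Hm] := compact_unif cK mono loc.
exists m.+1%:R^-1; first by rewrite invr_gt0.
move=> a x M a1 xa Ma.
have [u1 u11] := sphere_nonempty.
split; first by have [] := Hm (a, u1) (conj a1 u11) x M xa Ma.
move=> u; have [->|u0] := eqVneq u 0.
  by rewrite normr0 expr0n /= mulr0 qf0.
have p : 0 < dot u u by rewrite lt_neqAle dot_ge0 eq_sym dot_eq0 u0.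
have s0 : 0 < Num.sqrt (dot u u) by rewrite sqrtr_gt0.
have s2 := sqr_sqrtr (ltW p).
have uu : dot ((Num.sqrt (dot u u))^-1 *: u) ((Num.sqrt (dot u u))^-1 *: u) = 1.
  by rewrite dotZl dotZr -[X in _ * (_ * X)]s2; field; rewrite gt_eqF.
have [_ /=] := Hm (a, (Num.sqrt (dot u u))^-1 *: u) (conj a1 uu) x M xa Ma.
rewrite qf_scale exprVn s2 ler_pdivlMl// => H; apply: le_trans H.
by rewrite mulrC; apply: ler_wpM2r; [rewrite invr_ge0|exact: sqr_norm_le_dot].
Qed.

(** Strong convexity of the energy near [a], as strong monotonicity of its gradient; it will compare
    the critical points of two nearby matrices. *)
Lemma grad_mono (r : R) a x y M : dot a a = 1 ->
  (forall z, `|z - a| <= r -> z != 0 /\ forall u, r * `|u| ^+ 2 <= qf (hessmx z M) u) ->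
  `|x - a| <= r -> `|y - a| <= r ->
  r * `|x - y| ^+ 2 <= \sum_i (grad i x M - grad i y M) * (x - y) 0 i.
Proof.
move=> a1 H xa ya; pose h := x - y.
have seg (t : R) : 0 <= t <= 1 -> `|y + t *: h - a| <= r.
  move=> /andP[t0 t1].
  have -> : y + t *: h - a = (1 - t) *: (y - a) + t *: (x - a).
    by apply/rowP => i; rewrite !mxE; ring.
  apply: le_trans (ler_normD _ _) _; rewrite !normrZ !ger0_norm ?subr_ge0//.
  have e1 : (1 - t) * `|y - a| <= (1 - t) * r by apply: ler_wpM2l => //; rewrite subr_ge0.
  have e2 : t * `|x - a| <= t * r by apply: ler_wpM2l.
  lra.
have dg z : z != 0 -> is_derive z h (fun z => \sum_i h 0 i * grad i z M) (qf (hessmx z M) h).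
  move=> z0.
  have D1 i := is_deriveZ (h 0 i) (is_derive_grad i h M z0).
  have D2 := is_derive_sumr (index_enum 'I_d) D1.
  apply: is_derive_eq D2 _; apply: eq_bigr => i _; rewrite /GRing.scale /= mulr_sumr.
  apply: eq_bigr => j _; have -> : hessmx z M i j = hess i j z M by rewrite mxE.
  by ring.
have [|c cI E] := @MVT_line R _ (fun z => \sum_i h 0 i * grad i z M) y h.
  by move=> t /seg /H [z0 _]; have [] := dg _ z0.
have [z0 Hz] := H _ (seg c cI).
move: E; have [_ ->] := dg _ z0.
have -> : y + h = x by rewrite addrC subrK.
rewrite -sumrB => E.
have -> : \sum_i (grad i x M - grad i y M) * (x - y) 0 i = qf (hessmx (y + c *: h) M) h.
  by rewrite -E; apply: eq_bigr => i _; rewrite mulrC mulrBr.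
exact: Hz.
Qed.

End Retraction.

Lemma cvg_bounded_mul0 (R : realType) (T : Type) (F : set_system T) (FF : Filter F)
    (p q : T -> R) (C : R) :
  (\forall t \near F, `|p t| <= C) -> (q @ F --> (0 : R)) -> p t * q t @[t --> F] --> (0 : R).
Proof.
move=> pC q0; apply/(@cvgrPdist_lt _ _ _ F FF) => e e0.
have C0 : 0 < `|C| + 1 by rewrite ltr_wpDl.
have eC : 0 < e / (`|C| + 1) by rewrite divr_gt0.
have Hq : \forall t \near F, `|0 - q t| < e / (`|C| + 1).
  by move/(@cvgrPdist_lt _ _ _ F FF) : q0; apply.
apply: (@filterS2 _ F FF _ _ _ _ pC Hq) => t pt; rewrite !sub0r !normrN normrM => qt.
apply: (@le_lt_trans _ _ ((`|C| + 1) * `|q t|)).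
  by apply: ler_wpM2r => //; apply: le_trans pt _; have := ler_norm C; lra.
by rewrite mulrC -ltr_pdivlMr.
Qed.

Lemma sqr_norm_le_frobenius (R : realType) m n (N : 'M[R]_(m, n)) :
  `|N| ^+ 2 <= \sum_i \sum_j N i j ^+ 2.
Proof.
set s := \sum_i _.
have s0 : 0 <= s by apply: sumr_ge0 => i _; apply: sumr_ge0 => j _; exact: sqr_ge0.
rewrite -[leRHS]sqr_sqrtr// ler_sqr ?nnegrE ?sqrtr_ge0//.
apply: ler_norm_entry => [|i j]; first exact: sqrtr_ge0.
rewrite -ler_sqr ?nnegrE ?sqrtr_ge0// sqr_sqrtr// real_normK ?num_real//.
rewrite /s (bigD1 i)//= (bigD1 j)//= -addrA lerDl; apply: addr_ge0.
  by apply: sumr_ge0 => k _; exact: sqr_ge0.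
by apply: sumr_ge0 => k _; apply: sumr_ge0 => l _; exact: sqr_ge0.
Qed.

(** * Smooth dependence of the minimizer on the matrix *)

Section Argmin.
Variables (R : realType) (d : nat).
Implicit Types (x y z v w a b tau : 'rV[R]_d) (M N P : 'M[R]_d).

Local Notation nz := [set x : 'rV[R]_d | x != 0].
Local Notation e_ k := (delta_mx 0 k : 'rV[R]_d).

Variable f : 'rV[R]_d -> 'M[R]_d.
Hypothesis f_smooth : forall k i j, CkO k nz (fun x => f x i j).
Hypothesis f_homog : forall (t : R) x, 0 < t -> x != 0 -> f (t *: x) = f x.
Hypothesis secant : forall a b, dot a a = 1 -> dot b b = 1 -> a != b ->
  exists v, 0 < qf (f a - f b) v.
Hypothesis tangent : forall a tau, dot a a = 1 -> dot tau tau = 1 -> dot a tau = 0 ->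
  exists v, 0 < qf (Df f a tau) v.
Hypothesis sphere_nonempty : exists a : 'rV[R]_d, dot a a = 1.

Let onz : open nz := @open_nz R d.

Let CkO_coord k A i : CkO k A (fun x : 'rV[R]_d => x 0 i).
Proof.
by apply: CkO_linear => [c x y|]; [rewrite !mxE|exact: coord_continuous].
Qed.

Let CkO_dot k : CkO k nz (fun x : 'rV[R]_d => dot x x).
Proof. by apply: CkO_sum => // i _; apply: CkO_mul => //; exact: CkO_coord. Qed.

Lemma CkO_energy k M : CkO k nz (fun x => energy f x M).
Proof.
apply: CkO_add => //.
  apply: CkO_sum => // i _; apply: CkO_sum => // j _; apply: CkO_exprn => //.
  by apply: CkO_sub2 => //; exact: CkO_cst.
by apply: CkO_exprn => //; apply: CkO_sub2 => //; exact: CkO_cst.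
Qed.

Lemma CkO_grad k i M : CkO k nz (fun x => grad f i x M).
Proof.
apply: CkO_add => //.
  apply: CkO_opp => //; apply: CkO_sum => // p _; apply: CkO_sum => // q _.
  apply: CkO_mul => //; last exact: CkO_derive.
  by apply: CkO_sub2 => //; exact: CkO_cst.
apply: CkO_mul => //; apply: CkO_scale => //.
by apply: CkO_sub2 => //; exact: CkO_cst.
Qed.

Lemma grad_shift i x M N : grad f i x N = grad f i x M -
  \sum_k \sum_l (N k l - M k l) * 'D_(e_ i) (fun y => f y k l) x.
Proof.
rewrite /grad addrAC; congr (_ + _).
rewrite -opprD -big_split; congr (- _); apply: eq_bigr => k _ /=.
rewrite -big_split; apply: eq_bigr => l _ /=; ring.
Qed.

Lemma taylor_bound_partial A (phi : 'rV[R]_d -> R) m x i : CkO 1 A phi -> A x ->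
  taylor_bound A phi m x -> `|'D_(e_ i) phi x| <= m.+1%:R.
Proof.
move=> cphi Ax H.
have m0 : 0 < m.+1%:R :> R by rewrite ltr0n.
have e1 : `|e_ i| <= 1 :> R.
  apply: ler_norm_entry => // p q; rewrite mxE; case: (_ && _) => /=; rewrite ?normr1 ?normr0//.
have [|_ _] := H (m.+1%:R^-1 *: e_ i).
  by rewrite normrZ ger0_norm ?invr_ge0// ler_piMr ?invr_ge0.
have dd : derivable phi x (e_ i) by exact: CkO_derivable cphi Ax.
rewrite (derive_scaleE _ dd) normrM normrZ mulrCA ler_pM2l; last by rewrite normr_gt0 invr_eq0 gt_eqF.
by move=> H2; apply: le_trans H2 _; rewrite ler_piMr.
Qed.

Lemma energy_shift x M N : energy f x N - energy f x M =
  \sum_k \sum_l (N k l - M k l) * (N k l + M k l - 2 * f x k l).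
Proof.
rewrite /energy opprD addrACA subrr addr0 -sumrB; apply: eq_bigr => k _.
rewrite -sumrB; apply: eq_bigr => l _; ring.
Qed.

(** A kernel vector would be a zero of the form. Symmetry is not assumed; the transpose is what
    occurs in the linear system for row vectors. *)
Lemma unitmx_pos (N : 'M[R]_d) : (forall u : 'rV[R]_d, u != 0 -> 0 < qf N u) -> N^T \in unitmx.
Proof.
move=> H; rewrite -row_free_unit -kermx_eq0; apply/rowV0Pn => -[u /sub_kermxP uN u0].
have := H u u0; rewrite qfE.
have -> : (u *m N *m u^T) 0 0 = (u *m N^T *m u^T) 0 0.
  have -> : u *m N *m u^T = (u *m N^T *m u^T)^T by rewrite !trmx_mul !trmxK mulmxA.
  by rewrite mxE.
by rewrite uN mul0mx mxE ltxx.
Qed.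


Lemma derive_min_eq0 (V : normedModType R) (phi : V -> R) (x v : V) :
  (\forall t \near (0 : R), derivable phi (x + t *: v) v) ->
  (\forall t \near (0 : R), phi x <= phi (x + t *: v)) -> 'D_v phi x = 0.
Proof.
move=> dphi mphi; have /nbhs_ballP[r /= r0 rH] : nbhs (0 : R) [set t | derivable phi (x + t *: v) v /\ phi x <= phi (x + t *: v)].
  by apply: (@filterS2 _ (nbhs (0 : R)) (nbhs_filter _) _ _ _ _ dphi mphi) => t; split.
have inb t : t \in `]-r, r[%R -> derivable phi (x + t *: v) v /\ phi x <= phi (x + t *: v).
  rewrite in_itv /= => /andP[t1 t2]; apply: rH; rewrite -ball_normE /ball_ /= sub0r normrN.
  by rewrite ltr_norml t1.
have i0 : 0 \in `]-r, r[%R by rewrite in_itv /= oppr_lt0 r0.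
have D0 := is_derive_line (inb 0 i0).1.
have D1 : is_derive (0 : R) 1 (fun t : R => phi (x + t *: v)) 0.
  apply: (@derive1_at_min R _ (- r) r) => //.
  - by rewrite ltW// gtrN.
  - by move=> t /inb [dt _]; have [] := is_derive_line dt.
  - by move=> t /inb [_]; rewrite scale0r addr0.
have [_ E1] := D1; have [_ E0] := D0.
by rewrite -[x]addr0 -(scale0r v) -E0 E1.
Qed.


(** The implicit function theorem by hand. Caratheodory's formula turns the equations [grad = 0] at
    [M] and at [t *: P + M] into a linear system for the difference quotient [q] of [X], whose
    matrix tends to the invertible [H]. The Lipschitz hypothesis keeps [q] bounded, so that
    replacing the matrix by [H] costs a vanishing error. *)
Lemma argmin_derivable (X : 'M[R]_d -> 'rV[R]_d) M (C : R) : X M != 0 ->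
  (\forall N \near M, `|X N - X M| <= C * `|N - M|) ->
  (\forall N \near M, forall i, grad f i (X N) N = 0) ->
  (forall u, u != 0 -> 0 < qf (hessmx f (X M) M) u) ->
  forall P i, is_derive M P (fun N => X N 0 i)
    (\sum_j (\sum_k \sum_l P k l * 'D_(e_ j) (fun y => f y k l) (X M))
       * invmx (hessmx f (X M) M)^T j i).
Proof.
move=> x0 XC Xg Hpos P i; set H := hessmx f (X M) M.
have uH : H^T \in unitmx by exact: unitmx_pos.
pose F := (0 : R)^'.
have FF : Filter F by exact: dnbhs_filter.
pose b j y := \sum_k \sum_l P k l * 'D_(e_ j) (fun y => f y k l) y.
pose q (t : R) : 'rV[R]_d := t^-1 *: (X (t *: P + M) - X M).
pose h (t : R) : 'rV[R]_d := X (t *: P + M) - X M.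
have cP : t *: P + M @[t --> F] --> M.
  have c1 : t *: P + M @[t --> (0 : R)] --> 0 *: P + M.
    by apply: cvgD; [apply: cvgZr_tmp; exact: cvg_id|exact: cvg_cst].
  rewrite scale0r add0r in c1.
  by apply: cvg_trans c1; apply: (@cvg_app _ _ _ _ (fun t => t *: P + M)); exact: (@nbhs_dnbhs _ (0 : R)).
have N0 : \forall t \near F, t != 0 by exact: nbhs_dnbhs_neq.
have N1 : \forall t \near F, `|X (t *: P + M) - X M| <= C * `|t *: P + M - M| := cP _ XC.
have N2 : \forall t \near F, forall i, grad f i (X (t *: P + M)) (t *: P + M) = 0 := cP _ Xg.
have qC : \forall t \near F, `|q t| <= C * `|P|.
  apply: (@filterS2 _ F FF _ _ _ _ N0 N1) => t t0.
  rewrite addrK normrZ /q normrZ normfV => H1.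
  by rewrite ler_pdivrMl ?normr_gt0// mulrCA.
have h0 : h t @[t --> F] --> (0 : 'rV[R]_d).
  have c1 : (C * `|P|) * `|t| @[t --> F] --> (0 : R).
    have c0 : (fun t : R => t) @ F --> (0 : R) by exact: (@nbhs_dnbhs _ (0 : R)).
    by have := cvgM (@cvg_cst _ (C * `|P|) _ F FF) (cvg_norm c0); rewrite normr0 mulr0; apply.
  apply/(@cvgrPdist_lt _ _ _ F FF) => e e0.
  have N3 : \forall t \near F, `|0 - C * `|P| * `|t| | < e.
    by move/(@cvgrPdist_lt _ _ _ F FF) : c1; apply.
  apply: (@filterS2 _ F FF _ _ _ _ N1 N3) => t; rewrite addrK normrZ !sub0r !normrN => H1 H2.
  apply: le_lt_trans H2; apply: le_trans (ler_norm _).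
  by rewrite -mulrA [`|P| * _]mulrC.
have cX : X (t *: P + M) @[t --> F] --> X M.
  have : h t + X M @[t --> F] --> 0 + X M by apply: cvgD => //; exact: cvg_cst.
  rewrite add0r; apply: cvg_trans; apply: near_eq_cvg; apply: (@filterE _ F FF) => t.
  by rewrite /h subrK.
have cb j : b j (X (t *: P + M)) @[t --> F] --> b j (X M).
  apply: (@cvg_comp _ _ _ (fun t => X (t *: P + M)) (b j) F _ _ cX).
  apply: (CkO_cont (k := 0) (A := nz)) => //; apply: CkO_sum => // k _; apply: CkO_sum => // l _.
  by apply: CkO_scale => //; apply: CkO_derive.
have /choice[psi Hpsi] : forall p, exists psi : 'I_d -> 'rV[R]_d -> R,
    (forall j, psi j z @[z --> (0 : 'rV[R]_d)] --> H p j) /\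
    (\forall z \near (0 : 'rV[R]_d), grad f p (X M + z) M - grad f p (X M) M = \sum_j z 0 j * psi j z).
  move=> p; have [psi [H1 H2]] := caratheodory onz x0 (CkO_grad 1 p M).
  exists psi; split=> // j; have := H1 j.
  have [_ ->] := is_derive_grad f_smooth p (e_ j) M x0.
  rewrite (bigD1 j)//= big1 => [|k kj]; last by rewrite mxE (negbTE kj) andbF mul0r.
  by rewrite !mxE !eqxx mul1r addr0.
have cpsi p j : psi p j (h t) - H p j @[t --> F] --> (0 : R).
  have c1 : psi p j (h t) @[t --> F] --> H p j.
    exact: (@cvg_comp _ _ _ h (psi p j) F _ _ h0 ((Hpsi p).1 j)).
  by have := cvgB c1 (cvg_cst (H p j)); rewrite subrr; apply.
(* The right-hand side of the system once its matrix is frozen at [H]. *)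
pose s p t := b p (X (t *: P + M)) - \sum_j q t 0 j * (psi p j (h t) - H p j).
have cs p : s p t @[t --> F] --> b p (X M).
  have c1 : \sum_j q t 0 j * (psi p j (h t) - H p j) @[t --> F] --> \sum_(j < d) (0 : R).
    apply: (@cvg_sumr _ _ F FF _ _ _ (fun j t => q t 0 j * (psi p j (h t) - H p j))) => j _.
    apply: (@cvg_bounded_mul0 _ _ F FF (fun t => q t 0 j) _ (C * `|P|)) => //.
    by apply: (@filterS _ F FF _ _ _ qC) => t; apply: le_trans; exact: ler_entry_norm.
  by have := cvgB (cb p) c1; rewrite big1// subr0; apply.
have N3 : \forall t \near F, forall p, grad f p (X M + h t) M - grad f p (X M) M = \sum_j h t 0 j * psi p j (h t).
  apply: (@filter_forall R 'I_d (fun p t => grad f p (X M + h t) M - grad f p (X M) M =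
    \sum_j h t 0 j * psi p j (h t)) F FF) => p; exact: (h0 _ (Hpsi p).2).
have N4 : \forall t \near F, q t = (\row_p s p t) *m invmx H^T.
  have gM p : grad f p (X M) M = 0 by have := nbhs_singleton Xg; apply.
  apply: (@filterS3 _ F FF _ _ _ _ _ N0 N2 N3) => t t0 g2 g3.
  suff <- : q t *m H^T = \row_p s p t by rewrite mulmxK.
  apply/rowP => p; rewrite !mxE.
  have E1 : \sum_j q t 0 j * psi p j (h t) = b p (X (t *: P + M)).
    have := g3 p; rewrite gM subr0 [X M + h t]addrC /h subrK -/(h t) => g4.
    have := grad_shift p (X (t *: P + M)) M (t *: P + M); rewrite g2 g4.
    have -> : \sum_k \sum_l ((t *: P + M) k l - M k l) * 'D_(e_ p) (fun y => f y k l) (X (t *: P + M))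
       = t * b p (X (t *: P + M)).
      rewrite /b mulr_sumr; apply: eq_bigr => k _; rewrite mulr_sumr; apply: eq_bigr => l _.
      by rewrite !mxE addrK mulrA.
    move=> E; have E2 : \sum_j h t 0 j * psi p j (h t) = t * b p (X (t *: P + M)).
      by apply/eqP; rewrite -subr_eq0 -E.
    have -> : \sum_j q t 0 j * psi p j (h t) = t^-1 * \sum_j h t 0 j * psi p j (h t).
      by rewrite mulr_sumr; apply: eq_bigr => j _; rewrite mulrA [q t 0 j]mxE.
    by rewrite E2 mulKf.
  rewrite /s -E1 -sumrB; apply: eq_bigr => j _; rewrite [H^T _ _]mxE; ring.
have lim : q t 0 i @[t --> F] --> \sum_j b j (X M) * invmx H^T j i.
  have : \sum_j s j t * invmx H^T j i @[t --> F] --> \sum_j b j (X M) * invmx H^T j i.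
    apply: (@cvg_sumr _ _ F FF _ _ _ (fun j t => s j t * invmx H^T j i)) => j _.
    by apply: cvgM; [exact: cs|exact: cvg_cst].
  apply: cvg_trans; apply: near_eq_cvg; apply: (@filterS _ F FF _ _ _ N4) => t ->.
  by rewrite mxE; apply: eq_bigr => j _; rewrite mxE.
have lim2 : (fun t : R => t^-1 *: (((fun N => X N 0 i) \o shift M) (t *: P) - X M 0 i)) @ F -->
    \sum_j b j (X M) * invmx H^T j i.
  apply: cvg_trans lim; apply: near_eq_cvg; apply: (@filterE _ F FF) => t.
  by rewrite /= !mxE.
split; first by apply/cvg_ex; exists (\sum_j b j (X M) * invmx H^T j i).
exact/cvg_lim.
Qed.

Lemma CkO_hessmx k (V : normedModType R) (U : set V) (x : V -> 'rV[R]_d) (M : V -> 'M[R]_d) :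
  open U -> (forall t, U t -> x t != 0) ->
  (forall i, CkO k U (fun t => x t 0 i)) -> (forall i j, CkO k U (fun t => M t i j)) ->
  forall i j, CkO k U (fun t => hessmx f (x t) (M t) i j).
Proof.
move=> oU x0 cx cM i j.
have comp g : (CkO k nz g) -> CkO k U (fun t => g (x t)).
  by move=> cg; apply: (@CkO_comp _ _ _ k g nz U x).
apply: (@CkO_ext _ _ k U (fun t => hess f i j (x t) (M t))) => // [t _|]; first by rewrite mxE.
have cD p k' l : CkO k U (fun t => 'D_(e_ p) (fun y => f y k' l) (x t)).
  exact: (comp ('D_(e_ p) (fun y => f y k' l)) (CkO_derive (e_ p) (f_smooth k.+1 k' l))).
have cDD p q k' l : CkO k U (fun t => 'D_(e_ p) ('D_(e_ q) (fun y => f y k' l)) (x t)).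
  exact: (comp ('D_(e_ p) ('D_(e_ q) (fun y => f y k' l))) (CkO_derive (e_ p) (CkO_derive (e_ q) (f_smooth k.+2 k' l)))).
apply: CkO_add => //; last first.
  apply: CkO_mul => //; last exact: CkO_cst.
  apply: CkO_scale => //; apply: CkO_sub2 => //; last exact: CkO_cst.
  exact: (comp (fun x => dot x x) (CkO_dot k)).
apply: CkO_add => //; last by apply: CkO_mul => //; apply: CkO_scale.
apply: CkO_sum => // p _; apply: CkO_sum => // q _; apply: CkO_sub2 => //.
  by apply: CkO_mul.
apply: CkO_mul => //; apply: CkO_sub2 => //.
exact: (comp (fun x => f x p q) (f_smooth k p q)).
Qed.

(** Bootstrap: the derivative of [X] is an expression in [X], the derivatives of [f] and an inverse
    matrix, so each order of smoothness yields the next. *)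
Lemma CkO_argmin (X : 'M[R]_d -> 'rV[R]_d) (U : set 'M[R]_d) (C : R) : open U ->
  (forall M, U M -> X M != 0) ->
  (forall M, U M -> \forall N \near M, `|X N - X M| <= C * `|N - M|) ->
  (forall M, U M -> forall i, grad f i (X M) M = 0) ->
  (forall M u, U M -> u != 0 -> 0 < qf (hessmx f (X M) M) u) ->
  forall k i, CkO k U (fun M => X M 0 i).
Proof.
move=> oU x0 XC Xg Hpos.
have dX M P i : U M -> is_derive M P (fun N => X N 0 i)
    (\sum_j (\sum_k \sum_l P k l * 'D_(e_ j) (fun y => f y k l) (X M))
       * invmx (hessmx f (X M) M)^T j i).
  move=> UM; apply: argmin_derivable; [exact: x0|exact: XC| |by move=> u; exact: Hpos].
  by have := open_nbhs_nbhs (conj oU UM); apply: filterS => N; exact: Xg.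
have Xc M i : U M -> {for M, continuous (fun N => X N 0 i)}.
  move=> UM; apply/(@cvgrPdist_lt _ _ _ (nbhs M) (nbhs_filter M)) => e e0.
  have C0 : 0 < `|C| + 1 by rewrite ltr_wpDl.
  have N1 := XC M UM.
  have N2 : \forall N \near M, `|M - N| < e / (`|C| + 1).
    by apply: (@cvgr_dist_lt _ _ _ (nbhs M) (nbhs_filter M) id M cvg_id); rewrite divr_gt0.
  apply: (@filterS2 _ (nbhs M) (nbhs_filter M) _ _ _ _ N1 N2) => N H1 H2.
  rewrite distrC; have := ler_entry_norm (X N - X M) 0 i; rewrite !mxE => H3.
  apply: le_lt_trans H3 _; apply: le_lt_trans H1 _; rewrite distrC.
  apply: (@le_lt_trans _ _ ((`|C| + 1) * `|M - N|)).
    by apply: ler_wpM2r => //; have := ler_norm C; lra.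
  by rewrite mulrC -ltr_pdivlMr.
elim=> [|k IH] i; first by split=> // M UM; exact: Xc.
apply: CkO_succ => // [M UM|P]; first exact: Xc.
eexists; split; first by move=> M UM; exact: dX.
have cXf g : (forall k, CkO k nz g) -> CkO k U (fun M => g (X M)).
  by move=> cg; apply: (@CkO_comp _ _ _ k g nz U X).
apply: CkO_sum => // j _; apply: CkO_mul => //.
  apply: CkO_sum => // p _; apply: CkO_sum => // q _; apply: CkO_scale => //.
  exact: (cXf ('D_(e_ j) (fun y => f y p q)) (fun k' => CkO_derive (e_ j) (f_smooth k'.+1 p q))).
apply: CkO_invmx => // [p q|M UM].
  have H : CkO k U (fun M => hessmx f (X M) M q p).
    apply: CkO_hessmx => // a b; apply: CkO_linear => [c x y|]; first by rewrite !mxE.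
    exact: coord_continuous.
  by apply: CkO_ext H; [exact: oU|move=> M _; rewrite [RHS]mxE].
by apply: unitmx_pos => u; exact: Hpos.
Qed.

End Argmin.

(** [X M] minimizes the energy over a compact annulus and [E M] is the minimum; both are defined for
    every [M], and [E] is continuous everywhere, whereas smoothness is claimed where [E] is small.
    There the minimizer is interior and close to the sphere, [M] is close to the range, and the
    energy is strongly convex. *)
Lemma exists_retraction (R : realType) (d : nat) (f : 'rV[R]_d -> 'M[R]_d) :
  (forall k i j, CkO k [set x : 'rV[R]_d | x != 0] (fun x : 'rV[R]_d => f x i j)) ->
  (forall (t : R) (x : 'rV[R]_d), 0 < t -> x != 0 -> f (t *: x) = f x) ->
  (forall a b : 'rV[R]_d, dot a a = 1 -> dot b b = 1 -> a != b -> exists v : 'rV[R]_d, 0 < qf (f a - f b) v) ->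
  (forall a tau : 'rV[R]_d, dot a a = 1 -> dot tau tau = 1 -> dot a tau = 0 ->
    exists v : 'rV[R]_d, 0 < qf (Df f a tau) v) ->
  (exists a : 'rV[R]_d, dot a a = 1) ->
  exists (X : 'M[R]_d -> 'rV[R]_d) (E : 'M[R]_d -> R) (r C : R),
  let U := [set M | E M < r] in
  [/\ 0 < r, 0 < C, continuous E, forall M, 0 <= E M &
  [/\ forall k i, CkO k U (fun M => X M 0 i),
    forall k, CkO k U E,
    forall M, U M -> annulus (1 / 2) 2 (X M),
    forall a, dot a a = 1 -> E (f a) = 0 /\ X (f a) = a
    & forall M N, U M -> U N -> `|M - N| <= r ->
      `|X M - X N| <= C * `|M - N| /\ `|E M - E N| <= C * `|M - N|]].
Proof.
move=> f_smooth f_homog secant tangent sphere_nonempty.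
set nz := [set x : 'rV[R]_d | x != 0] in f_smooth *.
have onz : open nz := @open_nz R d.
have CkO_dot k : CkO k nz (fun x : 'rV[R]_d => dot x x).
  apply: CkO_sum => // i _.
  by apply: CkO_mul => //; (apply: CkO_linear => [c x y|]; [rewrite !mxE|exact: coord_continuous]).
have eqle (p q : R) : p = q -> p <= q by move=> ->.
have [rh rh0 Hh] := hessmx_unif f_smooth tangent sphere_nonempty.
have [L L0 [LB _ _]] := lipschitz_sphere f_smooth f_homog.
have [ms Hms] := secant_unif f_smooth f_homog secant tangent.
have annz : annulus (1 / 2) 2 `<=` nz.
  move=> x /= /andP[x1 _]; rewrite /nz /= -dot_eq0 gt_eqF//.
  by apply: lt_le_trans x1; rewrite divr_gt0.
have [mt Hmt] := @taylor_compact R d ('I_d * 'I_d)%type (fun kl x => f x kl.1 kl.2) nz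
  _ onz (@annulus_compact R d (1 / 2) 2) annz (fun kl => f_smooth 2 kl.1 kl.2).
have Cd x i k l : annulus (1 / 2) 2 x -> `|'D_(delta_mx 0 i : 'rV[R]_d) (fun y => f y k l) x| <= mt.+1%:R.
  move=> Kx; apply: (@taylor_bound_partial R d nz) => //; first exact: annz.
  exact: (Hmt (k, l)).
have [a0 a01] := sphere_nonempty.
have minE M : exists x, annulus (1 / 2) 2 x /\ forall y, annulus (1 / 2) 2 y -> energy f x M <= energy f y M.
  have [||x] := @compact_EVT_min _ R (fun x => energy f x M) (annulus (1 / 2) 2) _ (@annulus_compact R d (1 / 2) 2).
  - by exists a0; rewrite /annulus /= a01; apply/andP; split; lra.
  - apply: continuous_in_subspaceT => x /set_mem /annz xn.
    exact: CkO_cont (CkO_energy f_smooth 0 M) xn.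
  rewrite inE => Kx Hx; exists x; split=> // y Ky; apply: Hx; exact: mem_set.
have [X HX] := choice minE.
pose E M := energy f (X M) M.
pose D : R := d%:R.
have D0 : 0 <= D by rewrite ler0n.
pose As := ms.+1%:R * D ^+ 2.
have As0 : 0 <= As by rewrite mulr_ge0// sqr_ge0.
(* Uniform hyperbolicity makes the inverse of [f] on the sphere Lipschitz. *)
have bilip a b : dot a a = 1 -> dot b b = 1 -> `|a - b| <= As * `|f a - f b|.
  move=> a1 b1; have [v v1 Hv] := Hms a b a1 b1; apply: le_trans Hv _.
  rewrite -mulrA ler_pM2l ?ltr0n//; apply: le_trans (ler_norm _) _.
  apply: le_trans (qf_norm_le _ _) _; rewrite ler_piMr ?mulr_ge0 ?sqr_ge0//.
  by rewrite exprn_ile1.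
(* The bound 1 / 4 keeps minimizers interior; the other one puts the minimizers of two nearby
   matrices in one ball of radius [rh], where strong convexity holds. The energy is a sum of
   squares, whence the threshold [r0 ^+ 2] for [E]. *)
pose r0 := Num.min (1 / 4) (rh / (2 + 3 * As)).
have As2 : 0 < 2 + 3 * As by lra.
have r00 : 0 < r0 by rewrite lt_min !divr_gt0.
have r04 : r0 <= 1 / 4 by rewrite ge_min lexx.
have r0h : (2 + 3 * As) * r0 <= rh.
  by rewrite mulrC -ler_pdivlMr// ge_min lexx orbT.
have r0As : 0 <= As * r0 by rewrite mulr_ge0// ltW.
pose r := r0 ^+ 2.
have rp : 0 < r by rewrite exprn_gt0.
have E0 M : 0 <= E M.
  apply: addr_ge0; last exact: sqr_ge0.
  by apply: sumr_ge0 => k _; apply: sumr_ge0 => l _; exact: sqr_ge0.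
have loc M : E M < r -> exists a, [/\ dot a a = 1, `|X M - a| <= r0, `|M - f a| <= r0,
    f (X M) = f a & `|dot (X M) (X M) - 1| < 1 / 4].
  move=> EM; have [Kx _] := HX M; have x0 := annz _ Kx.
  have F0 : 0 <= \sum_k \sum_l (M k l - f (X M) k l) ^+ 2.
    by apply: sumr_ge0 => k _; apply: sumr_ge0 => l _; exact: sqr_ge0.
  have n1 : `|dot (X M) (X M) - 1| < r0.
    rewrite -(@ltr_pXn2r _ 2)// ?nnegrE ?(ltW r00)// real_normK ?num_real//.
    by apply: le_lt_trans EM; rewrite /E /energy lerDr.
  have n2 : `|M - f (X M)| <= r0.
    rewrite -(@ler_pXn2r _ 2)// ?nnegrE ?(ltW r00)//.
    apply: le_trans (ltW EM); apply: le_trans (sqr_norm_le_frobenius _) _.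
    rewrite /E /energy.
    have -> : \sum_i \sum_j (M - f (X M)) i j ^+ 2 = \sum_k \sum_l (M k l - f (X M) k l) ^+ 2.
      by apply: eq_bigr => k _; apply: eq_bigr => l _; rewrite !mxE.
    by rewrite lerDl sqr_ge0.
  have p : 0 < dot (X M) (X M) by rewrite lt_neqAle dot_ge0 eq_sym dot_eq0 x0.
  set s := Num.sqrt (dot (X M) (X M)).
  have s0 : 0 < s by rewrite sqrtr_gt0.
  have s2 : s ^+ 2 = dot (X M) (X M) := sqr_sqrtr (ltW p).
  have aa : dot (s^-1 *: X M) (s^-1 *: X M) = 1.
    by rewrite dotZl dotZr -s2; field; rewrite gt_eqF.
  have fE : f (X M) = f (s^-1 *: X M) by rewrite f_homog// invr_gt0.
  exists (s^-1 *: X M); split=> //.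
  - have -> : X M - s^-1 *: X M = (s - 1) *: (s^-1 *: X M).
      by rewrite scalerBl scale1r scalerA mulfV ?scale1r// gt_eqF.
    rewrite normrZ; apply: (@le_trans _ _ `|s - 1|).
      by rewrite ler_piMr// sphere_norm_le1.
    apply: le_trans (ltW n1).
    have -> : dot (X M) (X M) - 1 = (s - 1) * (s + 1) by rewrite -s2; ring.
    rewrite normrM ler_peMr// ger0_norm; lra.
  - by rewrite -fE.
  - by apply: lt_le_trans n1 r04.
pose K := D ^+ 2.
have K0 : 0 <= K by rewrite sqr_ge0.
have fL x : annulus (1 / 2) 2 x -> `|f x| <= L.
  by move=> /annz x0; have [a a1 ->] := normalize_sphere f_homog x0; exact: LB.
(* The minimizer for [M] is a competitor for [N]; this bounds [E] without any regularity of [X]. *)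
have Eup M N : E N - E M <= K * (`|M| + `|N| + 2 * L) * `|N - M|.
  have [KM _] := HX M; have [_ HN] := HX N.
  have H1 : E N <= energy f (X M) N by exact: HN.
  have H2 := energy_shift f (X M) M N.
  apply: (@le_trans _ _ (energy f (X M) N - energy f (X M) M)); first by rewrite lerD2r.
  rewrite H2; apply: le_trans (ler_norm _) _; apply: le_trans (ler_norm_sum _ _ _) _.
  apply: (@le_trans _ _ (\sum_(k < d) \sum_(l < d) `|N - M| * (`|M| + `|N| + 2 * L))).
    apply: ler_sum => k _; apply: le_trans (ler_norm_sum _ _ _) _; apply: ler_sum => l _.
    rewrite normrM; apply: ler_pM => //.
      by have := ler_entry_norm (N - M) k l; rewrite !mxE.
    apply: le_trans (ler_normB _ _) _; rewrite normrM ger0_norm//.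
    apply: lerD; last by rewrite ler_pM2l//; apply: le_trans (ler_entry_norm _ _ _) (fL _ KM).
    by rewrite addrC; apply: le_trans (ler_normD _ _) _; apply: lerD; exact: ler_entry_norm.
  by under eq_bigr do rewrite sum_ord_const; rewrite sum_ord_const /K /D; apply: eqle; ring.
have Ec : continuous E.
  move=> M; apply/(@cvgrPdist_lt _ _ _ (nbhs M) (nbhs_filter M)) => e e0.
  pose Q := K * (2 * `|M| + 1 + 2 * L) + 1.
  have Q0 : 0 < Q by rewrite ltr_wpDl// mulr_ge0// addr_ge0 ?addr_ge0 ?mulr_ge0// ltW.
  have N1 : \forall N \near M, `|M - N| < 1.
    by apply: (@cvgr_dist_lt _ _ _ (nbhs M) (nbhs_filter M) id M cvg_id).
  have N2 : \forall N \near M, `|M - N| < e / Q.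
    by apply: (@cvgr_dist_lt _ _ _ (nbhs M) (nbhs_filter M) id M cvg_id); rewrite divr_gt0.
  apply: (@filterS2 _ (nbhs M) (nbhs_filter M) _ _ _ _ N1 N2) => N H1 H2.
  have H3 : `|N| <= `|M| + 1.
    rewrite -[N](subrK M); apply: le_trans (ler_normD _ _) _; rewrite addrC lerD2l distrC; exact: ltW.
  have H4 : K * (`|M| + `|N| + 2 * L) * `|M - N| < e.
    apply: (@le_lt_trans _ _ (Q * `|M - N|)); last by rewrite mulrC -ltr_pdivlMr.
    apply: ler_wpM2r => //; apply: (@le_trans _ _ (K * (2 * `|M| + 1 + 2 * L))); last by rewrite lerDl.
    by apply: ler_wpM2l => //; clear -H3; lra.
  have H5 := Eup M N; have H6 := Eup N M.
  have H7 : K * (`|M| + `|N| + 2 * L) * `|N - M| < e by rewrite distrC.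
  have H8 : K * (`|N| + `|M| + 2 * L) * `|M - N| < e by rewrite [`|N| + _]addrC.
  rewrite ltr_norml; apply/andP; split; last exact: le_lt_trans H6 H8.
  by rewrite ltrNl opprB; exact: le_lt_trans H5 H7.
pose U : set 'M[R]_d := [set M | E M < r].
have oU : open U.
  have -> : U = E @^-1` [set x | x < r] by [].
  by apply: open_comp => [M _|]; [exact: Ec|exact: open_lt].
(* The minimizer lies in the interior of the annulus, so the gradient vanishes. *)
have crit M : U M -> forall i, grad f i (X M) M = 0.
  move=> UM i; have [KM HM] := HX M; have xn := annz _ KM.
  have [a [_ _ _ _ n1]] := loc M UM.
  suff : 'D_(delta_mx 0 i : 'rV[R]_d) (energy f ^~ M) (X M) = 0.
    have [_ ->] := is_derive_energy f_smooth (delta_mx 0 i : 'rV[R]_d) M xn.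
    rewrite (bigD1 i)//= big1 => [|k ki]; last by rewrite mxE (negbTE ki) andbF mul0r.
    by rewrite mxE !eqxx mul1r addr0 => /eqP; rewrite mulf_eq0 pnatr_eq0 /= => /eqP.
  have cl : (fun t : R => X M + t *: (delta_mx 0 i : 'rV[R]_d)) @ nbhs (0 : R) --> X M.
    have c0 : (fun t : R => t *: (delta_mx 0 i : 'rV[R]_d)) @ nbhs (0 : R) --> (0 : R) *: (delta_mx 0 i : 'rV[R]_d).
      by apply: cvgZr_tmp; exact: cvg_id.
    have := cvgD (@cvg_cst _ (X M) _ (nbhs (0 : R)) _) c0.
    by rewrite scale0r addr0; apply.
  have N1 : \forall t \near (0 : R), X M + t *: (delta_mx 0 i : 'rV[R]_d) != 0.
    exact: (cl nz (open_nbhs_nbhs (conj onz xn))).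
  have N2 : \forall t \near (0 : R), annulus (1 / 2) 2 (X M + t *: (delta_mx 0 i : 'rV[R]_d)).
    have cd := @continuous_dot _ _ _ (nbhs (0 : R)) (nbhs_filter _) _ _ _ _ cl cl.
    have q0 : 0 < 1 / 4 - `|dot (X M) (X M) - 1| by rewrite subr_gt0.
    have N3 : \forall t \near (0 : R), `|dot (X M) (X M) - dot (X M + t *: (delta_mx 0 i : 'rV[R]_d)) (X M + t *: (delta_mx 0 i : 'rV[R]_d))| <
       1 / 4 - `|dot (X M) (X M) - 1|.
      exact: (@cvgr_dist_lt _ _ _ (nbhs (0 : R)) (nbhs_filter _) _ _ cd _ q0).
    apply: (@filterS _ (nbhs (0 : R)) (nbhs_filter _) _ _ _ N3) => t.
    rewrite /annulus /=; move: (dot _ _) (dot _ _) => q p; clear.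
    move=> H; have H2 := ler_normD (p - q) (1 - p).
    have H3 : `|p - q + (1 - p)| < 1 / 4 by apply: le_lt_trans H2 _; rewrite [`|1 - p|]distrC -ltrBrDr; exact: H.
    move: H3; have -> : p - q + (1 - p) = 1 - q by ring.
    rewrite ltr_norml => /andP[h1 h2]; clear H H2; apply/andP; split; lra.
  apply: (@derive_min_eq0 R _ (fun x : 'rV[R]_d => energy f x M) (X M) (delta_mx 0 i)).
    apply: (@filterS _ (nbhs (0 : R)) (nbhs_filter _) _ _ _ N1) => t tn.
    by have [] := is_derive_energy f_smooth (delta_mx 0 i : 'rV[R]_d) M tn.
  by apply: (@filterS _ (nbhs (0 : R)) (nbhs_filter _) _ _ _ N2) => t; exact: HM.
pose Y := D * (K * mt.+1%:R) / rh.
have Y0 : 0 <= Y by rewrite mulr_ge0 ?invr_ge0 ?(ltW rh0)// !mulr_ge0.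
have r01 : r <= r0 by rewrite /r expr2 ler_piMl ?(ltW r00)//; clear -r04; lra.
have r0rh : r0 <= rh by apply: le_trans r0h; clear -r0As r00; lra.
(* Strong monotonicity of the gradient for [M] between the two minimizers is set against the affine
   dependence of the gradient on the matrix. *)
have XL M N : U M -> U N -> `|M - N| <= r -> `|X M - X N| <= Y * `|M - N|.
  move=> UM UN MN.
  have [a [a1 Xa Ma _ _]] := loc M UM; have [b [b1 Xb Nb _ _]] := loc N UN.
  have [KN _] := HX N.
  have ab : `|b - a| <= As * (3 * r0).
    apply: le_trans (bilip b a b1 a1) _; apply: ler_wpM2l => //.
    have -> : f b - f a = - (N - f b) - (M - N) + (M - f a) by apply/matrixP => i j; rewrite !mxE; ring.
    apply: le_trans (ler_normD _ _) _; have := ler_normB (- (N - f b)) (M - N).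
    rewrite normrN; move: Nb MN Ma r01; move: `|_| `|_| `|_| `|_| => p q s t; clear; lra.
  have Xba : `|X N - a| <= rh.
    rewrite -(subrKA b); apply: le_trans (ler_normD _ _) _; apply: le_trans r0h.
    have gen (p q x y : R) : 0 <= p -> x <= p -> y <= q * (3 * p) -> x + y <= (2 + 3 * q) * p.
      by clear => p0 xp yq; lra.
    exact: gen (ltW r00) Xb ab.
  have Hm : forall z, `|z - a| <= rh -> z != 0 /\ forall u, rh * `|u| ^+ 2 <= qf (hessmx f z M) u.
    by move=> z za; apply: Hh a1 za _; exact: le_trans Ma r0rh.
  have := grad_mono f_smooth a1 Hm (le_trans Xa r0rh) Xba.
  have Hg i : `|grad f i (X M) M - grad f i (X N) M| <= K * mt.+1%:R * `|M - N|.
    rewrite (crit M UM) (grad_shift f i (X N) N M) (crit N UN) !sub0r opprK.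
    apply: le_trans (ler_norm_sum _ _ _) _.
    apply: (@le_trans _ _ (\sum_(k < d) \sum_(l < d) `|M - N| * mt.+1%:R)).
      apply: ler_sum => k _; apply: le_trans (ler_norm_sum _ _ _) _; apply: ler_sum => l _.
      rewrite normrM; apply: ler_pM => //; last exact: Cd.
      by have := ler_entry_norm (M - N) k l; rewrite !mxE.
    under eq_bigr do rewrite sum_ord_const; rewrite sum_ord_const /K /D; apply: eqle; ring.
  move=> H; have {}H : rh * `|X M - X N| ^+ 2 <= D * (K * mt.+1%:R * `|M - N| * `|X M - X N|).
    apply: le_trans H _; apply: le_trans (ler_norm _) _; apply: le_trans (ler_norm_sum _ _ _) _.
    rewrite -sum_ord_const; apply: ler_sum => i _; rewrite normrM; apply: ler_pM => //.
    exact: ler_entry_norm.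
  have [->|n0] := eqVneq `|X M - X N| 0; first by rewrite mulr_ge0.
  have np : 0 < `|X M - X N| by rewrite lt_neqAle eq_sym n0 normr_ge0.
  have H2 : rh * `|X M - X N| <= D * (K * mt.+1%:R) * `|M - N|.
    rewrite -(ler_pM2r np); apply: le_trans (le_trans H _); apply: eqle; ring.
  by rewrite /Y mulrAC ler_pdivlMr// mulrC.
have EL M N : U M -> U N -> `|E M - E N| <= K * (2 + 4 * L) * `|M - N|.
  move=> UM UN.
  have Ub P : U P -> `|P| <= 1 + L.
    move=> UP; have [a [a1 _ Pa _ _]] := loc P UP; rewrite -[P](subrK (f a)).
    apply: le_trans (ler_normD _ _) _; apply: lerD; last exact: LB.
    by apply: le_trans Pa _; clear -r04; lra.
  have H P Q : U P -> U Q -> E Q - E P <= K * (2 + 4 * L) * `|P - Q|.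
    move=> UP UQ; apply: le_trans (Eup P Q) _; rewrite distrC; apply: ler_wpM2r => //.
    by apply: ler_wpM2l => //; move: (Ub P UP) (Ub Q UQ); move: `|P| `|Q| => p q; clear; lra.
  rewrite ler_norml; apply/andP; split; last by rewrite distrC; exact: H.
  by rewrite lerNl opprB; exact: H.
have Hpos M u : U M -> u != 0 -> 0 < qf (hessmx f (X M) M) u.
  move=> UM u0; have [a [a1 Xa Ma _ _]] := loc M UM.
  have [_ H] := Hh a (X M) M a1 (le_trans Xa r0rh) (le_trans Ma r0rh).
  by apply: lt_le_trans (H u); rewrite mulr_gt0// exprn_gt0// normr_gt0.
have XnearL M : U M -> \forall N \near M, `|X N - X M| <= Y * `|N - M|.
  move=> UM.
  have N1 : \forall N \near M, U N by exact: open_nbhs_nbhs.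
  have N2 : \forall N \near M, `|M - N| < r.
    by apply: (@cvgr_dist_lt _ _ _ (nbhs M) (nbhs_filter M) id M cvg_id).
  apply: (@filterS2 _ (nbhs M) (nbhs_filter M) _ _ _ _ N1 N2) => N UN MN.
  by apply: XL => //; rewrite distrC ltW.
have X0 M : U M -> X M != 0 by move=> _; have [/annz] := HX M.
have XC : forall k i, CkO k U (fun M => X M 0 i).
  exact: (CkO_argmin f_smooth oU X0 XnearL crit Hpos).
exists X, E, r, (Y + K * (2 + 4 * L) + 1).
have C0 : 0 <= K * (2 + 4 * L) by rewrite mulr_ge0// addr_ge0 ?mulr_ge0 ?(ltW L0).
split=> //; first by rewrite ltr_wpDl// addr_ge0.
split=> //.
- move=> k.
  have comp g : CkO k nz g -> CkO k U (fun M => g (X M)).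
    by move=> cg; apply: (@CkO_comp _ _ _ k g nz U X).
  apply: CkO_add => //; last first.
    apply: CkO_exprn => //; apply: CkO_sub2 => //; last exact: CkO_cst.
    exact: (comp (fun x => dot x x) (CkO_dot k)).
  apply: CkO_sum => // p _; apply: CkO_sum => // q _; apply: CkO_exprn => //.
  apply: CkO_sub2 => //; last exact: (comp (fun x => f x p q) (f_smooth k p q)).
  by apply: CkO_linear => [c x y|]; [rewrite !mxE|exact: coord_continuous].
- by move=> M _; have [] := HX M.
- move=> a a1.
  have Ka : annulus (1 / 2) 2 a by rewrite /annulus /= a1; apply/andP; split; lra.
  have Ea : E (f a) = 0.
    apply/eqP; rewrite eq_le E0 andbT.
    have [_ H] := HX (f a); apply: le_trans (H a Ka) _; rewrite /energy a1 subrr expr0n addr0.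
    by rewrite big1// => k _; rewrite big1// => l _; rewrite subrr expr0n.
  (* Zero energy means that [x] is a unit vector with [f x = f a], and hyperbolicity makes [f]
     injective on the sphere. *)
  split=> //; set x := X (f a).
  have F0 : 0 <= \sum_k \sum_l (f a k l - f x k l) ^+ 2.
    by apply: sumr_ge0 => k _; apply: sumr_ge0 => l _; exact: sqr_ge0.
  have S0 := sqr_ge0 (dot x x - 1).
  have ES : \sum_k \sum_l (f a k l - f x k l) ^+ 2 + (dot x x - 1) ^+ 2 = 0 := Ea.
  have x1 : dot x x = 1.
    apply/eqP; rewrite -subr_eq0 -sqrf_eq0 eq_le S0 andbT.
    by move: ES F0; move: (\sum_k _) (_ ^+ 2) => p q; clear; lra.
  have fx : f a - f x = 0.
    apply/eqP; rewrite -normr_le0 -(@ler_pXn2r _ 2)// ?nnegrE// expr0n /=.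
    apply: le_trans (sqr_norm_le_frobenius _) _.
    have -> : \sum_i \sum_j (f a - f x) i j ^+ 2 = \sum_k \sum_l (f a k l - f x k l) ^+ 2.
      by apply: eq_bigr => k _; apply: eq_bigr => l _; rewrite !mxE.
    by move: ES S0; move: (\sum_k _) (_ ^+ 2) => p q; clear; lra.
  apply/eqP/negPn/negP => xa; have [v] := secant _ _ x1 a1 xa.
  by rewrite -opprB fx oppr0 -(scale0r (0 : 'M[R]_d)) qfZ mul0r ltxx.
- move=> M N UM UN MN; have n0 := normr_ge0 (M - N).
  have q1 := mulr_ge0 Y0 n0; have q2 := mulr_ge0 C0 n0.
  have gen (x y n : R) : 0 <= x * n -> 0 <= y * n -> 0 <= n ->
      x * n <= (x + y + 1) * n /\ y * n <= (x + y + 1) * n by clear; split; lra.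
  have [g1 g2] := gen _ _ _ q1 q2 n0.
  by split; [exact: le_trans (XL M N UM UN MN) g1|exact: le_trans (EL M N UM UN) g2].
Qed.

(** * The elliptic operator *)

Section Cutoff.
Variable R : realType.
Implicit Types (p : {poly R}) (s t : R).

(** The inequality [s / n <= expR (s / n)], raised to the power [n]. *)
Lemma expr_le_expR n s : 0 <= s -> s ^+ n <= n%:R ^+ n * expR s.
Proof.
move=> s0; case: n => [|n]; first by rewrite !expr0 mul1r -expR0 ler_expR.
have n0 : 0 < n.+1%:R :> R by rewrite ltr0n.
have -> : expR s = expR (s / n.+1%:R) ^+ n.+1.
  by rewrite -expRM_natl mulrC divfK// gt_eqF.
rewrite -exprMn; apply: lerXn2r; rewrite ?nnegrE ?mulr_ge0 ?expR_ge0//.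
by rewrite -ler_pdivrMl// mulrC; apply: le_trans (expR_ge1Dx _); rewrite lerDr.
Qed.

Lemma horner_expR_bounded p : exists2 C, 0 <= C & forall s, 0 <= s -> `|p.[s]| * expR (- s) <= C.
Proof.
exists (\sum_(i < size p) `|p`_i| * i%:R ^+ i).
  by apply: sumr_ge0 => i _; rewrite mulr_ge0// exprn_ge0.
move=> s s0; rewrite expRN ler_pdivrMr ?expR_gt0// horner_coef mulr_suml.
apply: le_trans (ler_norm_sum _ _ _) _; apply: ler_sum => i _.
rewrite normrM -mulrA ler_wpM2l// normrX ger0_norm//; exact: expr_le_expR.
Qed.

(** With [p] ranging over the polynomials, these functions form a family closed under
    differentiation, by [p |-> X ^ 2 (p - p')]; smoothness at 0 then needs only first
    derivatives. *)
Definition flat p t : R := if 0 < t then p.[t^-1] * expR (- t^-1) else 0.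

Definition flat_step p := 'X^2 * (p - p^`()).

Lemma is_derive_horner p t : is_derive t 1 (fun y => p.[y]) p^`().[t].
Proof.
elim/poly_ind: p => [|p c IH].
  rewrite deriv0 horner0; have -> : (fun y : R => (0 : {poly R}).[y]) = fun=> 0.
    by apply/funext => y; rewrite horner0.
  exact: is_derive_cst.
have -> : (fun y => (p * 'X + c%:P).[y]) = (fun y => p.[y] * y + c).
  by apply/funext => y; rewrite hornerMXaddC.
have H := is_deriveD (is_deriveM IH (is_derive_id t 1)) (is_derive_cst c t 1).
apply: is_derive_eq H _; rewrite derivD derivM derivX derivC !hornerE /GRing.scale /=; ring.
Qed.

Lemma is_derive_flat p t : is_derive t 1 (flat p) (flat (flat_step p) t).
Proof.
have [t0|t0|<-] := ltrgtP 0 t.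
- have tn : t != 0 by rewrite gt_eqF.
  have D1 : is_derive t 1 (fun y : R => y^-1) (- (t^-1) ^+ 2).
    have H := @is_deriveV R id t 1 1 tn (is_derive_id _ _).
    by apply: is_derive_eq H _; rewrite /GRing.scale /= mulr1 exprVn.
  have D2 := is_derive_comp1 (is_derive_horner p t^-1) D1.
  have D3 := @is_derive_comp1 R R expR (expR (- t^-1)) (fun y => - y^-1) t 1 _
    (is_derive_expR (- t^-1)) (is_deriveN D1).
  have D4 := is_deriveM D2 D3.
  have N : \forall y \near t, ((fun y => p.[y^-1]) * (fun y => expR (- y^-1))) y = flat p y.
    have : \forall y \near t, 0 < y by exact: (open_nbhs_nbhs (conj (@open_gt R 0) t0)).
    by apply: filterS => y y0; rewrite /flat y0.
  apply: (near_eq_is_derive N).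
  apply: is_derive_eq D4 _.
  rewrite /flat t0 /flat_step !hornerE /GRing.scale /=; ring.
- have N : \forall y \near t, (0 : R) = flat p y.
    have : \forall y \near t, y < 0 by exact: (open_nbhs_nbhs (conj (@open_lt R 0) t0)).
    by apply: filterS => y y0; rewrite /flat ltNge ltW.
  rewrite {2}/flat ltNge (ltW t0) /=.
  exact: (near_eq_is_derive N (is_derive_cst 0 t 1)).
- have [C C0 HC] := horner_expR_bounded ('X^2 * p).
  rewrite {2}/flat ltxx.
  (* For positive [h] the difference quotient at 0 is [h] times the value at [h] of the bounded
     function [flat ('X^2 * p)]. *)
  have H : (fun h : R => h^-1 *: ((flat p \o shift 0) (h *: (1 : R)) - flat p 0)) @ 0^' --> (0 : R).
    apply/(@cvgrPdist_lt _ _ _ (0^') _) => e e0.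
    have C1 : 0 < C + 1 by rewrite ltr_wpDl.
    near=> h.
    have h0 : h != 0 by near: h; exact: nbhs_dnbhs_neq.
    have he : `|h| < e / (C + 1) by near: h; apply: dnbhs0_lt; rewrite divr_gt0.
    rewrite sub0r normrN /= addr0 {2}/flat ltxx subr0 /GRing.scale /= mulr1 /flat.
    case: ifP => hp; last by rewrite mulr0 normr0.
    apply: (@le_lt_trans _ _ ((C + 1) * `|h|)); last by rewrite mulrC -ltr_pdivlMr.
    have s0 : 0 < h^-1 by rewrite invr_gt0.
    have -> : `|h^-1 * (p.[h^-1] * expR (- h^-1))| = `|('X^2 * p).[h^-1]| * expR (- h^-1) * h.
      rewrite hornerM hornerXn !normrM (ger0_norm (expR_ge0 _)) (gtr0_norm s0).
      by field.
    rewrite (gtr0_norm hp); apply: ler_wpM2r; first exact: ltW.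
    by apply: le_trans (HC _ (ltW s0)) _; rewrite lerDl.
  by split; [apply/cvg_ex; exists 0|exact/cvg_lim].
Unshelve. all: by end_near. Qed.

Lemma CkO_flat (V : normedModType R) k (A : set V) (f : V -> R) p : open A ->
  CkO k A f -> CkO k A (fun x => flat p (f x)).
Proof.
move=> oA cf.
apply: (@CkO_comp1 R V (fun j => flat (iter j flat_step p)) setT _ k 0%N A f) => //.
by move=> j t _; rewrite iterS; exact: is_derive_flat.
Qed.

Definition cutoff t := flat 1 t.

Lemma cutoff_ge0 t : 0 <= cutoff t.
Proof. by rewrite /cutoff /flat; case: ifP => // _; rewrite hornerE mul1r expR_ge0. Qed.

Lemma cutoff_le1 t : cutoff t <= 1.
Proof.
rewrite /cutoff /flat; case: ifP => // t0; rewrite hornerE mul1r -expR0 ler_expR oppr_le0.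
by rewrite invr_ge0 ltW.
Qed.

Lemma cutoff1_gt0 : 0 < cutoff 1.
Proof. by rewrite /cutoff /flat ltr01 hornerE mul1r expR_gt0. Qed.

Lemma cutoff_eq0 t : t <= 0 -> cutoff t = 0.
Proof. by rewrite /cutoff /flat ltNge => ->. Qed.

Lemma cutoff_lipschitz : exists2 C, 0 <= C & forall s t, `|cutoff s - cutoff t| <= C * `|s - t|.
Proof.
have [C C0 HC] := horner_expR_bounded (flat_step 1).
exists C => // s t.
have dB y : is_derive y (s - t) cutoff ((s - t) * flat (flat_step 1) y).
  have := is_derive_scale (s - t) (is_derive_flat 1 y).
  by rewrite /GRing.scale /= mulr1.
have [|c _] := @MVT_line R R cutoff t (s - t).
  by move=> y _; have [] := dB (t + y *: (s - t)).
have [_ ->] := dB (t + c *: (s - t)).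
have -> : t + (s - t) = s by ring.
move=> ->; rewrite normrM mulrC; apply: ler_wpM2r => //.
rewrite /flat; case: ifP => [y0|_]; last by rewrite normr0.
by rewrite normrM (ger0_norm (expR_ge0 _)); apply: HC; rewrite invr_ge0 ltW.
Qed.

End Cutoff.

Lemma derive_norm_le (R : realType) (V : normedModType R) (phi : V -> R) (x v : V) (c : R) :
  derivable phi x v -> (\forall y \near x, `|phi y - phi x| <= c * `|y - x|) ->
  `|'D_v phi x| <= c * `|v|.
Proof.
move=> dphi H; pose F := (0 : R)^'.
have FF : ProperFilter F by typeclasses eauto.
have F0 : Filter F by exact: dnbhs_filter.
have cl : (fun h : R => h^-1 *: ((phi \o shift x) (h *: v) - phi x)) @ F --> 'D_v phi x := dphi.
have c1 : (fun h : R => h *: v + x) @ F --> x.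
  have c0 : (fun h : R => h *: v + x) @ nbhs (0 : R) --> 0 *: v + x.
    by apply: cvgD; [apply: cvgZr_tmp; exact: cvg_id|exact: cvg_cst].
  rewrite scale0r add0r in c0.
  by apply: cvg_trans c0; apply: (@cvg_app _ _ _ _ (fun h : R => h *: v + x)); exact: (@nbhs_dnbhs _ (0 : R)).
have N1 : \forall h \near F, h != 0 by exact: nbhs_dnbhs_neq.
have N2 : \forall h \near F, `|phi (h *: v + x) - phi x| <= c * `|h *: v + x - x| := c1 _ H.
have cn : `|h^-1 *: ((phi \o shift x) (h *: v) - phi x)| @[h --> F] --> `|'D_v phi x| := cvg_norm cl.
have N3 : \forall h \near F, `|h^-1 *: ((phi \o shift x) (h *: v) - phi x)| <= c * `|v|.
  apply: (@filterS2 _ F _ _ _ _ _ N1 N2) => h h0; rewrite addrK normrZ => h1.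
  by rewrite normrZ normfV ler_pdivrMl ?normr_gt0// mulrCA.
rewrite leNgt; apply/negP => lt.
have N4 := @cvgr_gt _ _ F F0 _ _ (cn F0) _ lt.
by have [h [h3 /lt_geF]] := @filter_ex _ F _ _ (filterI N3 N4); rewrite h3.
Qed.

Lemma CkO_comp_linear (R : realType) (V W : normedModType R) k (phi : V -> R) (L : W -> V) :
  (forall a x y, L (a *: x + y) = a *: L x + L y) -> continuous L ->
  CkO k setT phi -> CkO k setT (fun x => phi (L x)).
Proof.
move=> Ll Lc; elim: k phi => [|k IH] phi cphi.
  by split=> // x _; apply: (@continuous_comp _ _ _ L phi); [exact: Lc|exact: CkO_cont cphi I].
apply: CkO_succ; first exact: openT.
  by move=> x _; apply: (@continuous_comp _ _ _ L phi); [exact: Lc|exact: CkO_cont cphi I].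
move=> v; exists (fun x => 'D_(L v) phi (L x)); split; last first.
  by apply: (IH ('D_(L v) phi)); exact: CkO_derive.
move=> x _.
have E : (fun h : R => h^-1 *: (((fun y => phi (L y)) \o shift x) (h *: v) - phi (L x))) =
   (fun h : R => h^-1 *: ((phi \o shift (L x)) (h *: L v) - phi (L x))).
  by apply/funext => h; rewrite /= Ll.
have dphi : derivable phi (L x) (L v) by exact: CkO_derivable cphi I.
by split; [rewrite /derivable E|rewrite /derive E].
Qed.

(** The chain rule is available for row vectors; [mxvec] carries it over to matrices. *)
Lemma CkO_comp_mx (R : realType) (V : normedModType R) k d (G : 'M[R]_d -> R) (A : set V)
    (N : V -> 'M[R]_d) :
  open A -> CkO k setT G -> (forall i j, CkO k A (fun x => N x i j)) -> CkO k A (fun x => G (N x)).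
Proof.
move=> oA cG cN.
have H : CkO k A (fun x => (fun v => G (vec_mx v)) (mxvec (N x))).
  apply: (@CkO_comp _ _ _ k (fun v => G (vec_mx v)) setT A (fun x => mxvec (N x))) => //.
  + exact: openT.
  + apply: (@CkO_comp_linear _ _ _ k G (fun v => vec_mx v)) => // [a x y|v].
      by rewrite linearP.
    apply: (@cvg_mx _ _ (nbhs v) (nbhs_filter v)) => i j.
    have -> : (fun y : 'rV[R]_(d * d) => vec_mx y i j) = (fun y => y 0 (mxvec_index i j)).
      by apply/funext => y; rewrite mxE.
    by rewrite mxE; exact: coord_continuous.
  + move=> l; case/mxvec_indexP: l => i j.
    by apply: CkO_ext (cN i j) => // x _; rewrite mxvecE.
by apply: CkO_ext H => // x _; rewrite mxvecK.
Qed.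

(* An approximate operator [G] is of size [rho ^ 2] on the range of [f] and of slope [rho] along it.
   Subtracting a cutoff of [G] composed with the retraction makes it vanish there and, for small
   [rho], costs only part of the ellipticity constant. *)
Lemma exists_elliptic_operator (R : realType) (d : nat) (f : 'rV[R]_d -> 'M[R]_d) :
  (forall k i j, CkO k [set x : 'rV[R]_d | x != 0] (fun x : 'rV[R]_d => f x i j)) ->
  (forall (t : R) (x : 'rV[R]_d), 0 < t -> x != 0 -> f (t *: x) = f x) ->
  (forall x : 'rV[R]_d, x != 0 -> f (- x) = - f x) ->
  (forall a b : 'rV[R]_d, dot a a = 1 -> dot b b = 1 -> a != b ->
    exists v : 'rV[R]_d, 0 < qf (f a - f b) v) ->
  (forall a tau : 'rV[R]_d, dot a a = 1 -> dot tau tau = 1 -> dot a tau = 0 ->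
    exists v : 'rV[R]_d, 0 < qf (Df f a tau) v) ->
  (exists a : 'rV[R]_d, dot a a = 1) ->
  exists F : 'M[R]_d -> R,
  [/\ forall k, CkO k setT F, uniformly_elliptic F, F 0 = 0 & forall x, x != 0 -> F (f x) = 0].
Proof.
move=> f_smooth f_homog f_odd secant tangent sphere_nonempty.
have onz : open [set x : 'rV[R]_d | x != 0] := @open_nz R d.
have [C1 [r1 [C10 r10 HG]]] := exists_approximate f_smooth f_homog secant tangent sphere_nonempty.
have [X [E [r [C2 [r0 C20 Ec E0 [XC EC XA Xf XL]]]]]] :=
  exists_retraction f_smooth f_homog secant tangent sphere_nonempty.
set U := [set M | E M < r] in XC EC XA XL.
have oU : open U.
  have -> : U = E @^-1` [set x | x < r] by [].
  by apply: open_comp => [M _|]; [exact: Ec|exact: open_lt].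
have [LB LB0 HLB] := cutoff_lipschitz R.
pose b1 := cutoff (1 : R); have b10 : 0 < b1 := cutoff1_gt0 R.
pose s := r / 2; have s0 : 0 < s by rewrite divr_gt0.
have sr : s < r by rewrite /s; move: r0; clear; lra.
(* Equal to 1 where [E M = 0] and to 0 where [E M >= s]. Since [s < r], the open sets [E < r] and
   [E > s] cover all matrices. *)
pose kap M := cutoff (1 - E M / s) / b1.
have kap0 M : 0 <= kap M by rewrite mulr_ge0 ?cutoff_ge0// invr_ge0 ltW.
have kap1 M : kap M <= b1^-1 by rewrite ler_piMl ?cutoff_le1// invr_ge0 ltW.
(* The first product is the variation of the cutoff times the size of [G] on the range, the second
   the bound of the cutoff times the variation of [G (f (X M))]; the 1 makes [C3] positive. *)
pose C3 := LB / s / b1 * C2 * C1 + b1^-1 * C1 * C2 + 1.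
have C30 : 0 < C3 by rewrite ltr_wpDl// addr_ge0// !mulr_ge0 ?invr_ge0// ltW.
(* [G] has ellipticity constant 1, of which the correction may consume one half:
   [C3 * rho <= 1 / 2]. *)
pose rho := Num.min r1 (Num.min 1 (1 / (2 * C3))).
have rho0 : 0 < rho by rewrite !lt_min r10 ltr01/= divr_gt0// mulr_gt0.
have rho1 : rho <= 1 by rewrite !ge_min lexx orbT.
have rhor : rho <= r1 by rewrite !ge_min lexx.
have rhoC : C3 * rho <= 1 / 2.
  have : rho <= 1 / (2 * C3) by rewrite !ge_min lexx !orbT.
  rewrite ler_pdivlMr ?mulr_gt0// => H; move: H; clear; lra.
have [G [GC Gell GL Gf2 Gf1]] := HG rho rho0 rhor.
(* [X] is not controlled outside [U], which is harmless as the cutoff vanishes there. *)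
pose zeta M := kap M * G (f (X M)).
have X0 M : U M -> X M != 0.
  move=> /XA /= /andP[x1 _]; rewrite -dot_eq0 gt_eqF//.
  by apply: lt_le_trans x1; rewrite divr_gt0.
have zout M : s <= E M -> zeta M = 0.
  move=> sE; rewrite /zeta /kap cutoff_eq0 ?mul0r//.
  by rewrite subr_le0 ler_pdivlMr// mul1r.
have kapL M N : `|kap M - kap N| <= LB / s / b1 * `|E M - E N|.
  rewrite /kap -mulrBl normrM [`|b1^-1|]ger0_norm ?invr_ge0 ?(ltW b10)//.
  rewrite [leRHS]mulrAC; apply: ler_wpM2r; first by rewrite invr_ge0 ltW.
  apply: le_trans (HLB _ _) _; rewrite -mulrA ler_wpM2l//.
  have -> : 1 - E M / s - (1 - E N / s) = - ((E M - E N) / s) by ring.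
  by rewrite normrN normrM normfV (ger0_norm (ltW s0)) mulrC.
pose W := [set M | s < E M].
have oW : open W.
  have -> : W = E @^-1` [set x | s < x] by [].
  by apply: open_comp => [M _|]; [exact: Ec|exact: open_gt].
have cover M : U M \/ W M.
  have [EM|EM] := ltP (E M) r; [by left|right].
  by rewrite /W /=; exact: lt_le_trans sr EM.
have zetaU k : CkO k U zeta.
  apply: CkO_mul => //.
    apply: (@CkO_ext _ _ k U (fun M => b1^-1 * cutoff (1 - s^-1 * E M))) => //.
      by move=> M _; rewrite /kap mulrC [s^-1 * _]mulrC.
    apply: CkO_scale => //; apply: CkO_flat => //.
    by apply: CkO_sub2 => //; [exact: CkO_cst|apply: CkO_scale].
  have GK : CkO k [set x : 'rV[R]_d | x != 0] (fun x => G (f x)).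
    exact: CkO_comp_mx.
  exact: (@CkO_comp _ _ _ k (fun x => G (f x)) [set x : 'rV[R]_d | x != 0] U X).
have zetaC k : CkO k setT zeta.
  apply: CkO_local => M _; have [UM|WM] := cover M; first by exists U.
  exists W; split=> //; apply: CkO_ext (@CkO_cst _ _ k W 0) => // N WN.
  by rewrite zout// ltW.
have zetaD M P : `|'D_P zeta M| <= C3 * rho * `|P|.
  apply: derive_norm_le; first exact: CkO_derivable (zetaC 1) I.
  have [UM|WM] := cover M; last first.
    have : \forall N \near M, W N by exact: (open_nbhs_nbhs (conj oW WM)).
    apply: filterS => N WN; rewrite !zout ?subrr ?normr0//; try exact: ltW.
    by rewrite mulr_ge0// mulr_ge0// ltW.
  have N1 : \forall N \near M, U N by exact: (open_nbhs_nbhs (conj oU UM)).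
  have N2 : \forall N \near M, `|M - N| < Num.min r (rho / C2).
    by apply: (@cvgr_dist_lt _ _ _ (nbhs M) (nbhs_filter M) id M cvg_id); rewrite lt_min r0 divr_gt0.
  apply: (@filterS2 _ (nbhs M) (nbhs_filter M) _ _ _ _ N1 N2) => N UN.
  rewrite distrC lt_min => /andP[MNr MNC].
  have [XX EE] := XL N M UN UM (ltW MNr).
  set n := `|N - M| in MNr MNC XX EE *.
  have n0 : 0 <= n by exact: normr_ge0.
  have XXr : `|X N - X M| <= rho.
    by apply: le_trans XX _; rewrite mulrC -ler_pdivlMr// ltW.
  have -> : zeta N - zeta M = (kap N - kap M) * G (f (X N)) + kap M * (G (f (X N)) - G (f (X M))).
    by rewrite /zeta; ring.
  apply: le_trans (ler_normD _ _) _; rewrite [`|(kap N - _) * _|]normrM [`|kap M * _|]normrM (ger0_norm (kap0 M)).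
  have A1 : `|kap N - kap M| <= LB / s / b1 * C2 * n.
    apply: le_trans (kapL N M) _; rewrite -[leRHS]mulrA ler_wpM2l// !mulr_ge0 ?invr_ge0// ltW//.
  have A2 : `|G (f (X N))| <= C1 * rho.
    apply: le_trans (Gf2 _ (X0 _ UN)) _; rewrite ler_wpM2l ?(ltW C10)//.
    by rewrite expr2 ler_piMl// ltW.
  have A3 : `|G (f (X N)) - G (f (X M))| <= C1 * rho * (C2 * n).
    apply: le_trans (Gf1 _ _ (XA _ UN) (XA _ UM) XXr) _; rewrite ler_wpM2l//.
    by rewrite mulr_ge0// ltW.
  have A4 := ler_pM (normr_ge0 _) (normr_ge0 _) A1 A2.
  have A5 := ler_pM (kap0 M) (normr_ge0 _) (kap1 M) A3.
  apply: le_trans (lerD A4 A5) _.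
  have -> : C3 * rho * n = LB / s / b1 * C2 * n * (C1 * rho) + b1^-1 * (C1 * rho * (C2 * n)) + rho * n.
    by rewrite /C3; ring.
  by rewrite lerDl mulr_ge0// ltW.
have zetaL M N : `|zeta (M + N) - zeta M| <= 1 / 2 * `|N|.
  have [|c _ ->] := @MVT_line R _ zeta M N.
    by move=> t _; exact: CkO_derivable (zetaC 1) I.
  by apply: le_trans (zetaD _ _) _; apply: ler_wpM2r.
pose F M := G M - zeta M.
have FC k : CkO k setT F by apply: CkO_sub2 => //; exact: openT.
have Fell N P : nonneg_def P -> 1 / 2 * `|P| <= F (N + P) - F N <= (C1 + 1 / 2) * `|P|.
  move=> hP; have H1 := Gell N P hP; have H2 := GL (N + P) N; have H3 := zetaL N P.
  have -> : F (N + P) - F N = (G (N + P) - G N) - (zeta (N + P) - zeta N) by rewrite /F; ring.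
  have e : N + P - N = P by rewrite addrC addKr.
  rewrite e in H2.
  have H4 := le_trans (ler_norm _) H2.
  move: H3; rewrite ler_norml => /andP[H5 H6].
  move: H1 H4 H5 H6; move: (G _ - G _) (zeta _ - zeta _) `|P| => p q n; clear => H1 H4 H5 H6.
  by apply/andP; split; lra.
have Ff x : x != 0 -> F (f x) = 0.
  move=> x0; have [a a1 ->] := normalize_sphere f_homog x0.
  have [Ea Xa] := Xf a a1.
  by rewrite /F /zeta /kap Ea Xa mul0r subr0 divff ?mul1r ?subrr// gt_eqF.
(* [M |-> - F (- M)] is elliptic as well and the range of [f] is symmetric, so the odd part keeps
   both properties. *)
exists (fun M => (F M - F (- M)) / 2); split.
- move=> k; apply: (@CkO_ext _ _ k setT (fun M => 2^-1 * (F M - F (- M)))); first exact: openT.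
    by move=> M _; rewrite mulrC.
  apply: CkO_scale; first exact: openT.
  apply: CkO_sub2 => //; first exact: openT.
  apply: (@CkO_ext _ _ k setT (fun M => F (0 + (-1) *: (M - 0)))); first exact: openT.
    by move=> M _; rewrite subr0 add0r scaleN1r.
  exact: CkO_affine.
- exists (2 + C1); split; first by move: C10; clear; lra.
  move=> M N _ hN; have /andP[H1 H2] := Fell M N hN; have /andP[H3 H4] := Fell (- M - N) N hN.
  have e : - M - N + N = - M by rewrite subrK.
  have e2 : - M - N = - (M + N) by rewrite opprD.
  rewrite e e2 in H3 H4.
  have C2i : (2 + C1)^-1 <= 1 / 2.
    by rewrite mul1r lef_pV2 ?posrE//; move: C10; clear; lra.
  have Hn : (2 + C1)^-1 * `|N| <= 1 / 2 * `|N| by apply: ler_wpM2r.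
  have Hn2 : (C1 + 1 / 2) * `|N| <= (2 + C1) * `|N|.
    by apply: ler_wpM2r => //; clear; lra.
  have gen (p q u v l m : R) : l <= p - q -> l <= v - u -> p - q <= m -> v - u <= m ->
      l <= (p - u) / 2 - (q - v) / 2 <= m.
    by clear => h1 h2 h3 h4; apply/andP; split; lra.
  have /andP[G1 G2] := gen _ _ _ _ _ _ H1 H3 H2 H4.
  by apply/andP; split; [exact: le_trans Hn G1|exact: le_trans G2 Hn2].
- by rewrite oppr0 subrr mul0r.
- move=> x x0; rewrite -f_odd// !Ff// ?oppr_eq0//.
  by rewrite subrr mul0r.
Qed.

(** * The Hessian of a cubic form divided by the norm *)

(** For a function polynomial along lines the derivative is the coefficient of [h]; multilinear
    expressions can thus be differentiated by expansion. *)
Lemma is_derive_cubic (R : realType) (V : normedModType R) (phi : V -> R) x v (a b c : R) :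
  (forall h : R, phi (h *: v + x) = phi x + h * a + h ^+ 2 * b + h ^+ 3 * c) ->
  is_derive x v phi a.
Proof.
move=> E; pose F := (0 : R)^'.
have H : (fun h : R => h^-1 *: ((phi \o shift x) (h *: v) - phi x)) @ F --> a.
  have c1 : (fun h : R => a + h * b + h * (h * c)) @ F --> a + 0 * b + 0 * (0 * c).
    have c0 : (fun h : R => h) @ F --> (0 : R) by exact: (@nbhs_dnbhs _ (0 : R)).
    apply: cvgD; first by apply: cvgD; [exact: cvg_cst|apply: cvgM => //; exact: cvg_cst].
    by apply: cvgM => //; apply: cvgM => //; exact: cvg_cst.
  rewrite !mul0r !addr0 in c1.
  apply: cvg_trans c1; apply: near_eq_cvg; near=> h.
  have h0 : h != 0 by near: h; exact: nbhs_dnbhs_neq.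
  by rewrite /= E /GRing.scale /=; field.
by split; [apply/cvg_ex; exists a|exact/cvg_lim].
Unshelve. all: by end_near. Qed.

Section CubicOverNorm.
Variables (R : realType) (d : nat) (T : 'rV[R]_d -> 'rV[R]_d -> 'rV[R]_d -> R).
Implicit Types (x y z u v a b tau : 'rV[R]_d) (h : R).
Hypothesis Tlin : forall h x y u v, T (h *: x + y) u v = h * T x u v + T y u v.
Hypothesis TC12 : forall x y z, T x y z = T y x z.
Hypothesis TC23 : forall x y z, T x y z = T x z y.
Hypothesis Tsmooth : forall k, CkO k setT (fun x => T x x x).

Local Notation nz := [set x : 'rV[R]_d | x != 0].
Local Notation e_ k := (delta_mx 0 k : 'rV[R]_d).

Definition inv_norm x : R := (Num.sqrt (dot x x))^-1.
(** [T] is the complete polarization of the cubic form, whence the division by 6. At 0 the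
    convention [0^-1 = 0] gives the value 0. *)
Definition cubic_over_norm x : R := T x x x / 6 * inv_norm x.
Local Notation rho := inv_norm.
Local Notation W := cubic_over_norm.

Let onz : open nz := @open_nz R d.

Let dotp x : x != 0 -> 0 < dot x x.
Proof. by move=> x0; rewrite lt_neqAle dot_ge0 eq_sym dot_eq0 x0. Qed.

Lemma CkO_inv_norm k : CkO k nz rho.
Proof.
apply: CkO_inv => //; first by move=> x x0; rewrite gt_eqF// sqrtr_gt0; exact: dotp.
apply: CkO_sqrt => //.
by apply: CkO_sum => // i _; apply: CkO_mul => //;
  (apply: CkO_linear => [c x y|]; [rewrite !mxE|exact: coord_continuous]).
Qed.

Lemma CkO_cubic_over_norm k : CkO k nz W.
Proof.
apply: CkO_mul => //; last exact: CkO_inv_norm.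
apply: (@CkO_sub _ _ k setT) => //.
apply: (@CkO_ext _ _ k setT (fun x => 6^-1 * T x x x)); first exact: openT.
  by move=> x _; rewrite mulrC.
by apply: CkO_scale; [exact: openT|].
Qed.

Lemma inv_normZ (h : R) x : 0 < h -> rho (h *: x) = h^-1 * rho x.
Proof.
move=> h0; rewrite /inv_norm dotZl dotZr mulrA -expr2 sqrtrM ?sqr_ge0//.
by rewrite sqrtr_sqr gtr0_norm// invfM.
Qed.

Lemma inv_normN x : rho (- x) = rho x.
Proof. by rewrite /inv_norm dotNl dotNr opprK. Qed.

Lemma is_derive_inv_norm x v : x != 0 -> is_derive x v rho (- (dot x v * rho x ^+ 3)).
Proof.
move=> x0; have p := dotp x0.
have D1 : is_derive x v (fun y => dot y y) (2 * dot x v).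
  apply: (@is_derive_cubic _ _ _ _ _ _ (dot v v) 0) => h.
  by rewrite !(dotDl, dotDr, dotZl, dotZr) (dotC v x); ring.
have D2 : is_derive (dot x x) 1 Num.sqrt (2 * Num.sqrt (dot x x))^-1 := is_derive1_sqrt p.
have s0 : Num.sqrt (dot x x) != 0 by rewrite gt_eqF// sqrtr_gt0.
have D3 := is_deriveV s0 D2.
have D4 := @is_derive_comp1 R _ (fun t => (Num.sqrt t)^-1) _ (fun y => dot y y) x v _ D3 D1.
by apply: is_derive_eq D4 _; rewrite /inv_norm /GRing.scale /=; field.
Qed.

Let TlinD x y u v : T (x + y) u v = T x u v + T y u v.
Proof. by rewrite -{1}(scale1r x) Tlin mul1r. Qed.
Let TlinZ h x u v : T (h *: x) u v = h * T x u v.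
Proof.
have T0 : T 0 u v = 0.
  by have := TlinD 0 0 u v; rewrite addr0 => /eqP; rewrite eq_sym addrC -subr_eq0 addrK => /eqP.
by rewrite -[h *: x]addr0 Tlin T0 addr0.
Qed.
Let TlinD2 x y u v : T u (x + y) v = T u x v + T u y v.
Proof. by rewrite TC12 TlinD TC12 [T y _ _]TC12. Qed.
Let TlinZ2 h x u v : T u (h *: x) v = h * T u x v.
Proof. by rewrite TC12 TlinZ TC12. Qed.
Let TlinD3 x y u v : T u v (x + y) = T u v x + T u v y.
Proof. by rewrite TC23 TlinD2 TC23 [T u y v]TC23. Qed.
Let TlinZ3 h x u v : T u v (h *: x) = h * T u v x.
Proof. by rewrite TC23 TlinZ2 TC23. Qed.
Let Tlins := (TlinD, TlinD2, TlinD3, TlinZ, TlinZ2, TlinZ3).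

Let dT3 x v : is_derive x v (fun y => T y y y) (3 * T x x v).
Proof.
apply: (@is_derive_cubic _ _ _ _ _ _ (3 * T x v v) (T v v v)) => h.
rewrite !Tlins [T v x x]TC12 [T x v x]TC23 [T v v x]TC23 [T v x v]TC12; ring.
Qed.

Let dT2 x u v : is_derive x v (fun y => T y y u) (2 * T x u v).
Proof.
apply: (@is_derive_cubic _ _ _ _ _ _ (T v v u) 0) => h.
rewrite !Tlins [T v x u]TC12 [T x v u]TC23; ring.
Qed.

Let dT1 x u w v : is_derive x v (fun y => T y u w) (T v u w).
Proof. by apply: (@is_derive_cubic _ _ _ _ _ _ 0 0) => h; rewrite !Tlins; ring. Qed.

Let dD1 x u v : is_derive x v (fun y => dot y u) (dot v u).
Proof. by apply: (@is_derive_cubic _ _ _ _ _ _ 0 0) => h; rewrite dotDl dotZl; ring. Qed.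

Let dX (n : nat) x v (g : 'rV[R]_d -> R) dg : is_derive x v g dg ->
  is_derive x v (fun y => g y ^+ n.+1) (n.+1%:R * g x ^+ n * dg).
Proof.
move=> dgP; elim: n => [|n IH].
  by apply: is_derive_eq dgP _; rewrite expr0; ring.
have -> : (fun y => g y ^+ n.+2) = (fun y => g y) * (fun y => g y ^+ n.+1).
  by apply/funext => y; rewrite exprS.
have H := is_deriveM dgP IH.
by apply: is_derive_eq H _; rewrite /GRing.scale /= -(natr1 n.+1) exprS; ring.
Qed.

Definition dW u x : R := T x x u / 2 * rho x - T x x x / 6 * dot x u * rho x ^+ 3.

Lemma is_derive_cubic_over_norm x u : x != 0 -> is_derive x u W (dW u x).
Proof.
move=> x0.
have H : is_derive x u W _ :=
  is_deriveM (is_deriveM (dT3 x u) (is_derive_cst (6^-1 : R) x u)) (is_derive_inv_norm u x0).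
by apply: is_derive_eq H _; rewrite /dW /GRing.scale /= ?fctE /=; by field.
Qed.

(** Sorted by powers of [rho]: for [x] orthogonal to [u] and [v] only the first and the third terms
    remain. *)
Definition ddW u v x : R := T x u v * rho x
  - (T x x u * dot x v + T x x v * dot x u) / 2 * rho x ^+ 3
  - T x x x / 6 * dot u v * rho x ^+ 3 + T x x x / 2 * (dot x u * dot x v) * rho x ^+ 5.

Lemma derive2_cubic_over_norm x u v : x != 0 -> 'D_v ('D_u W) x = ddW u v x.
Proof.
move=> x0.
have E : 'D_v ('D_u W) x = 'D_v (dW u) x.
  apply: near_eq_derive.
  have : \forall y \near x, y != 0 by exact: (open_nbhs_nbhs (conj onz x0)).
  by apply: filterS => y y0; have [_ ->] := is_derive_cubic_over_norm u y0.
have H1 := is_deriveM (is_deriveM (dT2 x u v) (is_derive_cst (2^-1 : R) x v)) (is_derive_inv_norm v x0).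
have H2 := is_deriveM (is_deriveM (is_deriveM (dT3 x v) (is_derive_cst (6^-1 : R) x v)) (dD1 x u v))
  (dX 2 (is_derive_inv_norm v x0)).
have H := is_deriveB H1 H2.
rewrite E; have [_ ->] := H; rewrite /ddW /GRing.scale /= ?fctE /= (dotC v u); by field.
Qed.

Lemma hessianE x : x != 0 -> forall i j, hessian W x i j = ddW (e_ j) (e_ i) x.
Proof. by move=> x0 i j; rewrite mxE derive2_cubic_over_norm. Qed.

Lemma CkO_hessian k i j : CkO k nz (fun x => hessian W x i j).
Proof.
apply: (@CkO_ext _ _ k nz ('D_(e_ i) ('D_(e_ j) W))) => // [x _|]; first by rewrite mxE.
by apply: CkO_derive; apply: CkO_derive; exact: CkO_cubic_over_norm.
Qed.

Lemma hessian_homog h x : 0 < h -> x != 0 -> hessian W (h *: x) = hessian W x.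
Proof.
move=> h0 x0; apply/matrixP => i j.
have hn : h != 0 by rewrite gt_eqF.
have hx : h *: x != 0 by rewrite scaler_eq0 negb_or hn.
apply: (etrans (hessianE hx i j)); apply: (etrans _ (esym (hessianE x0 i j))).
by rewrite /ddW inv_normZ// !Tlins !dotZl; field.
Qed.

Lemma hessian_odd x : x != 0 -> hessian W (- x) = - hessian W x.
Proof.
move=> x0; have xn : - x != 0 by rewrite oppr_eq0.
apply/matrixP => i j; rewrite [RHS]mxE; apply: (etrans (hessianE xn i j)).
apply: (etrans _ (congr1 -%R (esym (hessianE x0 i j)))); rewrite /ddW inv_normN.
by rewrite -scaleN1r !Tlins !dotZl; by field.
Qed.

Lemma qf_hessian x v : x != 0 -> qf (hessian W x) v = ddW v v x.
Proof.
move=> x0; rewrite -derive2_cubic_over_norm//.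
rewrite (derive2_rowE v v onz x0 (CkO_cubic_over_norm 2)).
by apply: eq_bigr => i _; apply: eq_bigr => j _; rewrite mxE mulrC mulrA.
Qed.

Lemma qf_hessian_sphere a v : dot a a = 1 -> dot a v = 0 ->
  qf (hessian W a) v = T a v v - T a a a / 6 * dot v v.
Proof.
move=> a1 av; rewrite qf_hessian ?sphere_neq0// /ddW av /inv_norm a1 sqrtr1 invr1; ring.
Qed.

(** A factor [dot a v] that is not differentiated kills its term, and the derivative of [inv_norm]
    at [a] along [tau] is 0. *)
Lemma qf_derive_hessian a tau v : dot a a = 1 -> dot a tau = 0 -> dot a v = 0 ->
  qf (Df (hessian W) a tau) v =
  T tau v v - T a a v * dot tau v - T a a tau / 2 * dot v v.
Proof.
move=> a1 at0 av; have a0 := sphere_neq0 a1.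
have -> : qf (Df (hessian W) a tau) v = 'D_tau (ddW v v) a.
  have H1 i j : is_derive a tau (fun x => hessian W x i j * (v 0 i * v 0 j))
      ('D_tau (fun x => hessian W x i j) a * (v 0 i * v 0 j)).
    have D : is_derive a tau (fun x => hessian W x i j) ('D_tau (fun x => hessian W x i j) a).
      by apply: derivableP; exact: CkO_derivable (CkO_hessian 1 i j) a0.
    have H := is_deriveM D (is_derive_cst (v 0 i * v 0 j) a tau).
    by apply: is_derive_eq H _; rewrite /GRing.scale /= ?fctE /=; ring.
  have H2 i := is_derive_sumr (index_enum 'I_d) (H1 i).
  have H3 := is_derive_sumr (index_enum 'I_d) H2.
  transitivity ('D_tau (fun x => qf (hessian W x) v) a).
    have [_ ->] := H3; rewrite /qf; apply: eq_bigr => i _; apply: eq_bigr => j _.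
    by rewrite mxE.
  apply: near_eq_derive.
  have : \forall y \near a, y != 0 by exact: (open_nbhs_nbhs (conj onz a0)).
  by apply: filterS => y y0; rewrite qf_hessian.
have dr := is_derive_inv_norm tau a0.
have H1 := is_deriveM (dT1 a v v tau) dr.
have H2 := is_deriveM (is_deriveM (is_deriveD (is_deriveM (dT2 a v tau) (dD1 a v tau))
   (is_deriveM (dT2 a v tau) (dD1 a v tau))) (is_derive_cst (2^-1 : R) a tau)) (dX 2 dr).
have H3 := is_deriveM (is_deriveM (is_deriveM (dT3 a tau) (is_derive_cst (6^-1 : R) a tau))
   (is_derive_cst (dot v v : R) a tau)) (dX 2 dr).
have H4 := is_deriveM (is_deriveM (is_deriveM (dT3 a tau) (is_derive_cst (2^-1 : R) a tau))
   (is_deriveM (dD1 a v tau) (dD1 a v tau))) (dX 4 dr).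
have H := is_deriveD (is_deriveB (is_deriveB H1 H2) H3) H4.
have [_ ->] := H.
rewrite /GRing.scale /= ?fctE /= !av !at0 /inv_norm a1 sqrtr1 invr1; by field.
Qed.

End CubicOverNorm.

(** * Quaternions *)

Section Quaternion.
Variable R : realType.
Implicit Types (p q r : quaternion R) (x y z s u v : 'rV[R]_12) (h : R).

Definition qconj p := Quaternion (q0 p) (- q1 p) (- q2 p) (- q3 p).
Definition qscale h p := Quaternion (h * q0 p) (h * q1 p) (h * q2 p) (h * q3 p).
Definition qadd p q := Quaternion (q0 p + q0 q) (q1 p + q1 q) (q2 p + q2 q) (q3 p + q3 q).
Definition qdot p q := q0 p * q0 q + q1 p * q1 q + q2 p * q2 q + q3 p * q3 q.
Definition triple p q r := qRe (qmul (qmul p q) r).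

Lemma qmulA p q r : qmul p (qmul q r) = qmul (qmul p q) r.
Proof. by case: p q r => ? ? ? ? [? ? ? ?] [? ? ? ?]; rewrite /qmul /=; congr Quaternion; ring. Qed.

Lemma triple_cycle p q r : triple p q r = triple q r p.
Proof. by rewrite /triple /qRe /=; ring. Qed.

Lemma triple_scale1 h p q r : triple (qscale h p) q r = h * triple p q r.
Proof. by rewrite /triple /qRe /=; ring. Qed.

Lemma triple_scale2 h p q r : triple p (qscale h q) r = h * triple p q r.
Proof. by rewrite /triple /qRe /=; ring. Qed.

Lemma triple_scale3 h p q r : triple p q (qscale h r) = h * triple p q r.
Proof. by rewrite /triple /qRe /=; ring. Qed.

Lemma triple_qdot p q r : triple p q r = qdot p (qconj (qmul q r)).
Proof. by rewrite /triple /qdot /qRe /=; ring. Qed.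

Lemma qdotM p q : qdot (qmul p q) (qmul p q) = qdot p p * qdot q q.
Proof. by rewrite /qdot /=; ring. Qed.

Lemma qdot_conj p : qdot (qconj p) (qconj p) = qdot p p.
Proof. by rewrite /qdot /=; ring. Qed.

Lemma qdot_conjr p q : qdot p (qconj q) = qRe (qmul p q).
Proof. by rewrite /qdot /qRe /=; ring. Qed.

Lemma qdot_ge0 p : 0 <= qdot p p.
Proof. by rewrite /qdot -!expr2 !addr_ge0// sqr_ge0. Qed.

(** Multiplying [p q + conj q conj p = 2 Re (p q)] by [p] on the right gives
    [p q p = 2 Re (p q) p - |p| ^ 2 conj q]. *)
Lemma qmul_sandwich p q : qRe (qmul p q) = 0 ->
  qmul (qmul p q) p = qscale (- qdot p p) (qconj q).
Proof.
move=> H; have E : qmul (qmul p q) p =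
    qadd (qscale (2 * qRe (qmul p q)) p) (qscale (- qdot p p) (qconj q)).
  by rewrite /qadd /qscale /qmul /qdot /qRe /=; congr Quaternion; ring.
by rewrite E H /qadd /qscale /=; congr Quaternion; ring.
Qed.

Lemma qRe_square p : qRe p = 0 -> qRe (qmul p p) = - qdot p p.
Proof.
by rewrite /qRe /qdot /= => ->; ring.
Qed.

Definition mk3 p q r : 'rV[R]_12 := \row_i nth 0
  [:: q0 p; q1 p; q2 p; q3 p; q0 q; q1 q; q2 q; q3 q; q0 r; q1 r; q2 r; q3 r] i.

Lemma qcoord_mk3 p q r :
  [/\ qcoord (mk3 p q r) 0 = p, qcoord (mk3 p q r) 1 = q & qcoord (mk3 p q r) 2 = r].
Proof.
by split; rewrite /qcoord !mxE !inordK//=; [case: p|case: q|case: r].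
Qed.

Lemma mk3_linear h p q r p' q' r' :
  mk3 (qadd (qscale h p) p') (qadd (qscale h q) q') (qadd (qscale h r) r') =
  h *: mk3 p q r + mk3 p' q' r'.
Proof.
apply/rowP => -[i Hi]; rewrite !mxE /=.
by do 12 (case: i Hi => [|i] Hi //=).
Qed.

Lemma dot_qcoord x y : dot x y =
  qdot (qcoord x 0) (qcoord y 0) + qdot (qcoord x 1) (qcoord y 1) + qdot (qcoord x 2) (qcoord y 2).
Proof.
rewrite /dot; transitivity (\sum_(i < 12) x 0 (inord i) * y 0 (inord i)).
  by apply: eq_bigr => i _; rewrite inord_val.
rewrite -(big_mkord xpredT (fun i => x 0 (inord i) * y 0 (inord i))).
rewrite !big_nat_recr//= big_nil /qdot /qcoord /=.
rewrite -[(4 * 0)%N]/0%N -[(4 * 1)%N]/4%N -[(4 * 2)%N]/8%N.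
rewrite -[(0 + 1)%N]/1%N -[(0 + 2)%N]/2%N -[(0 + 3)%N]/3%N.
rewrite -[(4 + 1)%N]/5%N -[(4 + 2)%N]/6%N -[(4 + 3)%N]/7%N.
rewrite -[(8 + 1)%N]/9%N -[(8 + 2)%N]/10%N -[(8 + 3)%N]/11%N.
by rewrite add0r !addrA.
Qed.

Lemma qcoord_linear h x y m : qcoord (h *: x + y) m = qadd (qscale h (qcoord x m)) (qcoord y m).
Proof. by rewrite /qcoord /qadd /qscale !mxE. Qed.

(** The six placements of [x], [y], [z] in the three factors, without division: on the diagonal this
    is 6 times the cubic form. *)
Definition polar x y z :=
  triple (qcoord x 0) (qcoord y 1) (qcoord z 2) + triple (qcoord x 0) (qcoord z 1) (qcoord y 2)
  + triple (qcoord y 0) (qcoord x 1) (qcoord z 2) + triple (qcoord y 0) (qcoord z 1) (qcoord x 2)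
  + triple (qcoord z 0) (qcoord x 1) (qcoord y 2) + triple (qcoord z 0) (qcoord y 1) (qcoord x 2).

Lemma triple_lin1 h p p' q r : triple (qadd (qscale h p) p') q r = h * triple p q r + triple p' q r.
Proof. by rewrite /triple /qRe /=; ring. Qed.

Lemma triple_lin2 h p p' q r : triple q (qadd (qscale h p) p') r = h * triple q p r + triple q p' r.
Proof. by rewrite /triple /qRe /=; ring. Qed.

Lemma triple_lin3 h p p' q r : triple q r (qadd (qscale h p) p') = h * triple q r p + triple q r p'.
Proof. by rewrite /triple /qRe /=; ring. Qed.

Lemma polar_linear h x y u v : polar (h *: x + y) u v = h * polar x u v + polar y u v.
Proof. by rewrite /polar !qcoord_linear !(triple_lin1, triple_lin2, triple_lin3); ring. Qed.

Lemma polarC12 x y z : polar x y z = polar y x z.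
Proof. by rewrite /polar; ring. Qed.

Lemma polarC23 x y z : polar x y z = polar x z y.
Proof. by rewrite /polar; ring. Qed.

Lemma polar_diag x : polar x x x = 6 * triple (qcoord x 0) (qcoord x 1) (qcoord x 2).
Proof. by rewrite /polar; ring. Qed.

Lemma dot_cauchy n (x y : 'rV[R]_n) : dot x y ^+ 2 <= dot x x * dot y y.
Proof.
have [->|x0] := eqVneq x 0.
  have -> : dot 0 y = 0 by rewrite -(scale0r 0) dotZl mul0r.
  by rewrite expr0n /= mulr_ge0 ?dot_ge0.
have p : 0 < dot x x by rewrite lt_neqAle dot_ge0 eq_sym dot_eq0 x0.
have := dot_ge0 (dot x x *: y - dot x y *: x).
have -> : dot (dot x x *: y - dot x y *: x) (dot x x *: y - dot x y *: x) =
   dot x x * (dot x x * dot y y - dot x y ^+ 2).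
  by rewrite !(dotBl, dotBr, dotZl, dotZr) (dotC y x); ring.
by rewrite pmulr_rge0// subr_ge0.
Qed.

(* The gradient at [x] of the cubic form [polar x x x / 6]. *)
Definition cogradient x : 'rV[R]_12 :=
  mk3 (qconj (qmul (qcoord x 1) (qcoord x 2))) (qconj (qmul (qcoord x 2) (qcoord x 0)))
      (qconj (qmul (qcoord x 0) (qcoord x 1))).

Lemma polar_cogradient s x : polar s s x = 2 * dot x (cogradient s).
Proof.
have [e0 e1 e2] := qcoord_mk3 (qconj (qmul (qcoord s 1) (qcoord s 2)))
  (qconj (qmul (qcoord s 2) (qcoord s 0))) (qconj (qmul (qcoord s 0) (qcoord s 1))).
rewrite dot_qcoord /cogradient e0 e1 e2 -!triple_qdot /polar.
rewrite -(triple_cycle (qcoord s 0) (qcoord x 1)) (triple_cycle (qcoord x 2)) ; ring.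
Qed.

Lemma dot_cogradient s : dot (cogradient s) (cogradient s) =
  qdot (qcoord s 1) (qcoord s 1) * qdot (qcoord s 2) (qcoord s 2)
  + qdot (qcoord s 2) (qcoord s 2) * qdot (qcoord s 0) (qcoord s 0)
  + qdot (qcoord s 0) (qcoord s 0) * qdot (qcoord s 1) (qcoord s 1).
Proof.
have [e0 e1 e2] := qcoord_mk3 (qconj (qmul (qcoord s 1) (qcoord s 2)))
  (qconj (qmul (qcoord s 2) (qcoord s 0))) (qconj (qmul (qcoord s 0) (qcoord s 1))).
by rewrite dot_qcoord /cogradient e0 e1 e2 !qdot_conj !qdotM.
Qed.

(** With [a], [b], [c] the squared lengths of the components, this is
    [3 (ab + bc + ca) <= (a + b + c) ^ 2]. *)
Lemma dot_cogradient_le s : dot (cogradient s) (cogradient s) <= dot s s ^+ 2 / 3.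
Proof.
rewrite dot_cogradient dot_qcoord; move: (qdot _ _) (qdot _ _) (qdot _ _) => a b c.
have := sqr_ge0 (a - b); have := sqr_ge0 (b - c); have := sqr_ge0 (c - a).
rewrite !expr2; nra.
Qed.

(** Cauchy-Schwarz with the gradient of the cubic form. *)
Lemma polar_bound s x : (polar s s x / 2) ^+ 2 <= dot x x * (dot s s ^+ 2 / 3).
Proof.
have -> : polar s s x / 2 = dot x (cogradient s) by rewrite polar_cogradient; field.
apply: le_trans (dot_cauchy _ _) _.
by apply: ler_wpM2l; [exact: dot_ge0|exact: dot_cogradient_le].
Qed.

Definition quat (y : 'rV[R]_4) := Quaternion (y 0 0) (y 0 1) (y 0 2) (y 0 3).

Lemma quat_linear h (y z : 'rV[R]_4) : quat (h *: y + z) = qadd (qscale h (quat y)) (quat z).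
Proof. by rewrite /quat /qadd /qscale !mxE. Qed.

Lemma quat_qdot (y z : 'rV[R]_4) : qdot (quat y) (quat z) = dot y z.
Proof.
rewrite /dot !big_ord_recl big_ord0 /qdot /= addr0 !addrA.
by congr (_ + _ + _ + _); congr (y 0 _ * z 0 _); apply: val_inj.
Qed.

Lemma linear_mx n m (g : 'rV[R]_n -> 'rV[R]_m) :
  (forall h (y z : 'rV[R]_n), g (h *: y + z) = h *: g y + g z) ->
  exists L : 'M[R]_(n, m), forall y : 'rV[R]_n, y *m L = g y.
Proof.
move=> gl; exists (\matrix_i g (delta_mx 0 i)) => y.
have g0 : g 0 = 0.
  by have := gl (-1) 0 0; rewrite scaleN1r oppr0 addr0 scaleN1r addNr.
rewrite mulmx_sum_row [in RHS](row_sum_delta y).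
elim/big_rec2 : _ => [|i u v _ IH]; first by rewrite g0.
by rewrite gl rowK -IH.
Qed.

End Quaternion.

(** * Hyperbolicity of the quaternionic cubic form *)

Section Hyperbolic.
Variable R : realType.
Implicit Types (p q r : quaternion R) (h : R).

Lemma mxrank_row_mx_le (m n1 n2 : nat) (A : 'M[R]_(m, n1)) (B : 'M[R]_(m, n2)) :
  (\rank (row_mx A B) <= \rank A + \rank B)%N.
Proof.
rewrite -mxrank_tr tr_row_mx -(mxrank_tr A) -(mxrank_tr B) -addsmxE.
exact: mxrank_adds_leqif.
Qed.

(** The row space of [A] is a hyperplane, and lying in it is one linear condition, expressed by the
    rank-one matrix [cokermx A]. With the two columns, three conditions are imposed on four
    parameters. *)
Lemma exists_constrained n (A : 'M[R]_(n, n.+1)) (L : 'M[R]_(4, n.+1)) (c1 c2 : 'cV[R]_4) :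
  row_free A -> exists y : 'rV[R]_4, y != 0 /\
    exists v : 'rV[R]_n, [/\ y *m L = v *m A, y *m c1 = 0 & y *m c2 = 0].
Proof.
move=> fA; pose B := row_mx (L *m cokermx A) (row_mx c1 c2).
have rB : (\rank B <= 3)%N.
  apply: leq_trans (mxrank_row_mx_le _ _) _.
  have r1 : (\rank (L *m cokermx A) <= 1)%N.
    apply: leq_trans (mxrankM_maxr _ _) _.
    by rewrite mxrank_coker (eqP fA) subSnn.
  have r2 : (\rank (row_mx c1 c2) <= 2)%N.
    apply: leq_trans (mxrank_row_mx_le _ _) _.
    exact: (leq_add (rank_leq_col c1) (rank_leq_col c2)).
  exact: (leq_add r1 r2).
have : kermx B != 0.
  by rewrite -mxrank_eq0 mxrank_ker -lt0n subn_gt0.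
case/rowV0Pn => y /sub_kermxP yB y0; exists y; split=> //.
move: yB; rewrite !mul_mx_row -!row_mx0 => /eq_row_mx[y1 /eq_row_mx[y2 y3]].
have : (y *m L <= A)%MS by rewrite submxE -mulmxA y1.
by case/submxP => v Hv; exists v.
Qed.

(* When the second component [b] of [x] is the largest, [y *m L] is [(|b| y, 0, conj (y b))], and
   cyclically in the other cases; four parameters leave room for three linear constraints. *)
Lemma exists_family (x : 'rV[R]_12) : x != 0 -> exists (L : 'M[R]_(4, 12)) (m : R),
  [/\ 0 < m, dot x x <= 3 * m ^+ 2 &
    forall y : 'rV[R]_4, polar x (y *m L) (y *m L) = m * dot (y *m L) (y *m L) /\
      (y != 0 -> 0 < dot (y *m L) (y *m L))].
Proof.
move=> x0; have xp : 0 < dot x x by rewrite lt_neqAle dot_ge0 eq_sym dot_eq0 x0.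
set a := qcoord x 0; set b := qcoord x 1; set c := qcoord x 2.
have E : dot x x = qdot a a + qdot b b + qdot c c := dot_qcoord x x.
have yp (y : 'rV[R]_4) : y != 0 -> 0 < qdot (quat y) (quat y).
  by move=> y0; rewrite quat_qdot lt_neqAle dot_ge0 eq_sym dot_eq0 y0.
pose M (p : quaternion R) := Num.sqrt (qdot p p).
have M2 p : M p ^+ 2 = qdot p p by rewrite sqr_sqrtr// qdot_ge0.
have Mp p : 0 < qdot p p -> 0 < M p by rewrite sqrtr_gt0.
(* What the three cases share: [p] is the longest component and [m = |p|], so only the squared
   length of [g y] and the value of [polar] on it remain to be computed. *)
have conc (g : 'rV[R]_4 -> 'rV[R]_12) p : dot x x <= 3 * qdot p p ->
    (forall h (y z : 'rV[R]_4), g (h *: y + z) = h *: g y + g z) ->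
    (forall y, dot (g y) (g y) = 2 * qdot p p * qdot (quat y) (quat y)) ->
    (forall y, polar x (g y) (g y) = 2 * M p * (qdot p p * qdot (quat y) (quat y))) ->
    exists (L : 'M[R]_(4, 12)) (m : R),
    [/\ 0 < m, dot x x <= 3 * m ^+ 2 &
    forall y : 'rV[R]_4, polar x (y *m L) (y *m L) = m * dot (y *m L) (y *m L) /\
      (y != 0 -> 0 < dot (y *m L) (y *m L))].
  move=> Hp gl gd gp; have pp : 0 < qdot p p by move: xp Hp; clear; lra.
  have [L HL] := linear_mx gl; exists L, (M p); split; [exact: Mp|by rewrite M2|].
  move=> y; rewrite HL gp gd; split; first by ring.
  by move=> y0; rewrite mulr_gt0 ?mulr_gt0 ?yp.
have [H|[H|H]] : dot x x <= 3 * qdot a a \/ dot x x <= 3 * qdot b b \/ dot x x <= 3 * qdot c c.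
- rewrite E; move: (qdot a a) (qdot b b) (qdot c c); clear => p q r.
  have [h1|h1] := lerP q p; have [h2|h2] := lerP r p; have [h3|h3] := lerP q r;
    first [by left; lra|by right; left; lra|by right; right; lra].
- apply: (conc (fun y => mk3 (Quaternion 0 0 0 0) (qscale (M a) (quat y)) (qconj (qmul a (quat y)))) a H).
  + move=> h y z; rewrite -mk3_linear quat_linear; congr mk3;
      by rewrite /qadd /qscale /qconj /qmul /=; congr Quaternion; ring.
  + move=> y; set u := mk3 _ _ _.
    have [e0 e1 e2] := qcoord_mk3 (Quaternion 0 0 0 0) (qscale (M a) (quat y)) (qconj (qmul a (quat y))).
    rewrite dot_qcoord e0 e1 e2 qdot_conj qdotM.
    have -> : qdot (qscale (M a) (quat y)) (qscale (M a) (quat y)) = M a ^+ 2 * qdot (quat y) (quat y).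
      by rewrite /qdot /=; ring.
    rewrite M2; have -> : qdot (Quaternion 0 0 0 0) (Quaternion 0 0 0 0) = 0 :> R by rewrite /qdot /=; ring.
    by ring.
  + move=> y; have [e0 e1 e2] := qcoord_mk3 (Quaternion 0 0 0 0) (qscale (M a) (quat y)) (qconj (qmul a (quat y))).
    (* The first component of [g y] is 0, so the surviving products take their first factor from
       [x]. *)
    rewrite /polar e0 e1 e2 -/a -/b -/c.
    have -> : triple a (qscale (M a) (quat y)) (qconj (qmul a (quat y))) =
       M a * (qdot a a * qdot (quat y) (quat y)).
      by rewrite triple_scale2 -qdotM /triple /qdot /qRe /=; ring.
    by rewrite /triple /qRe /=; ring.
- apply: (conc (fun y => mk3 (qscale (M b) (quat y)) (Quaternion 0 0 0 0) (qconj (qmul (quat y) b))) b H).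
  + move=> h y z; rewrite -mk3_linear quat_linear; congr mk3;
      by rewrite /qadd /qscale /qconj /qmul /=; congr Quaternion; ring.
  + move=> y; set u := mk3 _ _ _.
    have [e0 e1 e2] := qcoord_mk3 (qscale (M b) (quat y)) (Quaternion 0 0 0 0) (qconj (qmul (quat y) b)).
    rewrite dot_qcoord e0 e1 e2 qdot_conj qdotM.
    have -> : qdot (qscale (M b) (quat y)) (qscale (M b) (quat y)) = M b ^+ 2 * qdot (quat y) (quat y).
      by rewrite /qdot /=; ring.
    rewrite M2; have -> : qdot (Quaternion 0 0 0 0) (Quaternion 0 0 0 0) = 0 :> R by rewrite /qdot /=; ring.
    by ring.
  + move=> y; have [e0 e1 e2] := qcoord_mk3 (qscale (M b) (quat y)) (Quaternion 0 0 0 0) (qconj (qmul (quat y) b)).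
    rewrite /polar e0 e1 e2 -/a -/b -/c.
    have -> : triple (qscale (M b) (quat y)) b (qconj (qmul (quat y) b)) =
       M b * (qdot b b * qdot (quat y) (quat y)).
      by rewrite triple_scale1 [qdot b b * _]mulrC -qdotM /triple /qdot /qRe /=; ring.
    by rewrite /triple /qRe /=; ring.
- apply: (conc (fun y => mk3 (qscale (M c) (quat y)) (qconj (qmul c (quat y))) (Quaternion 0 0 0 0)) c H).
  + move=> h y z; rewrite -mk3_linear quat_linear; congr mk3;
      by rewrite /qadd /qscale /qconj /qmul /=; congr Quaternion; ring.
  + move=> y; set u := mk3 _ _ _.
    have [e0 e1 e2] := qcoord_mk3 (qscale (M c) (quat y)) (qconj (qmul c (quat y))) (Quaternion 0 0 0 0).
    rewrite dot_qcoord e0 e1 e2 qdot_conj qdotM.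
    have -> : qdot (qscale (M c) (quat y)) (qscale (M c) (quat y)) = M c ^+ 2 * qdot (quat y) (quat y).
      by rewrite /qdot /=; ring.
    rewrite M2; have -> : qdot (Quaternion 0 0 0 0) (Quaternion 0 0 0 0) = 0 :> R by rewrite /qdot /=; ring.
    by ring.
  + move=> y; have [e0 e1 e2] := qcoord_mk3 (qscale (M c) (quat y)) (qconj (qmul c (quat y))) (Quaternion 0 0 0 0).
    rewrite /polar e0 e1 e2 -/a -/b -/c.
    have -> : triple (qscale (M c) (quat y)) (qconj (qmul c (quat y))) c =
       M c * (qdot c c * qdot (quat y) (quat y)).
      by rewrite triple_scale1 -qdotM /triple /qdot /qRe /=; ring.
    by rewrite /triple /qRe /=; ring.
Qed.

End Hyperbolic.

(** [S] and [D] stand for the squared lengths of the midpoint and of the difference of two unit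
    vectors. The hypotheses give [X <= m * S] and [Z <= m * D], so the sum is at most
    [m * (S + D / 12)], and [S + D / 4 = 1] leaves strict room. *)
Lemma ltr_sum_lt (R : realType) (X Z S D m : R) : 0 < m -> 0 < D -> D <= 3 * m ^+ 2 ->
  0 <= S -> S + D / 4 = 1 -> X ^+ 2 <= D * (S ^+ 2 / 3) -> Z ^+ 2 <= D * (D ^+ 2 / 3) ->
  X + Z / 12 < m.
Proof.
move=> m0 D0 Dm S0 SD HX HZ.
have gen (x s : R) : 0 <= s -> x ^+ 2 <= D * (s ^+ 2 / 3) -> x <= m * s.
  move=> s0 H; apply: le_trans (ler_norm _) _.
  rewrite -(@ler_pXn2r _ 2)// ?nnegrE ?mulr_ge0 ?(ltW m0)// real_normK ?num_real//.
  apply: le_trans H _; rewrite exprMn.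
  have -> : D * (s ^+ 2 / 3) = D / 3 * s ^+ 2 by ring.
  by apply: ler_wpM2r; [exact: sqr_ge0|rewrite ler_pdivrMr// mulrC].
have h1 := gen _ _ S0 HX; have h2 := gen _ _ (ltW D0) HZ.
have e : m = m * S + m * D / 4 by rewrite -mulrA -mulrDr SD mulr1.
have mD : 0 < m * D by rewrite mulr_gt0.
by move: h1 h2 e mD; move: (m * S) (m * D); clear => p q h1 h2 e mD; lra.
Qed.

(** Expansion about the midpoint leaves only the terms odd in [x - y]. *)
Lemma polar_difference (R : realType) (x y : 'rV[R]_12) :
  polar x x x - polar y y y = 3 * polar (2^-1 *: (x + y)) (2^-1 *: (x + y)) (x - y)
    + polar (x - y) (x - y) (x - y) / 4.
Proof.
set d := x - y.
have xE : x = 1 *: d + y by rewrite scale1r subrK.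
have -> : 2^-1 *: (x + y) = 2^-1 *: d + y.
  by rewrite /d; apply/rowP => i; rewrite !mxE; field.
have lin2 h a b u v : polar u (h *: a + b) v = h * polar u a v + polar u b v.
  by rewrite polarC12 polar_linear polarC12 (polarC12 b).
have lin3 h a b u v : polar u v (h *: a + b) = h * polar u v a + polar u v b.
  by rewrite polarC23 lin2 polarC23 (polarC23 u b).
rewrite {1 2 3}xE !(polar_linear, lin2, lin3) (polarC12 y d d) (polarC23 d y d).
by rewrite (polarC12 y d y) (polarC23 y y d) (polarC12 y d y); field.
Qed.

(** * Restriction to a hyperplane and the secant inequality *)

Section Pullback.
Variables (R : realType) (A : 'M[R]_(11, 12)).
Implicit Types (a b v tau : 'rV[R]_11) (x y z : 'rV[R]_12).
Hypothesis Aisom : forall a b, dot (a *m A) (b *m A) = dot a b.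

Definition pullback a b v : R := polar (a *m A) (b *m A) (v *m A).

Lemma pullback_linear h a b u v :
  pullback (h *: a + b) u v = h * pullback a u v + pullback b u v.
Proof. by rewrite /pullback mulmxDl -scalemxAl polar_linear. Qed.

Lemma pullbackC12 a b v : pullback a b v = pullback b a v.
Proof. exact: polarC12. Qed.

Lemma pullbackC23 a b v : pullback a b v = pullback a v b.
Proof. exact: polarC23. Qed.

Lemma pullback_smooth k : CkO k setT (fun a => pullback a a a).
Proof.
have oT := @openT 'rV[R]_11.
have cA i : CkO k setT (fun a => (a *m A) 0 i).
  apply: (@CkO_ext _ _ k setT (fun a => \sum_j A j i * a 0 j)) => //.
    by move=> a _; rewrite mxE; apply: eq_bigr => j _; rewrite mulrC.
  apply: CkO_sum => // j _; apply: CkO_scale => //.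
  by apply: CkO_linear => [c x y|]; [rewrite !mxE|exact: coord_continuous].
apply: (@CkO_ext _ _ k setT (fun a => 6 * triple (qcoord (a *m A) 0) (qcoord (a *m A) 1) (qcoord (a *m A) 2))) => //.
  by move=> a _; rewrite /pullback polar_diag.
apply: CkO_scale => //; rewrite /triple /qRe /=.
by repeat first [exact: oT | exact: cA | apply: CkO_sub2 | apply: CkO_add | apply: CkO_mul].
Qed.

Lemma isom_row_free : row_free A.
Proof.
rewrite -kermx_eq0; apply/rowV0P => u /sub_kermxP uA.
apply/eqP; rewrite -dot_eq0 -Aisom uA -(scale0r (0 : 'rV[R]_12)) dotZl mul0r//.
Qed.

Let dotT n (p q : 'rV[R]_n) : (p *m q^T) 0 0 = dot p q.
Proof. by rewrite mxE; apply: eq_bigr => i _; rewrite mxE. Qed.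

Let dot_mx (L : 'M[R]_(4, 12)) (t : 'rV[R]_4) x : t *m (L *m x^T) = 0 -> dot (t *m L) x = 0.
Proof. by move=> H; rewrite -dotT -mulmxA H mxE. Qed.

(** A sixth of the cubic difference is [X + Z / 12], with [X] half of [polar] at the midpoint,
    twice, and the difference, and [Z] half of [polar] on the difference. [polar_bound] estimates
    both, and the total stays below the factor [m] of the family. *)
Lemma pullback_secant a b : dot a a = 1 -> dot b b = 1 -> a != b ->
  exists v, 0 < qf (hessian (cubic_over_norm pullback) a - hessian (cubic_over_norm pullback) b) v.
Proof.
move=> a1 b1 ab; set d := a - b.
have dn : d != 0 by rewrite subr_eq0.
have dp : 0 < dot d d by rewrite lt_neqAle dot_ge0 eq_sym dot_eq0 dn.
have dAn : d *m A != 0 by rewrite -dot_eq0 Aisom gt_eqF.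
have [L [m [m0 Hm HL]]] := exists_family dAn.
have [t [t0 [v [tv ta tb]]]] := exists_constrained L (L *m (a *m A)^T) (L *m (b *m A)^T) isom_row_free.
have av : dot a v = 0 by rewrite dotC -Aisom -tv; exact: dot_mx.
have bv : dot b v = 0 by rewrite dotC -Aisom -tv; exact: dot_mx.
have [H1 H2] := HL t; rewrite tv Aisom in H1 H2; have vp := H2 t0.
have Ea := qf_hessian_sphere pullback_linear pullbackC12 pullbackC23 pullback_smooth a1 av.
have Eb := qf_hessian_sphere pullback_linear pullbackC12 pullbackC23 pullback_smooth b1 bv.
exists v; rewrite (etrans (qfB _ _ v) (f_equal2 (fun p q => p - q) Ea Eb)).
set n := dot v v in vp H1 *.
have E1 : pullback a v v - pullback b v v = m * n.
  rewrite -H1 -[RHS]/(pullback d v v).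
  have -> : d = (-1) *: b + a by rewrite scaleN1r addrC.
  by rewrite pullback_linear; ring.
set S := 2^-1 *: (a + b).
have E2 : pullback a a a - pullback b b b =
    3 * polar (S *m A) (S *m A) (d *m A) + polar (d *m A) (d *m A) (d *m A) / 4.
  by rewrite /pullback polar_difference /S /d -scalemxAl mulmxDl mulmxBl.
have SD : dot S S + dot d d / 4 = 1.
  by rewrite /S /d !(dotDl, dotDr, dotZl, dotZr, dotNl, dotNr) a1 b1 (dotC b a); field.
have B1 := polar_bound (S *m A) (d *m A); have B2 := polar_bound (d *m A) (d *m A).
rewrite !Aisom in B1 B2 Hm.
have K := ltr_sum_lt m0 dp Hm (dot_ge0 S) SD B1 B2.
have gen (p q u w X Z m' n' : R) : p - u = m' * n' -> q - w = 3 * X + Z / 4 ->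
    X / 2 + Z / 2 / 12 < m' -> 0 < n' -> 0 < p - q / 6 * n' - (u - w / 6 * n').
  clear => E1 E2 K n0.
  have -> : p - q / 6 * n' - (u - w / 6 * n') = (m' - (X / 2 + Z / 2 / 12)) * n'.
    have -> : p = m' * n' + u by rewrite -E1; ring.
    have -> : q = 3 * X + Z / 4 + w by rewrite -E2; ring.
    by field.
  by rewrite mulr_gt0// subr_gt0.
exact: gen E1 E2 K vp.
Qed.

End Pullback.

(** * The equality case and the tangent inequality *)

Section EqualityCase.
Variable R : realType.
Implicit Types (p q r : quaternion R) (s x : 'rV[R]_12) (h : R).

Lemma qRe_mulC p q : qRe (qmul p q) = qRe (qmul q p).
Proof. by rewrite /qRe /=; ring. Qed.

Lemma qRe_conjl p q : qRe (qmul (qconj p) q) = qdot p q.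
Proof. by rewrite /qRe /qdot /=; ring. Qed.

Lemma qmul_scalel h p q : qmul (qscale h p) q = qscale h (qmul p q).
Proof. by rewrite /qmul /qscale /=; congr Quaternion; ring. Qed.

Lemma qmul_scaler h p q : qmul p (qscale h q) = qscale h (qmul p q).
Proof. by rewrite /qmul /qscale /=; congr Quaternion; ring. Qed.

Lemma qRe_scale h p : qRe (qscale h p) = h * qRe p. Proof. by []. Qed.

Lemma qdot_scale h p : qdot (qscale h p) (qscale h p) = h ^+ 2 * qdot p p.
Proof. by rewrite /qdot /=; ring. Qed.

Lemma qdot_scalel h p q : qdot (qscale h p) q = h * qdot p q.
Proof. by rewrite /qdot /=; ring. Qed.

Lemma triple_conj_mul p q : triple p (qconj q) (qmul q (qconj p)) = qdot q q * qdot p p.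
Proof. by rewrite /triple /qRe /qdot /=; ring. Qed.

Lemma triple_mul_conj p q : triple p (qmul (qconj p) q) (qconj q) = qdot q q * qdot p p.
Proof. by rewrite /triple /qRe /qdot /=; ring. Qed.

(** Equality in [polar_bound] forces equality in Cauchy-Schwarz, so that [x] is a multiple of the
    gradient at [s], and in the inequality between squared lengths, so that these coincide. By
    Euler's relation, orthogonality of [x] and [s] then makes the cubic form vanish at [s]. *)
Lemma polar_equality s x : dot s s = 1 -> dot x x = 1 -> dot x s = 0 ->
  0 < polar s s x -> 1 <= 3 * (polar s s x / 2) ^+ 2 ->
  [/\ x = (3 * (polar s s x / 2)) *: cogradient s,
      qRe (qmul (qcoord s 0) (qmul (qcoord s 1) (qcoord s 2))) = 0 &
      [/\ qdot (qcoord s 0) (qcoord s 0) = 1 / 3, qdot (qcoord s 1) (qcoord s 1) = 1 / 3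
        & qdot (qcoord s 2) (qcoord s 2) = 1 / 3]].
Proof.
move=> s1 x1 xs X0 X1; have B := polar_bound s x.
rewrite s1 x1 expr1n mul1r in B.
set X := polar s s x / 2 in X1 B *.
have Xp : 0 < X by rewrite divr_gt0.
have X2 : X ^+ 2 = 1 / 3 by apply/eqP; rewrite eq_le; apply/andP; split; move: B X1; move: (X ^+ 2); clear => u; lra.
set g := cogradient s.
have XE : dot x g = X by rewrite /X polar_cogradient; field.
have gle := dot_cogradient_le s; rewrite s1 expr1n mul1r -/g in gle.
have E : dot (x - (3 * X) *: g) (x - (3 * X) *: g) = 1 - 6 * X ^+ 2 + 9 * X ^+ 2 * dot g g.
  by rewrite !(dotBl, dotBr, dotZl, dotZr) (dotC g x) XE x1; ring.
have D0 := dot_ge0 (x - (3 * X) *: g); rewrite E X2 in D0.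
have gE : dot g g = 1 / 3 by move: gle D0; move: (dot g g); clear => u; lra.
have xE : x = (3 * X) *: g.
  by apply/eqP; rewrite -subr_eq0 -dot_eq0 E X2 gE; apply/eqP; field.
split=> //.
  have := xs; rewrite xE dotZl; have -> : dot g s = 3 * qRe (qmul (qcoord s 0) (qmul (qcoord s 1) (qcoord s 2))).
    have P1 := polar_cogradient s s; rewrite polar_diag (dotC s) -/g in P1.
    have -> : qRe (qmul (qcoord s 0) (qmul (qcoord s 1) (qcoord s 2))) = triple (qcoord s 0) (qcoord s 1) (qcoord s 2).
      by rewrite /triple qmulA.
    by move: P1; move: (dot g s) (triple _ _ _); clear => u w; lra.
  have XX : 3 * X * 3 != 0 by rewrite gt_eqF// !mulr_gt0.
  by rewrite [_ * (3 * _)]mulrA; move/eqP; rewrite mulf_eq0 (negbTE XX) /=; move/eqP.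
move: gE s1; rewrite /g dot_cogradient dot_qcoord.
move: (qdot _ _) (qdot _ _) (qdot _ _) => u w t; clear => E1 E2.
have : (u - w) ^+ 2 + (w - t) ^+ 2 + (t - u) ^+ 2 = 0.
  have -> : (u - w) ^+ 2 + (w - t) ^+ 2 + (t - u) ^+ 2 =
     2 * ((u + w + t) ^+ 2 - 3 * (u * w + w * t + t * u)) by ring.
  have -> : u + w + t = 1 by rewrite -E2; ring.
  have -> : u * w + w * t + t * u = 1 / 3 by rewrite -E1; ring.
  by field.
have h1 := sqr_ge0 (u - w); have h2 := sqr_ge0 (w - t); have h3 := sqr_ge0 (t - u) => H.
have e1 : (u - w) ^+ 2 = 0 by lra.
have e2 : (w - t) ^+ 2 = 0 by lra.
move/eqP: e1; rewrite sqrf_eq0 subr_eq0 => /eqP e1.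
move/eqP: e2; rewrite sqrf_eq0 subr_eq0 => /eqP e2.
by split; lra.
Qed.

(* Test vectors for the equality case of [polar_bound], where [exists_family] only gives the value 0. *)
Definition critical_vector s (y : 'rV[R]_4) : 'rV[R]_12 :=
  mk3 (quat y) (qscale 3 (qmul (qmul (qconj (quat y)) (qcoord s 0)) (qcoord s 1)))
    (qscale 3 (qmul (qmul (qcoord s 2) (qcoord s 0)) (qconj (quat y)))).

Lemma critical_vector_linear s h (y z : 'rV[R]_4) :
  critical_vector s (h *: y + z) = h *: critical_vector s y + critical_vector s z.
Proof.
rewrite /critical_vector -mk3_linear quat_linear; congr mk3;
  by rewrite /qadd /qscale /qconj /qmul /=; congr Quaternion; ring.
Qed.

(** As [Re (a b c) = 0], the sandwich identity turns [a b c a] into a multiple of the conjugate of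
    [b c], to which [quat y] is orthogonal; this gives orthogonality to the gradient. For [x = 3 X]
    times the gradient, [polar x v v] is [2 X * dot v v], twice the threshold. *)
Lemma critical_vectorP s (y : 'rV[R]_4) :
  qRe (qmul (qcoord s 0) (qmul (qcoord s 1) (qcoord s 2))) = 0 ->
  qdot (qcoord s 0) (qcoord s 0) = 1 / 3 -> qdot (qcoord s 1) (qcoord s 1) = 1 / 3 ->
  qdot (qcoord s 2) (qcoord s 2) = 1 / 3 ->
  qdot (quat y) (qconj (qmul (qcoord s 1) (qcoord s 2))) = 0 ->
  let v := critical_vector s y in
  [/\ dot v v = 3 * dot y y, dot v (cogradient s) = 0 & polar (cogradient s) v v = 2 * dot y y].
Proof.
set a := qcoord s 0; set b := qcoord s 1; set c := qcoord s 2.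
move=> Hre na nb nc Hy v; set u := quat y in Hy v *.
have -> : dot y y = qdot u u by rewrite quat_qdot.
have San := qmul_sandwich Hre.
have [e0 e1 e2] := qcoord_mk3 u (qscale 3 (qmul (qmul (qconj u) a) b)) (qscale 3 (qmul (qmul c a) (qconj u))).
have [g0 g1 g2] := qcoord_mk3 (qconj (qmul b c)) (qconj (qmul c a)) (qconj (qmul a b)).
split.
- rewrite dot_qcoord /v /critical_vector e0 e1 e2 !qdot_scale !qdotM !qdot_conj na nb nc; by field.
- rewrite dot_qcoord /v /critical_vector /cogradient e0 e1 e2 g0 g1 g2 Hy !qdot_scalel !qdot_conjr.
  have -> : qRe (qmul (qmul (qmul (qconj u) a) b) (qmul c a)) = 0.
    have -> : qmul (qmul (qmul (qconj u) a) b) (qmul c a) = qmul (qconj u) (qmul (qmul a (qmul b c)) a).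
      by rewrite !qmulA.
    by rewrite San qmul_scaler qRe_scale qRe_conjl Hy mulr0.
  have -> : qRe (qmul (qmul (qmul c a) (qconj u)) (qmul a b)) = 0.
    rewrite qRe_mulC.
    have -> : qmul (qmul a b) (qmul (qmul c a) (qconj u)) = qmul (qmul (qmul a (qmul b c)) a) (qconj u).
      by rewrite !qmulA.
    by rewrite San qmul_scalel qRe_scale qRe_mulC qRe_conjl Hy mulr0.
  by ring.
- rewrite /polar /v /critical_vector /cogradient e0 e1 e2 g0 g1 g2.
  rewrite !(triple_scale1, triple_scale2, triple_scale3) triple_conj_mul.
  have -> : qmul (qmul (qconj u) a) b = qmul (qconj u) (qmul a b) by rewrite qmulA.
  rewrite triple_mul_conj !qdotM na nb nc.
  have -> : triple (qconj (qmul b c)) (qmul (qconj u) (qmul a b)) (qmul (qmul c a) (qconj u)) = qdot u u / 27.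
    rewrite /triple.
    have -> : qmul (qmul (qconj (qmul b c)) (qmul (qconj u) (qmul a b))) (qmul (qmul c a) (qconj u)) =
        qmul (qmul (qconj (qmul b c)) (qconj u)) (qmul (qmul (qmul a (qmul b c)) a) (qconj u)).
      by rewrite !qmulA.
    rewrite San qmul_scalel qmul_scaler qRe_scale qRe_square; last by rewrite qRe_mulC qRe_conjl.
    by rewrite qdotM !qdot_conj qdotM na nb nc; field.
  by field.
Qed.

Lemma quat_surj q : exists y : 'rV[R]_4, quat y = q.
Proof.
exists (\row_i nth 0 [:: q0 q; q1 q; q2 q; q3 q] i); case: q => p0 p1 p2 p3.
by rewrite /quat !mxE.
Qed.

Variable A : 'M[R]_(11, 12).
Hypothesis Aisom : forall a b : 'rV[R]_11, dot (a *m A) (b *m A) = dot a b.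

Let dotT n (p q : 'rV[R]_n) : (p *m q^T) 0 0 = dot p q.
Proof. by rewrite mxE; apply: eq_bigr => i _; rewrite mxE. Qed.

Let dot_mx (L : 'M[R]_(4, 12)) (t : 'rV[R]_4) x : t *m (L *m x^T) = 0 -> dot (t *m L) x = 0.
Proof. by move=> H; rewrite -dotT -mulmxA H mxE. Qed.

Lemma pullback_tangent (a tau : 'rV[R]_11) : dot a a = 1 -> dot tau tau = 1 -> dot a tau = 0 ->
  exists v, 0 < qf (Df (hessian (cubic_over_norm (pullback A))) a tau) v.
Proof.
move=> a1 t1 at0.
pose s := a *m A; pose x := tau *m A.
have s1 : dot s s = 1 by rewrite Aisom.
have x1 : dot x x = 1 by rewrite Aisom.
have xs : dot x s = 0 by rewrite Aisom dotC.
have qE v : dot a v = 0 -> dot tau v = 0 -> qf (Df (hessian (cubic_over_norm (pullback A))) a tau) v =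
    polar x (v *m A) (v *m A) - polar s s x / 2 * dot v v.
  move=> av tv; rewrite (qf_derive_hessian (@pullback_linear R A) (@pullbackC12 R A)
    (@pullbackC23 R A) (@pullback_smooth R A) a1 at0 av) tv mulr0 subr0 //.
have xn : x != 0 by exact: sphere_neq0.
have [L [m [m0 Hm HL]]] := exists_family xn.
have B := polar_bound s x; rewrite s1 x1 expr1n mul1r in B.
set X := polar s s x / 2 in B qE.
(* [X] is at most 1 / sqrt 3 and [m] at least that: the general family works unless both are equal
   to it. *)
have [Xm|mX] := ltP X m.
  have [t [t0 [v [tv ta tb]]]] := exists_constrained L (L *m s^T) (L *m x^T) (isom_row_free Aisom).
  have av : dot a v = 0 by rewrite dotC -Aisom -tv; exact: dot_mx.
  have bv : dot tau v = 0 by rewrite dotC -Aisom -tv; exact: dot_mx.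
  have [H1 H2] := HL t; rewrite tv Aisom in H1 H2; have vp := H2 t0.
  by exists v; rewrite qE// H1 -mulrBl mulr_gt0// subr_gt0.
have X0 : 0 < X by exact: lt_le_trans m0 mX.
have X1 : 1 <= 3 * X ^+ 2.
  have Hm1 : 1 <= 3 * m ^+ 2 by rewrite -[leLHS]x1.
  apply: le_trans Hm1 _; rewrite ler_pM2l//.
  by rewrite ler_pXn2r ?nnegrE ?(ltW m0) ?(ltW X0).
have pp : 0 < polar s s x by move: X0; rewrite /X pmulr_lgt0// invr_gt0.
have [xE Hre [n0 n1 n2]] := polar_equality s1 x1 xs pp X1.
rewrite -/X in xE.
have [M HM] := linear_mx (critical_vector_linear s).
(* The last constraint makes the first component of [v] orthogonal to that of the gradient at [s].
   Orthogonality to the whole gradient, hence to [tau], follows, so three constraints still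
   suffice. *)
have [z zE] := quat_surj (qconj (qmul (qcoord s 1) (qcoord s 2))).
have [t [t0 [v [tv ta tb]]]] := exists_constrained M (M *m s^T) z^T (isom_row_free Aisom).
have ty : qdot (quat t) (qconj (qmul (qcoord s 1) (qcoord s 2))) = 0.
  by rewrite -zE quat_qdot -dotT tb mxE.
have [v1 v2 v3] := critical_vectorP Hre n0 n1 n2 ty.
rewrite -HM tv in v1 v2 v3.
have av : dot a v = 0 by rewrite dotC -Aisom -tv; exact: dot_mx.
have bv : dot tau v = 0 by rewrite -Aisom -/x xE dotZl dotC v2 mulr0.
have tp : 0 < dot t t by rewrite lt_neqAle dot_ge0 eq_sym dot_eq0 t0.
exists v; rewrite qE//; rewrite Aisom in v1.
have -> : polar x (v *m A) (v *m A) = 3 * X * (2 * dot t t).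
  have p0 (y : 'rV[R]_12) : polar 0 y y = 0.
    by rewrite /polar /triple /qcoord /qRe /= !mxE; ring.
  by rewrite {1}xE -[(3 * X) *: _]addr0 polar_linear p0 addr0 v3.
rewrite v1; have -> : 3 * X * (2 * dot t t) - X * (3 * dot t t) = 3 * (X * dot t t) by ring.
by rewrite mulr_gt0// mulr_gt0.
Qed.

End EqualityCase.

(** * Viscosity solutions *)

Section HessianOrder.
Variables (R : realType) (n : nat).
Implicit Types (phi psi : 'rV[R]_n -> R) (z v : 'rV[R]_n) (A : set 'rV[R]_n).
Local Notation e_ k := (delta_mx 0 k : 'rV[R]_n).

Lemma hessian_sub A phi psi z : open A -> A z -> CkO 2 A phi -> CkO 2 A psi ->
  hessian (fun x => phi x - psi x) z = hessian phi z - hessian psi z.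
Proof.
move=> oA Az cphi cpsi; apply/matrixP => i j; rewrite !mxE.
have E : 'D_(e_ i) ('D_(e_ j) (fun x => phi x - psi x)) z =
    'D_(e_ i) (fun x => 'D_(e_ j) phi x - 'D_(e_ j) psi x) z.
  apply: near_eq_derive.
  have : \forall y \near z, A y by exact: (open_nbhs_nbhs (conj oA Az)).
  apply: filterS => y Ay; have d1 := derivableP (CkO_derivable (v := e_ j) cphi Ay).
  have d2 := derivableP (CkO_derivable (v := e_ j) cpsi Ay).
  by have [_ ->] := is_deriveB d1 d2.
rewrite E; have d1 := derivableP (CkO_derivable (v := e_ i) (CkO_derive (e_ j) cphi) Az).
have d2 := derivableP (CkO_derivable (v := e_ i) (CkO_derive (e_ j) cpsi) Az).
by have [_ ->] := is_deriveB d1 d2.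
Qed.

Lemma hessian_cst (c : R) z : hessian (fun=> c) z = 0.
Proof.
apply/matrixP => i j; rewrite !mxE.
have -> : 'D_(e_ j) (fun=> c) = (fun=> 0) :> ('rV[R]_n -> R).
  by apply/funext => x; exact: derive_cst.
exact: derive_cst.
Qed.

Lemma hessian_symmx A phi z : open A -> A z -> CkO 2 A phi -> symmx (hessian phi z).
Proof.
by move=> oA Az cphi; apply/matrixP => i j; rewrite !mxE (schwarz _ _ oA Az cphi).
Qed.

(** Stated with second differences in order to serve both at a local maximum and at the origin,
    where oddness controls only the sum of the values at [h] and [- h]. *)
Lemma hessian_nonpos A phi z : open A -> A z -> CkO 2 A phi ->
  (\forall h \near (0 : 'rV[R]_n), phi (z + h) + phi (z - h) <= 2 * phi z) ->
  nonneg_def (- hessian phi z).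
Proof.
move=> oA Az cphi H; split.
  by rewrite /symmx /= linearN /= (hessian_symmx oA Az cphi).
move=> v; rewrite -qfE qfN oppr_ge0.
have -> : qf (hessian phi z) v = 'D_v ('D_v phi) z.
  rewrite (derive2_rowE v v oA Az cphi).
  by apply: eq_bigr => i _; apply: eq_bigr => j _; rewrite mxE mulrC mulrA.
apply: (second_derivative_le0 oA Az cphi).
have c0 : (fun t : R => t *: v) @ nbhs (0 : R) --> (0 : 'rV[R]_n).
  have c1 : (fun t : R => t *: v) @ nbhs (0 : R) --> (0 : R) *: v.
    by apply: cvgZr_tmp; exact: cvg_id.
  by rewrite scale0r in c1.
exact: (c0 _ H).
Qed.

Lemma local_max_hessian A phi z : open A -> A z -> CkO 2 A phi ->
  (\forall x \near z, phi x <= phi z) -> nonneg_def (- hessian phi z).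
Proof.
move=> oA Az cphi H; apply: hessian_nonpos cphi _ => //.
have c0 (s : R) : (fun h : 'rV[R]_n => z + s *: h) @ nbhs (0 : 'rV[R]_n) --> z.
  have c1 : (fun h : 'rV[R]_n => z + s *: h) @ nbhs (0 : 'rV[R]_n) --> z + s *: 0.
    by apply: cvgD; [exact: cvg_cst|apply: cvgZr; exact: cvg_id].
  by rewrite scaler0 addr0 in c1.
have N1 : \forall h \near (0 : 'rV[R]_n), phi (z + 1 *: h) <= phi z := c0 1 _ H.
have N2 : \forall h \near (0 : 'rV[R]_n), phi (z + (-1) *: h) <= phi z := c0 (-1) _ H.
apply: (@filterS2 _ (nbhs (0 : 'rV[R]_n)) (nbhs_filter _) _ _ _ _ N1 N2) => h.
by rewrite scale1r scaleN1r mulrDl !mul1r; exact: lerD.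
Qed.

Lemma elliptic_mono (F : 'M[R]_n -> R) (M N : 'M[R]_n) : uniformly_elliptic F ->
  symmx M -> nonneg_def (N - M) -> F M <= F N.
Proof.
move=> [C [C1 H]] sM hN; have /andP[H1 _] := H M (N - M) sM hN.
rewrite [M + (N - M)]addrC subrK in H1; rewrite -subr_ge0; apply: le_trans H1.
by rewrite mulr_ge0// invr_ge0; exact: le_trans C1.
Qed.

End HessianOrder.

(** * Oddness and continuity of the quotient *)

Section CubicQuotient.
Variables (R : realType) (A : 'M[R]_(11, 12)).
Hypothesis Aisom : forall a b : 'rV[R]_11, dot (a *m A) (b *m A) = dot a b.

Local Notation W := (cubic_over_norm (pullback A)).

Lemma cubic_over_norm_odd x : W (- x) = - W x.
Proof.
rewrite /cubic_over_norm inv_normN /pullback mulNmx /polar.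
have E m : qcoord (- (x *m A)) m = qscale (-1) (qcoord (x *m A) m).
  by rewrite /qcoord /qscale !mxE /= !mulN1r.
by rewrite !E !triple_scale1 !triple_scale2 !triple_scale3; ring.
Qed.

(** Serves for continuity at 0, where the value is 0 by oddness. *)
Lemma cubic_over_norm_le x : `|W x| <= dot x x.
Proof.
have [->|x0] := eqVneq x 0.
  have -> : W 0 = 0.
    by have := cubic_over_norm_odd 0; rewrite oppr0; move: (W 0); clear => u; lra.
  by rewrite normr0 dot_ge0.
have p : 0 < dot x x by rewrite lt_neqAle dot_ge0 eq_sym dot_eq0 x0.
have B := polar_bound (x *m A) (x *m A); rewrite Aisom in B.
rewrite -(@ler_pXn2r _ 2)// ?nnegrE ?(ltW p)// real_normK ?num_real//.
have -> : W x ^+ 2 = (polar (x *m A) (x *m A) (x *m A) / 2) ^+ 2 / 9 * (dot x x)^-1.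
  rewrite /cubic_over_norm /inv_norm /pullback exprMn exprVn sqr_sqrtr ?dot_ge0//.
  by field; rewrite gt_eqF.
rewrite ler_pdivrMr// ler_pdivrMr//; apply: le_trans B _.
have p3 : 0 <= dot x x ^+ 3 by rewrite exprn_ge0// ltW.
have -> : dot x x * (dot x x ^+ 2 / 3) = dot x x ^+ 3 / 3 by field.
have -> : dot x x ^+ 2 * dot x x * 9 = dot x x ^+ 3 * 9 by ring.
by move: p3; move: (_ ^+ 3); clear => u; lra.
Qed.

Lemma cubic_over_norm_continuous : continuous W.
Proof.
move=> x; have [->|x0] := eqVneq x 0; last first.
  exact: CkO_cont (CkO_cubic_over_norm (@pullback_smooth R A) 0) x0.
have W0 : W 0 = 0.
  by have := cubic_over_norm_odd 0; rewrite oppr0; move: (W 0); clear => u; lra.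
apply/(@cvgrPdist_lt _ _ _ (nbhs (0 : 'rV[R]_11)) (nbhs_filter _)) => e e0.
have cd := @continuous_dot _ _ _ (nbhs (0 : 'rV[R]_11)) (nbhs_filter _) id id 0 0 cvg_id cvg_id.
have N := @cvgr_dist_lt _ _ _ (nbhs (0 : 'rV[R]_11)) (nbhs_filter _) _ _ cd _ e0.
apply: (@filterS _ (nbhs (0 : 'rV[R]_11)) (nbhs_filter _) _ _ _ N) => y.
have -> : dot (0 : 'rV[R]_11) 0 = 0 by apply/eqP; rewrite dot_eq0.
rewrite W0 !sub0r !normrN => H; apply: le_lt_trans (cubic_over_norm_le y) _.
exact: le_lt_trans (ler_norm _) H.
Qed.

End CubicQuotient.

Lemma viscosity_cubic_over_norm (R : realType) (A : 'M[R]_(11, 12)) (F : 'M[R]_11 -> R)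
    (Omega : set 'rV[R]_11) :
  (forall a b : 'rV[R]_11, dot (a *m A) (b *m A) = dot a b) ->
  uniformly_elliptic F -> F 0 = 0 ->
  (forall x : 'rV[R]_11, x != 0 -> F (hessian (cubic_over_norm (pullback A)) x) = 0) ->
  viscosity_solution F Omega (cubic_over_norm (pullback A)).
Proof.
move=> Aisom Fell F0 Ff; set W := cubic_over_norm (pullback A).
have Wc := cubic_over_norm_continuous Aisom.
have Wodd y : W (- y) = - W y := cubic_over_norm_odd A y.
split; first exact: continuous_subspaceT.
move=> x phi _ [U [oU Ux /(Ck_CkO oU) cphi]].
have sphi := hessian_symmx oU Ux cphi.
have [xE|x0] := eqVneq x 0.
  (* Touching at 0 from one side, [phi] is compared with [W] at [h] and at [- h]; as [W] is odd, the
     sum bounds the second difference of [phi]. *)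
  rewrite xE in Ux sphi *.
  have W0 : W 0 = 0.
    by have := Wodd 0; rewrite oppr0; move: (W 0); clear => u; lra.
  have s0 : symmx (0 : 'M[R]_11) by rewrite /symmx /= trmx0.
  have cc : CkO 2 U (fun=> 0 : R) by exact: CkO_cst.
  have cn : (fun h : 'rV[R]_11 => - h) @ nbhs (0 : 'rV[R]_11) --> (0 : 'rV[R]_11).
    by have := @cvgN _ _ _ (nbhs (0 : 'rV[R]_11)) _ _ _ cvg_id; rewrite oppr0; apply.
  split=> H; rewrite W0 in H.
    have H2 : \forall h \near (0 : 'rV[R]_11), W (- h) - phi (- h) <= 0 - phi 0 := cn _ H.
    have cpsi : CkO 2 U (fun x => 0 - phi x) by exact: CkO_sub2.
    have N : nonneg_def (- hessian (fun x => 0 - phi x) 0).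
      apply: (hessian_nonpos oU Ux cpsi).
      apply: (@filterS2 _ (nbhs (0 : 'rV[R]_11)) (nbhs_filter _) _ _ _ _ H H2) => h.
      rewrite /= Wodd (add0r h) (sub0r h).
      by move: (W h) (phi h) (phi (- h)) (phi 0); clear => *; lra.
    rewrite (hessian_sub oU Ux cc cphi) hessian_cst sub0r opprK -[hessian phi 0]subr0 in N.
    by have := elliptic_mono Fell s0 N; rewrite F0.
  have H2 : \forall h \near (0 : 'rV[R]_11), 0 - phi 0 <= W (- h) - phi (- h) := cn _ H.
  have N : nonneg_def (- hessian phi 0).
    apply: (hessian_nonpos oU Ux cphi).
    apply: (@filterS2 _ (nbhs (0 : 'rV[R]_11)) (nbhs_filter _) _ _ _ _ H H2) => h.
    rewrite /= Wodd (add0r h) (sub0r h).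
    by move: (W h) (phi h) (phi (- h)) (phi 0); clear => *; lra.
  by rewrite -sub0r in N; have := elliptic_mono Fell sphi N; rewrite F0.
pose B := U `&` [set x : 'rV[R]_11 | x != 0].
have oB : open B by apply: openI => //; exact: open_nz.
have Bx : B x by [].
have cphiB : CkO 2 B phi by apply: CkO_sub cphi; exact: subIsetl.
have cWB : CkO 2 B W.
  by apply: CkO_sub (CkO_cubic_over_norm (@pullback_smooth R A) 2); exact: subIsetr.
have sW := hessian_symmx oB Bx cWB.
split=> H.
  have N := local_max_hessian oB Bx (CkO_sub2 oB cWB cphiB) H.
  rewrite (hessian_sub oB Bx cWB cphiB) opprB in N.
  by apply: (le_trans _ (elliptic_mono Fell sW N)); rewrite Ff.
have H2 : \forall y \near x, phi y - W y <= phi x - W x.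
  by apply: (@filterS _ (nbhs x) (nbhs_filter _) _ _ _ H) => y; rewrite -lerN2 !opprB.
have N := local_max_hessian oB Bx (CkO_sub2 oB cphiB cWB) H2.
rewrite (hessian_sub oB Bx cphiB cWB) opprB in N.
by apply: le_trans (elliptic_mono Fell sphi N) _; rewrite Ff.
Qed.

Theorem corollary1p2 (R : realType) (H : {vspace 'rV[R]_12})
    (hH : (\dim H)%VS = 11%N)
    (iota : 'Hom('rV[R]_11, 'rV[R]_12)) (hiota : isometry_onto iota H) :
  exists F : 'M[R]_11 -> R,
    [/\ smooth_on_sym F,
        uniformly_elliptic F &
        viscosity_solution F (@unit_eball R 11) (fun y => w (iota y))].
Proof.
pose A := lin1_mx iota; have AE y : y *m A = iota y by exact: mul_rV_lin1.
have enormE n (x : 'rV[R]_n) : enorm x = Num.sqrt (dot x x).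
  by congr Num.sqrt; apply: eq_bigr => i _; rewrite expr2.
have norm_iota y : dot (y *m A) (y *m A) = dot y y.
  have := hiota.2 y; rewrite !enormE AE => E.
  by rewrite -(sqr_sqrtr (dot_ge0 (iota y))) E sqr_sqrtr ?dot_ge0.
(* Preservation of lengths is polarized. *)
have Aisom (a b : 'rV[R]_11) : dot (a *m A) (b *m A) = dot a b.
  have := norm_iota (a + b); rewrite mulmxDl !(dotDl, dotDr) !norm_iota.
  rewrite (dotC (b *m A)) (dotC b a); move: (dot _ _) (dot _ _) (dot a _) (dot a _); clear => *; lra.
pose W := cubic_over_norm (pullback A).
(* At 0 both sides are 0: [w] by definition, the quotient because [0^-1 = 0]. *)
have wE : (fun y => w (iota y)) = W.
  apply/funext => y; rewrite /W /cubic_over_norm /inv_norm /w -norm_iota /pullback polar_diag AE.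
  rewrite enormE /triple; case: eqP => [->|_]; last first.
    by rewrite [6 * _]mulrC mulfK// pnatr_eq0.
  have -> : dot (0 : 'rV[R]_12) 0 = 0 by apply/eqP; rewrite dot_eq0.
  by rewrite sqrtr0 invr0 mulr0.
have sphere : exists a : 'rV[R]_11, dot a a = 1.
  exists (delta_mx 0 0); rewrite /dot (bigD1 ord0)//= big1 ?addr0; first by rewrite !mxE !eqxx mulr1.
  by move=> i i0; rewrite !mxE (negbTE i0) andbF mulr0.
have L := @pullback_linear R A; have C1 := @pullbackC12 R A; have C2 := @pullbackC23 R A.
have S := @pullback_smooth R A.
have [F [Fs Fe F0 Ff]] := @exists_elliptic_operator R 11 (hessian W) (CkO_hessian S)
  (fun t x => @hessian_homog R 11 _ L C1 C2 t x) (fun x => @hessian_odd R 11 _ L C1 C2 x)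
  (pullback_secant Aisom) (pullback_tangent Aisom) sphere.
exists F; split=> //; first by move=> k; exact: CkO_Ck.
by rewrite wE; exact: viscosity_cubic_over_norm.
Qed.
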